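(* Let $n\ge1$ be an integer and $s\in(0,1)$. There is a constant $\kappa(n,s)$ depending only on $n$ and $s$ such that the following holds for every $r>0$ and all $x,z\in B_r$ with $x\neq z$, where $G$ is the Green function of the ball $B_r$. If $n\neq 2s$, then $$G(x,z)=\kappa(n,s)\,|z-x|^{2s-n}\int_0^{r_0(x,z)}\frac{t^{s-1}}{(t+1)^{\frac n2}}\,dt,\qquad\text{where}\quad r_0(x,z)=\frac{(r^2-|x|^2)(r^2-|z|^2)}{r^2|x-z|^2}.$$ If $n=2s$ (that is, $n=1$ and $s=\frac12$), then $$G(x,z)=\kappa\Big(1,\frac12\Big)\log\bigg(\frac{r^2-xz+\sqrt{(r^2-x^2)(r^2-z^2)}}{r|z-x|}\bigg).$$
   Context: $B_r=\{x\in\mathbb{R}^n:|x|<r\}$. For $x\in\mathbb{R}^n\setminus\{0\}$, $$\Phi(x):=\begin{cases}a(n,s)\,|x|^{-n+2s}& \text{if } n\ne2s,\\ a(1,\frac12)\log|x| & \text{if } n=2s,\end{cases}\qquad a(n,s):=\frac{\Gamma(\frac n2-s)}{2^{2s}\pi^{\frac n2}\Gamma(s)}\ (n\neq2s),\qquad a\Big(1,\frac12\Big):=-\frac1\pi,$$ where $\Gamma$ is the Gamma function, extended to negative non-integer arguments. For $x\in B_r$ and $y\in\mathbb{R}^n\setminus\overline B_r$, $$P_r(y,x):=c(n,s)\Big(\frac{r^2-|x|^2}{|y|^2-r^2}\Big)^s\frac1{|x-y|^n},\qquad c(n,s):=\frac{\Gamma(\frac n2)\sin(\pi s)}{\pi^{\frac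 n2+1}}.$$ For $x,z\in B_r$, $x\ne z$, the Green function is $$G(x,z):=\Phi(x-z)-\int_{\mathbb{R}^n\setminus B_r}\Phi(z-y)\,P_r(y,x)\,dy.$$ *)

(* Defs.v *)
From HB Require Import structures.
From mathcomp Require Import all_boot all_order all_algebra.
From mathcomp Require Import all_classical all_reals all_analysis.

Set Implicit Arguments.
Unset Strict Implicit.
Unset Printing Implicit Defensive.

Import Order.TTheory GRing.Theory Num.Theory.
Import numFieldNormedType.Exports.

Local Open Scope classical_set_scope.
Local Open Scope ring_scope.

(* ['rV[R]_n] models R^n.  The library's norm on matrices is the max norm, so
   the Euclidean one has to be defined.  In dimension 1, [dotv x y] is the
   product of the two reals x and y, and [enorm] the absolute value. *)
Definition dotv (R : realType) (n : nat) (x y : 'rV[R]_n) : R :=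
  \sum_(i < n) x 0 i * y 0 i.

Definition enorm (R : realType) (n : nat) (x : 'rV[R]_n) : R :=
  Num.sqrt (\sum_(i < n) x 0 i ^+ 2).

Definition eball (R : realType) (n : nat) (r : R) : set 'rV[R]_n :=
  [set x | enorm x < r].
Arguments eball {R n} r.

Definition rV_display : measure_display.
Proof. exact: default_measure_display. Qed.

Definition rV_coord (R : realType) (n : nat) (i : 'I_n) (v : 'rV[R]_n) :
  measurableTypeR R := v 0 i.

Section measurable_rV.
Variables (R : realType) (n : nat).

Let rV_set0 : g_sigma_preimage (@rV_coord R n) set0.
Proof. exact: sigma_algebra0. Qed.

Let rV_setC A :
  g_sigma_preimage (@rV_coord R n) A -> g_sigma_preimage (@rV_coord R n) (~` A).
Proof. exact: sigma_algebraC. Qed.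

Let rV_bigcup (F : (set 'rV[R]_n)^nat) :
  (forall i, g_sigma_preimage (@rV_coord R n) (F i)) ->
  g_sigma_preimage (@rV_coord R n) (\bigcup_i (F i)).
Proof. exact: sigma_algebra_bigcup. Qed.

HB.instance Definition _ := @isMeasurable.Build rV_display
  'rV[R]_n (g_sigma_preimage (@rV_coord R n)) rV_set0 rV_setC rV_bigcup.

End measurable_rV.

Definition rV_cons (R : realType) (n : nat)
    (p : 'rV[R]_n * measurableTypeR R) : 'rV[R]_n.+1 :=
  \row_i (if unlift ord0 i is Some j then p.1 0 j else p.2).

(* n-dimensional Lebesgue measure, as an iterated product measure. *)
Fixpoint lebesgue_rV (R : realType) (n : nat) : set 'rV[R]_n -> \bar R :=
  match n with
  | 0%N => \d_(0 : 'rV[R]_0)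
  | m.+1 => pushforward (@lebesgue_rV R m \x @lebesgue_measure R)%E
              (@rV_cons R m)
  end.
Arguments lebesgue_rV {R n}.

Section lebesgue_rV_theory.
Variable R : realType.

Lemma measurable_rV_coord n (i : 'I_n) :
  measurable_fun [set: 'rV[R]_n] (@rV_coord R n i).
Proof.
move=> _ Y mY; rewrite setTI; apply: sub_sigma_algebra => /=.
rewrite -bigcup_seq/=; exists i => /=; first by rewrite mem_index_enum.
by exists Y => //; rewrite setTI.
Qed.

Lemma measurable_fun_rVP d (T : measurableType d) n (f : T -> 'rV[R]_n) :
  (forall i, measurable_fun [set: T] (@rV_coord R n i \o f)) ->
  measurable_fun [set: T] f.
Proof.
move=> mf; apply: (@measurability _ _ _ _ _ _
  (\big[setU/set0]_(i < n)
     preimage_set_system [set: 'rV[R]_n] (@rV_coord R n i) measurable)) => //.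
move=> _ [A + <-].
rewrite -bigcup_seq/= => -[i _ [B mB <-]].
by rewrite !setTI -comp_preimage -[X in measurable X]setTI; exact: mf.
Qed.

Lemma measurable_rV_cons n : measurable_fun setT (@rV_cons R n).
Proof.
apply: measurable_fun_rVP => i; case: (unliftP ord0 i) => [j ->|->].
- rewrite (_ : _ \o _ = @rV_coord R n j \o fst); last first.
    by apply/funext => p /=; rewrite /rV_coord mxE liftK.
  by apply: measurableT_comp => //; exact: measurable_rV_coord.
- rewrite (_ : _ \o _ = snd) //.
  by apply/funext => p /=; rewrite /rV_coord mxE unlift_none.
Qed.

Lemma lebesgue_rV_is_measure n :
  exists m : {measure set 'rV[R]_n -> \bar R}, @lebesgue_rV R n = m.
Proof.
elim: n => [|n [m Hm]] /=; first by exists (dirac (0 : 'rV[R]_0)).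
rewrite Hm.
have mc := @measurable_rV_cons n.
pose mu : {measure set _ -> \bar R} := (m \x @lebesgue_measure R)%E.
pose M := HB.pack_for {measure set 'rV[R]_n.+1 -> \bar R}
  (pushforward mu (@rV_cons R n)).
by exists (M mc).
Qed.

Let lebesgue_rV0 n : @lebesgue_rV R n set0 = 0%E.
Proof. by have [m ->] := lebesgue_rV_is_measure n; rewrite measure0. Qed.

Let lebesgue_rV_ge0 n A : (0 <= @lebesgue_rV R n A)%E.
Proof. by have [m ->] := lebesgue_rV_is_measure n. Qed.

Let lebesgue_rV_sigma_additive n : semi_sigma_additive (@lebesgue_rV R n).
Proof.
have [m ->] := lebesgue_rV_is_measure n; exact: measure_semi_sigma_additive.
Qed.

HB.instance Definition _ n := isMeasure.Build _ _ _ (@lebesgue_rV R n)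
  (@lebesgue_rV0 n) (@lebesgue_rV_ge0 n) (@lebesgue_rV_sigma_additive n).

Lemma lebesgue_rV_box n (A : 'I_n -> set (measurableTypeR R)) :
  (forall i, measurable (A i)) ->
  lebesgue_rV [set v : 'rV[R]_n | forall i, A i (v 0 i)] =
  (\prod_(i < n) lebesgue_measure (A i))%E.
Proof.
elim: n A => [|n IH] A mA.
  by rewrite big_ord0 /= /dirac indicE mem_set //= => -[].
rewrite big_ord_recl /= /pushforward.
rewrite (_ : _ @^-1` _ =
  [set v : 'rV[R]_n | forall i, A (lift ord0 i) (v 0 i)] `*` A ord0).
  rewrite product_measure1E //; last first.
    rewrite (_ : [set _ | _] =
      \bigcap_(i in [set: 'I_n]) (@rV_coord R n i @^-1` A (lift ord0 i))).
      apply: fin_bigcap_measurable => // i _.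
      by rewrite -[X in measurable X]setTI; exact: measurable_rV_coord.
    by apply/seteqP; split => v /= H i; [move=> _|]; exact: H.
  by rewrite muleC; congr mule; exact: (IH (fun j => A (lift ord0 j))).
apply/seteqP; split => -[v a] /= => [H|[H Ha] i].
  split=> [i|]; [have := H (lift ord0 i)|have := H ord0].
  - by rewrite /rV_cons mxE liftK.
  - by rewrite /rV_cons mxE unlift_none.
by rewrite /rV_cons mxE; case: (unliftP ord0 i) => [j|] ->.
Qed.

End lebesgue_rV_theory.

Section green_function.
Variable R : realType.
Local Notation mu := (@lebesgue_measure R).

Definition Gamma_pos (x : R) : R :=
  \int[mu]_(t in `[0, +oo[) (t `^ (x - 1) * expR (- t)).

(* For [x <= 0], [Gamma] is extended by the functional equation
   Gamma (x + 1) = x * Gamma x; the values at non-positive integers are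
   meaningless. *)
Definition Gamma (x : R) : R :=
  if 0 < x then Gamma_pos x
  else let k := (Num.truncn (- x)).+1 in
       Gamma_pos (x + k%:R) / \prod_(i < k) (x + i%:R).

Definition a_const (n : nat) (s : R) : R :=
  if n%:R == 2 * s then - pi^-1
  else Gamma (n%:R / 2 - s) / (2 `^ (2 * s) * pi `^ (n%:R / 2) * Gamma s).

Definition c_const (n : nat) (s : R) : R :=
  Gamma (n%:R / 2) * sin (pi * s) / pi `^ (n%:R / 2 + 1).

Definition Phi (n : nat) (s : R) (x : 'rV[R]_n) : R :=
  if n%:R == 2 * s then a_const n s * ln (enorm x)
  else a_const n s * enorm x `^ (- n%:R + 2 * s).

(* Meaningful for |x| < r < |y|.  On the sphere |y| = r, which has measure
   zero, the formula evaluates to 0 because division by 0 returns 0. *)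
Definition Poisson (n : nat) (s r : R) (y x : 'rV[R]_n) : R :=
  c_const n s * ((r ^+ 2 - enorm x ^+ 2) / (enorm y ^+ 2 - r ^+ 2)) `^ s
    * (enorm (x - y) ^+ n)^-1.

(* Extended-real valued, so that the value is finite only if the integral
   converges. *)
Definition Green (n : nat) (s r : R) (x z : 'rV[R]_n) : \bar R :=
  ((Phi s (x - z))%:E
    - \int[lebesgue_rV]_(y in ~` eball r) (Phi s (z - y) * Poisson s r y x)%:E)%E.

Definition r0 (n : nat) (r : R) (x z : 'rV[R]_n) : R :=
  (r ^+ 2 - enorm x ^+ 2) * (r ^+ 2 - enorm z ^+ 2)
    / (r ^+ 2 * enorm (x - z) ^+ 2).

End green_function.

(* Main.v *)
(** Put [D = r^2 - |x|^2].  The inversion [y = x - D (y' - x) / |y' - x|^2]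
    exchanges the ball with its exterior and, for [n <> 2 s], turns
    [Phi (z - y) P_r (y, x) dy] into a constant multiple of
    [(r^2 - |y'|^2)^(- s) |w - y'|^(2 s - n) dy'], where the image [w] of [z]
    lies outside the ball and satisfies [|w|^2 = r^2 (1 + r_0)].  Hence everything
    reduces to the Riesz potential of the density [(r^2 - |y'|^2)^(- s)] at [w].

    For [n > 2 s] the potential, as a function of [v = r^2] for a fixed [w], has
    a Laplace transform that Gaussian subordination makes explicit; it is also
    the transform of a multiple of the Beta integral restricted to [t > r_0].
    Uniqueness of the transform identifies the two, the full Beta integral cancels
    [Phi (x - z)] by the reflection formula for [Gamma], and what remains is the
    integral over [0 <= t <= r_0].

    For [n = 1 <= 2 s] one moves [w] along [|w| = r sqrt (1 + t)] from the boundary: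
    the derivative of the potential in [t] is an explicit multiple of
    [t^(s - 1) (1 + t)^(- 1 / 2)].  When [2 s = 1] the logarithmic potential of the
    density at the interior point [x] is also needed; it does not depend on [x],
    since in the variable [q] with [y = r (1 - q^2) / (1 + q^2)] it is an integral
    invariant under the rotations of the projective line. *)

From HB Require Import structures.
Require Import Defs.
From mathcomp Require Import all_boot all_order all_algebra.
From mathcomp Require Import all_classical all_reals all_analysis.
From mathcomp Require Import measurable_realfun ring lra.
Import Order.TTheory GRing.Theory Num.Theory.
Import numFieldNormedType.Exports.
Local Open Scope classical_set_scope.
Local Open Scope ring_scope.

(** * Measurability and integrals on the line *)

(** Every nonlinear change of variables, and the functional equation of [Gamma], is derived from
    affine invariance of Lebesgue measure and Tonelli, by inserting an exponential of mass 1.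
    Tonelli wants nonnegative integrands, hence the extended reals: finiteness comes last, by
    comparison with a Beta integral. The Laplace variable is [v = r^2] because the density
    [(v - |y|^2)^(- s)], continued by 0, then transforms into a Gaussian in [y], whose integral
    against the Gaussians that make up the kernel is explicit in every dimension. Subordination
    requires [n / 2 - s > 0], and this is what separates the case [n = 1 <= 2 s]. For a power, the
    factor [|y - x|] that the inversion produces in [Phi (z - y)] cancels against the Poisson
    kernel. For the logarithm it survives as an additive term [ln |y - x|]; this is how the
    potential at the interior point enters. The constants [a(n,s)] and [c(n,s)] fit together through
    [sin (pi s) Gamma s Gamma (1 - s) = pi], which is obtained by pinching Cauchy's integrals of
    [cos (2 s x) cos(x)^(2 N)] between Wallis integrals. *)

Section measurability.
Context d (T : measurableType d) (R : realType).
Implicit Types (D : set T) (f g : T -> R).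

Lemma mfM D f g : measurable_fun D f -> measurable_fun D g ->
  measurable_fun D (fun x => f x * g x).
Proof. exact: measurable_funM. Qed.

Lemma mfD D f g : measurable_fun D f -> measurable_fun D g ->
  measurable_fun D (fun x => f x + g x).
Proof. exact: measurable_funD. Qed.

Lemma mfDe D (f g : T -> \bar R) : measurable_fun D f -> measurable_fun D g ->
  measurable_fun D (fun x => f x + g x)%E.
Proof. exact: emeasurable_funD. Qed.

Lemma mfMe D (f g : T -> \bar R) : measurable_fun D f -> measurable_fun D g ->
  measurable_fun D (fun x => f x * g x)%E.
Proof. exact: emeasurable_funM. Qed.

Lemma mfN D f : measurable_fun D f -> measurable_fun D (fun x => - f x).
Proof. exact: measurable_funN. Qed.

Lemma mf_expR D f : measurable_fun D f -> measurable_fun D (fun x => expR (f x)).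
Proof. by move=> mf; apply: (measurableT_comp (@measurable_expR R)). Qed.

Lemma mf_ln D f : measurable_fun D f -> measurable_fun D (fun x => ln (f x)).
Proof. by move=> mf; apply: (measurableT_comp (@measurable_ln R)). Qed.

Lemma mf_powR D f (p : R) : measurable_fun D f ->
  measurable_fun D (fun x => f x `^ p).
Proof. by move=> mf; apply: (measurableT_comp (measurable_powR p)). Qed.

Lemma mf_norm D f : measurable_fun D f -> measurable_fun D (fun x => `|f x|).
Proof. by move=> mf; apply: measurableT_comp. Qed.

Lemma mf_sqrt D f : measurable_fun D f ->
  measurable_fun D (fun x => Num.sqrt (f x)).
Proof.
move=> mf; apply: (measurableT_comp _ mf).
by apply: continuous_measurable_fun; exact: sqrt_continuous.
Qed.

Lemma mf_inv D f : measurable_fun D f -> measurable_fun D (fun x => (f x)^-1).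
Proof.
(* Written as [f |f|^(-2)], the inverse involves only the measurable [powR]; at a zero of [f] both
   sides are 0. *)
move=> mf; rewrite (_ : (fun _ => _) = fun x => f x * `|f x| `^ (- 2)).
  by apply: mfM => //; apply/mf_powR/mf_norm.
apply/funext => x; have [->|fx0] := eqVneq (f x) 0; first by rewrite invr0 mul0r.
rewrite powRN -[2]/(2%:R) powR_mulrn// real_normK ?num_real// expr2 invfM mulrA.
by rewrite divff ?mul1r.
Qed.

Lemma mf_if D (b : T -> bool) f g : measurable D -> measurable_fun D b ->
  measurable_fun D f -> measurable_fun D g ->
  measurable_fun D (fun x => if b x then f x else g x).
Proof.
move=> mD mb mf mg; apply: measurable_fun_if => //.
- by apply: measurable_funS mf => //; exact: subIsetl.
- by apply: measurable_funS mg => //; exact: subIsetl.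
Qed.

Lemma mf_ife D (b : T -> bool) (f g : T -> \bar R) : measurable D -> measurable_fun D b ->
  measurable_fun D f -> measurable_fun D g ->
  measurable_fun D (fun x => if b x then f x else g x).
Proof.
move=> mD mb mf mg; apply: measurable_fun_if => //.
- by apply: measurable_funS mf => //; exact: subIsetl.
- by apply: measurable_funS mg => //; exact: subIsetl.
Qed.

End measurability.

Section measurable_rV.
Context d (T : measurableType d) (R : realType) (n : nat).
Implicit Types g h : T -> 'rV[R]_n.

Lemma mf_coord g i : measurable_fun setT g ->
  measurable_fun setT (fun x => g x 0 i : R).
Proof. by move=> mg; apply: (measurableT_comp (@measurable_rV_coord R n i) mg). Qed.

Lemma mf_rVP g : (forall i, measurable_fun setT (fun x => g x 0 i : R)) ->
  measurable_fun setT g.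
Proof. by move=> mg; apply: measurable_fun_rVP => i; exact: mg. Qed.

Lemma mf_rVD g h : measurable_fun setT g -> measurable_fun setT h ->
  measurable_fun setT (fun x => g x + h x).
Proof.
move=> mg mh; apply: mf_rVP => i.
under eq_fun do rewrite mxE.
by apply: mfD; exact: mf_coord.
Qed.

Lemma mf_rVN g : measurable_fun setT g -> measurable_fun setT (fun x => - g x).
Proof.
move=> mg; apply: mf_rVP => i.
under eq_fun do rewrite mxE.
by apply: mfN; exact: mf_coord.
Qed.

Lemma mf_rVZ (c : T -> R) g : measurable_fun setT c -> measurable_fun setT g ->
  measurable_fun setT (fun x => c x *: g x).
Proof.
move=> mc mg; apply: mf_rVP => i.
under eq_fun do rewrite mxE.
by apply: mfM => //; exact: mf_coord.
Qed.

Lemma mf_enorm g : measurable_fun setT g ->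
  measurable_fun setT (fun x => enorm (g x)).
Proof.
move=> mg; apply: mf_sqrt; apply: measurable_sum => i.
by apply: measurable_funX; exact: mf_coord.
Qed.

End measurable_rV.

(** Sums of reals, extended reals and row vectors share one head symbol, so the codomain of the
    function selects the closure lemma. *)
Ltac is_ereal_valued f :=
  lazymatch type of f with _ -> ?B =>
    let B' := eval hnf in B in
    lazymatch B' with extended _ => idtac | _ => fail end
  end.

Ltac is_matrix_valued f :=
  lazymatch type of f with _ -> ?B =>
    let B' := eval hnf in B in
    lazymatch B' with matrix _ _ _ => idtac | _ => fail end
  end.

Ltac mf_leaf :=
  match goal with
  | H : measurable_fun setT ?f |- measurable_fun _ (fun x => ?f _) =>
      apply: (measurableT_comp H)
  | |- _ => assumption
  | |- _ => first [exact: measurable_cst | exact: measurable_id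
    | exact: measurable_fst | exact: measurable_snd]
  end.

Ltac mf_step :=
  lazymatch goal with
  | |- measurable_fun _ (fun _ => ?c) => exact: measurable_cst
  | |- measurable_fun _ (fun x => x) => exact: measurable_id
  | |- measurable_fun _ (fun x => x.1) => exact: measurable_fst
  | |- measurable_fun _ (fun x => x.2) => exact: measurable_snd
  | |- measurable_fun _ fst => exact: measurable_fst
  | |- measurable_fun _ snd => exact: measurable_snd
  | |- measurable_fun _ (fun _ => EFin _) => apply/measurable_EFinP
  | |- measurable_fun _ EFin => apply/measurable_EFinP
  | |- measurable_fun _ (EFin \o _) => apply/measurable_EFinP
  | |- measurable_fun _ (fun _ => mule _ _) => apply: mfMe
  | |- measurable_fun _ (fun _ => if _ then _ else _) =>
      first [apply: mf_if; [first [exact: measurableT|exact: measurable_itv|done]| | |]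
            |apply: mf_ife; [first [exact: measurableT|exact: measurable_itv|done]| | |]]
  | |- measurable_fun _ (fun _ => _ && _) => apply: measurable_and
  | |- measurable_fun _ (fun _ => ~~ _) => apply: measurable_neg
  | |- measurable_fun _ (fun _ => @Order.lt _ _ _ _) => apply: measurable_fun_ltr
  | |- measurable_fun _ (fun _ => @Order.le _ _ _ _) => apply: measurable_fun_ler
  | |- measurable_fun _ (@Order.lt _ _ _) => apply: measurable_fun_ltr
  | |- measurable_fun _ (@Order.le _ _ _) => apply: measurable_fun_ler
  | |- measurable_fun _ (fun _ => enorm _) => apply: mf_enorm
  | |- measurable_fun _ (@enorm _ _) => apply: mf_enorm; exact: measurable_id
  | |- measurable_fun _ (fun _ => @GRing.scale _ _ _ _) => apply: mf_rVZ
  | |- measurable_fun _ (@GRing.scale _ _ _) => apply: mf_rVZ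
  | |- measurable_fun _ (fun _ => @GRing.add _ _ _) =>
      lazymatch goal with |- measurable_fun _ ?f =>
        first [is_ereal_valued f; apply: mfDe | is_matrix_valued f; apply: mf_rVD
              | apply: mfD] end
  | |- measurable_fun _ (@GRing.add _ _) =>
      lazymatch goal with |- measurable_fun _ ?f =>
        first [is_matrix_valued f; apply: mf_rVD | apply: mfD] end
  | |- measurable_fun _ (fun _ => @GRing.opp _ _) =>
      lazymatch goal with |- measurable_fun _ ?f =>
        first [is_matrix_valued f; apply: mf_rVN | apply: mfN] end
  | |- measurable_fun _ (@GRing.opp _) =>
      lazymatch goal with |- measurable_fun _ ?f =>
        first [is_matrix_valued f; apply: mf_rVN | exact: oppr_measurable] end
  | |- measurable_fun _ (fun _ => @GRing.mul _ _ _) => apply: mfM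
  | |- measurable_fun _ (@GRing.mul _ _) => apply: mfM
  | |- measurable_fun _ (fun _ => @GRing.inv _ _) => apply: mf_inv
  | |- measurable_fun _ (@GRing.inv _) => apply: mf_inv; exact: measurable_id
  | |- measurable_fun _ (fun _ => @GRing.exp _ _ _) => apply: measurable_funX
  | |- measurable_fun _ (fun _ => expR _) => apply: mf_expR
  | |- measurable_fun _ expR => exact: measurable_expR
  | |- measurable_fun _ (fun _ => ln _) => apply: mf_ln
  | |- measurable_fun _ ln => exact: measurable_ln
  | |- measurable_fun _ (fun _ => powR _ _) => apply: mf_powR
  | |- measurable_fun _ (fun _ => Num.sqrt _) => apply: mf_sqrt
  | |- measurable_fun _ Num.sqrt => apply: mf_sqrt; exact: measurable_id
  | |- measurable_fun _ (fun _ => `| _ |) => apply: mf_norm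
  | |- measurable_fun _ (@Num.norm _ _) => exact: normr_measurable
  | |- measurable_fun _ _ => mf_leaf
  | |- measurable _ => first [exact: measurableT|exact: measurable_itv|done]
  end.

Ltac mf := repeat mf_step.

(** * Tonelli on products of measurable sets *)

Section tonelli.
Local Open Scope ereal_scope.
Context d1 d2 (T1 : measurableType d1) (T2 : measurableType d2) (R : realType).
Variables (m1 : {sigma_finite_measure set T1 -> \bar R}).
Variables (m2 : {sigma_finite_measure set T2 -> \bar R}).

Lemma tonelli_in (D1 : set T1) (D2 : set T2) (f : T1 -> T2 -> \bar R) :
  measurable D1 -> measurable D2 ->
  measurable_fun (D1 `*` D2) (fun z : T1 * T2 => f z.1 z.2) ->
  (forall x y, D1 x -> D2 y -> 0 <= f x y) ->
  \int[m1]_(x in D1) \int[m2]_(y in D2) f x y =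
  \int[m2]_(y in D2) \int[m1]_(x in D1) f x y.
Proof.
move=> mD1 mD2 mf f0.
pose F := (fun z : T1 * T2 => f z.1 z.2) \_ (D1 `*` D2).
have mF : measurable_fun setT F.
  by apply/(measurable_restrictT _ _).1 => //; exact: measurableX.
have F0 z : 0 <= F z by apply: erestrict_ge0 => -[x y] []; exact: f0.
transitivity (\int[m1]_x \int[m2]_y F (x, y)).
  rewrite integral_mkcond; apply: eq_integral => x _.
  rewrite patchE; case: ifPn => xD1.
    rewrite integral_mkcond; apply: eq_integral => y _.
    by rewrite /F !patchE in_setX xD1.
  by rewrite integral0_eq// => y _; rewrite /F patchE in_setX (negbTE xD1).
rewrite fubini_tonelli//.
rewrite [RHS]integral_mkcond; apply: eq_integral => y _.
rewrite patchE; case: ifPn => yD2.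
  rewrite [RHS]integral_mkcond; apply: eq_integral => x _.
  by rewrite /F !patchE in_setX yD2 andbT.
by rewrite integral0_eq// => x _; rewrite /F patchE in_setX (negbTE yD2) andbF.
Qed.

Lemma measurable_integral_in (D1 : set T1) (D2 : set T2) (f : T1 -> T2 -> \bar R) :
  measurable D1 -> measurable D2 ->
  measurable_fun (D1 `*` D2) (fun z : T1 * T2 => f z.1 z.2) ->
  (forall x y, D1 x -> D2 y -> 0 <= f x y) ->
  measurable_fun D1 (fun x => \int[m2]_(y in D2) f x y).
Proof.
move=> mD1 mD2 mf f0.
pose F := (fun z : T1 * T2 => f z.1 z.2) \_ (D1 `*` D2).
have mF : measurable_fun setT F.
  by apply/(measurable_restrictT _ _).1 => //; exact: measurableX.
have F0 z : 0 <= F z by apply: erestrict_ge0 => -[x y] []; exact: f0.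
apply/(measurable_restrictT _ mD1).
rewrite (_ : _ \_ D1 = fun x => \int[m2]_y F (x, y)).
  exact: (@measurable_fun_fubini_tonelli_F _ _ _ _ _ m2 _ mF F0).
apply/funext => x; rewrite patchE; case: ifPn => xD1.
  rewrite integral_mkcond; apply: eq_integral => y _.
  by rewrite /F !patchE in_setX xD1.
by rewrite integral0_eq// => y _; rewrite /F patchE in_setX (negbTE xD1).
Qed.

End tonelli.

Lemma tonelli_mu (R : realType) (D1 D2 : set R) (f : R -> R -> \bar R) :
  measurable D1 -> measurable D2 ->
  measurable_fun (D1 `*` D2) (fun z : R * R => f z.1 z.2) ->
  (forall x y, D1 x -> D2 y -> 0 <= f x y)%E ->
  (\int[@lebesgue_measure R]_(x in D1) \int[@lebesgue_measure R]_(y in D2) f x y =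
  \int[@lebesgue_measure R]_(y in D2) \int[@lebesgue_measure R]_(x in D1) f x y)%E.
Proof.
move=> *.
exact: (@tonelli_in _ _ _ _ R (@lebesgue_measure R) (@lebesgue_measure R)).
Qed.

(** * Affine substitutions on the line *)

Section affine.
Local Open Scope ereal_scope.
Context {R : realType}.
Local Notation mu := (@lebesgue_measure R).

Lemma measurable_affine (c w : R) :
  measurable_fun setT (fun x : measurableTypeR R => (c * x + w)%R : measurableTypeR R).
Proof. by mf. Qed.

Let aff (c w : R) (x : measurableTypeR R) : measurableTypeR R := (c * x + w)%R.

(** Lebesgue measure is determined by its values on half-open intervals, where the scaled image
    measure agrees with it. *)
Let pushforward_affine (c w : R) A : (0 < c)%R -> measurable A ->
  mu A = c%:E * pushforward mu (aff c w) A.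
Proof.
move=> c0 mA.
pose M := HB.pack_for {measure set (measurableTypeR R) -> \bar R}
  (pushforward mu (aff c w)).
pose c' : {nonneg R} := NngNum (ltW c0).
rewrite -[RHS]/(mscale c' (M (measurable_affine c w)) A).
apply: lebesgue_measure_unique => // X [[a b] /= ab <-].
rewrite /mscale/= /pushforward.
rewrite (_ : _ @^-1` _ = `]((a - w) / c)%R, ((b - w) / c)%R]%classic); last first.
  apply/seteqP; split => x /=; rewrite !in_itv/=.
    by rewrite ltr_pdivrMr// ler_pdivlMr// ltrBlDr lerBrDr [(x * c)%R]mulrC.
  by rewrite ltr_pdivrMr// ler_pdivlMr// ltrBlDr lerBrDr [(x * c)%R]mulrC.
rewrite !lebesgue_measure_itv/= !lte_fin ltr_pM2r ?invr_gt0// ltrD2r.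
case: ifPn => _; last by rewrite mule0.
by rewrite -!EFinB -EFinM -mulrBl mulrCA divff ?gt_eqF// mulr1 opprB addrA subrK.
Qed.

Lemma ge0_integral_affine (c w : R) (f : R -> \bar R) : (0 < c)%R ->
  measurable_fun setT f -> (forall x, 0 <= f x) ->
  \int[mu]_x f x = c%:E * \int[mu]_x f (c * x + w)%R.
Proof.
move=> c0 mf f0.
pose c' : {nonneg R} := NngNum (ltW c0).
pose M := HB.pack_for {measure set (measurableTypeR R) -> \bar R}
  (pushforward mu (aff c w)).
rewrite (@eq_measure_integral _ _ _ _ (mscale c' (M (measurable_affine c w)))); last first.
  by move=> A mA _; exact: pushforward_affine.
rewrite ge0_integral_mscale//=.
by rewrite ge0_integral_pushforward//=; exact: measurable_affine.
Qed.

Lemma ge0_integral_oppr (f : R -> \bar R) :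
  measurable_fun setT f -> (forall x, 0 <= f x) ->
  \int[mu]_x f x = \int[mu]_x f (- x)%R.
Proof.
move=> mf f0.
have mN : measurable_fun setT (fun x : measurableTypeR R => (- x)%R : measurableTypeR R).
  by mf.
pose M := HB.pack_for {measure set (measurableTypeR R) -> \bar R}
  (pushforward mu (fun x : measurableTypeR R => (- x)%R : measurableTypeR R)).
rewrite (@eq_measure_integral _ _ _ _ (M mN)).
  by rewrite /= ge0_integral_pushforward.
move=> A mA _; apply: lebesgue_measure_unique => // X [[a b] /= ab <-].
rewrite /pushforward (_ : _ @^-1` _ = `[(- b)%R, (- a)%R[%classic); last first.
  by apply/seteqP; split => x /=; rewrite !in_itv/= ltrNr lerNl andbC.
rewrite !lebesgue_measure_itv/= !lte_fin ltrN2.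
by case: ifPn => // _; rewrite -!EFinB opprK addrC.
Qed.

End affine.

Section calculus.
Context {R : realType}.
Local Notation mu := (@lebesgue_measure R).

Lemma ftc_itvcc (f F : R -> R) (a b : R) : a < b ->
  (forall x, a <= x <= b -> is_derive x 1 F (f x)) ->
  (forall x, a <= x <= b -> {for x, continuous f}) ->
  (\int[mu]_(x in `[a, b]) (f x)%:E = (F b - F a)%:E)%E.
Proof.
move=> ab dF cf.
have cF x : a <= x <= b -> {for x, continuous F}.
  by move=> /dF dFx; apply: differentiable_continuous; apply/derivable1_diffP.
rewrite (@continuous_FTC2 _ f F)//.
- apply/continuous_within_itvP => //; split.
  + by move=> x; rewrite in_itv/= => /andP[ax xb]; apply: cf; rewrite !ltW.
  + by apply/cvg_at_right_filter/cf; rewrite lexx ltW.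
  + by apply/cvg_at_left_filter/cf; rewrite lexx ltW.
- split.
  + by move=> x; rewrite in_itv/= => /andP[ax xb]; have := dF x; rewrite !ltW// => /(_ isT) [].
  + by apply/cvg_at_right_filter/cF; rewrite lexx ltW.
  + by apply/cvg_at_left_filter/cF; rewrite lexx ltW.
- move=> x; rewrite in_itv/= => /andP[ax xb]; rewrite derive1E.
  by have := dF x; rewrite !ltW// => /(_ isT) dFx; apply: derive_val.
Qed.

Lemma ftc_itvcy (f F : R -> R) (a l : R) :
  (forall x, a <= x -> is_derive x 1 F (f x)) ->
  (forall x, a <= x -> {for x, continuous f}) ->
  (forall x, a <= x -> 0 <= f x) -> F x @[x --> +oo] --> l ->
  (\int[mu]_(x in `[a, +oo[) (f x)%:E = (l - F a)%:E)%E.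
Proof.
move=> dF cf f0 Fl.
rewrite (@ge0_continuous_FTC2y _ f F _ l)//.
- apply/continuous_within_itvcyP; split.
  + by move=> x; rewrite in_itv/= andbT => ax; apply: cf; rewrite ltW.
  + by apply/cvg_at_right_filter/cf.
- by move=> x ax; have [] := dF x (ltW ax).
- apply/cvg_at_right_filter; apply: differentiable_continuous.
  by have [+ _] := dF a (lexx _); move=> /derivable1_diffP.
- move=> x; rewrite in_itv/= andbT => ax; rewrite derive1E.
  by have := dF x (ltW ax) => dFx; apply: derive_val.
Qed.

End calculus.

(** * Substitutions on the half-line *)

Section halfline.
Local Open Scope ereal_scope.
Context {R : realType}.
Local Notation mu := (@lebesgue_measure R).
Local Notation D := (`]0%R, +oo[%classic : set R).

Lemma in_itv0y (x : R) : (x \in D) = (0 < x)%R.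
Proof. by apply/idP/idP; rewrite inE/= in_itv/= andbT. Qed.

Lemma itv0yE (x : R) : D x = (0 < x)%R.
Proof. by rewrite /= in_itv/= andbT. Qed.

Lemma ge0_integral_pos_scale (c : R) (f : R -> \bar R) : (0 < c)%R ->
  measurable_fun D f -> (forall x, (0 < x)%R -> 0 <= f x) ->
  \int[mu]_(x in D) f x = c%:E * \int[mu]_(x in D) f (c * x)%R.
Proof.
move=> c0 mf f0.
rewrite integral_mkcond (@ge0_integral_affine _ c 0%R _ c0); last 2 first.
  exact/(measurable_restrictT _ _).1.
  by move=> x; apply: erestrict_ge0 => {}x; rewrite itv0yE; exact: f0.
rewrite [in RHS]integral_mkcond; congr *%E; apply: eq_integral => x _.
by rewrite addr0 !patchE !in_itv0y pmulr_rgt0.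
Qed.

Lemma integral_expRN_pos : \int[mu]_(x in D) (expR (- x))%:E = 1.
Proof.
rewrite integral_itv_obnd_cbnd; last by apply: measurable_funTS; mf.
have dF (x : R) : (0 <= x)%R ->
    is_derive x 1%R (fun x : R => - expR (- x))%R (expR (- x)).
  by move=> _; apply: is_derive_eq; rewrite mulrN1 opprK.
rewrite (@ftc_itvcy _ _ _ _ (- 0)%R dF).
- by rewrite !oppr0 expR0 add0r opprK.
- move=> x _; apply: continuous_comp; [exact: opp_continuous|exact: continuous_expR].
- by move=> x _; exact: expR_ge0.
- exact: (cvgN (@cvgr_expR R)).
Qed.

Lemma integral_exp_pos (c : R) : (0 < c)%R ->
  \int[mu]_(x in D) (c * expR (- (c * x)))%:E = 1.
Proof.
move=> c0; under eq_integral do rewrite EFinM.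
rewrite ge0_integralZl ?lee_fin ?(ltW c0)//; last first.
  by apply: measurable_funTS; mf.
rewrite -(@ge0_integral_pos_scale _ (fun x => (expR (- x))%:E))//.
- exact: integral_expRN_pos.
- by apply: measurable_funTS; mf.
Qed.

Lemma integral_gauss_pos :
  \int[mu]_(x in D) (2 * x * expR (- x ^+ 2))%:E = 1.
Proof.
rewrite integral_itv_obnd_cbnd; last by apply: measurable_funTS; mf.
have dF (x : R) : (0 <= x)%R ->
    is_derive x 1%R (fun x : R => - expR (- x ^+ 2))%R (2 * x * expR (- x ^+ 2))%R.
  move=> _; apply: is_derive_eq.
  by rewrite /GRing.scale/=; ring.
rewrite (@ftc_itvcy _ _ _ _ (- 0)%R dF).
- by rewrite expr0n/= !oppr0 expR0 add0r opprK.
- move=> x _; apply: cvgM.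
    by apply: cvgM; [exact: cvg_cst|exact: cvg_id].
  exact: (@continuous_gauss_fun R).
- by move=> x x0; rewrite mulr_ge0 ?expR_ge0// mulr_ge0.
- exact: (cvgN (@cvg_gauss_fun R)).
Qed.

(* [x e^(-x t)] has integral [1] in [t]: inserting it and exchanging the
   integrals reduces the inversion to the scaling invariance. *)
Lemma ge0_integral_pos_inv (C : R) (f : R -> \bar R) : (0 < C)%R ->
  measurable_fun setT f -> (forall x, (0 < x)%R -> 0 <= f x) ->
  \int[mu]_(x in D) f x = \int[mu]_(x in D) (f (C / x)%R * (C / x ^+ 2)%:E).
Proof.
move=> C0 mf f0; apply/esym.
pose k (x t : R) : \bar R := f (C / x)%R * (C / x)%:E * (expR (- (x * t)))%:E.
have k0 x t : D x -> D t -> 0 <= k x t.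
  rewrite !itv0yE => x0 t0; rewrite /k !mule_ge0 ?lee_fin ?expR_ge0//.
    by apply: f0; rewrite divr_gt0.
  by rewrite divr_ge0 ?ltW.
transitivity (\int[mu]_(x in D) \int[mu]_(t in D) k x t).
  apply: eq_integral => x; rewrite in_itv0y => x0.
  transitivity (f (C / x)%R * (C / x ^+ 2)%:E *
      \int[mu]_(t in D) (x * expR (- (x * t)))%:E).
    by rewrite integral_exp_pos// mule1.
  rewrite -ge0_integralZl//; last 3 first.
    by apply: measurable_funTS; mf.
    by move=> t _; rewrite lee_fin mulr_ge0 ?expR_ge0 ?ltW.
    by rewrite mule_ge0 ?lee_fin ?divr_ge0 ?exprn_ge0 ?f0 ?divr_gt0 ?ltW.
  apply: eq_integral => t _; rewrite /k -!muleA -!EFinM; congr (_ * _%:E).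
  by field; rewrite gt_eqF.
rewrite tonelli_mu//; last first.
  by apply: measurable_funTS; rewrite /k; mf.
transitivity (\int[mu]_(t in D) \int[mu]_(x in D)
    (f (C * t / x)%R * (C / x * expR (- x))%:E)).
  apply: eq_integral => t; rewrite in_itv0y => t0.
  rewrite (@ge0_integral_pos_scale t^-1) ?invr_gt0//; last 2 first.
    by apply: measurable_funTS; rewrite /k; mf.
      by move=> x x0; apply: k0; rewrite itv0yE.
  rewrite -ge0_integralZl ?lee_fin ?invr_ge0 ?(ltW t0)//; last 2 first.
    by apply: measurable_funTS; rewrite /k; mf.
      by move=> x; rewrite itv0yE => x0; apply: k0; rewrite itv0yE ?mulr_gt0 ?invr_gt0.
  apply: eq_integral => x; rewrite in_itv0y => x0.
  rewrite /k muleC -!muleA -!EFinM; congr (f _ * _%:E).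
    by field; rewrite !gt_eqF.
  have -> : (t^-1 * x * t = x)%R by field; rewrite gt_eqF.
  by field; rewrite !gt_eqF.
rewrite tonelli_mu//; last 2 first.
  by apply: measurable_funTS; mf.
  move=> t x; rewrite !itv0yE => t0 x0.
  by rewrite mule_ge0 ?f0 ?lee_fin ?mulr_ge0 ?expR_ge0 ?invr_ge0 ?divr_gt0 ?mulr_gt0// ltW.
transitivity (\int[mu]_(x in D) ((expR (- x))%:E * \int[mu]_(t in D) f t)).
  apply: eq_integral => x; rewrite in_itv0y => x0.
  rewrite ge0_integralZr//; last 3 first.
    by apply: measurable_funTS; mf.
    by move=> t; rewrite itv0yE => t0; apply: f0; rewrite divr_gt0 ?mulr_gt0.
    by rewrite lee_fin !mulr_ge0 ?expR_ge0 ?invr_ge0 ?ltW.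
  rewrite [in RHS](@ge0_integral_pos_scale (C / x)) ?divr_gt0//; last first.
    exact: measurable_funTS.
  rewrite muleC muleA -EFinM mulrC; congr *%E.
  by apply: eq_integral => t _; rewrite mulrAC.
rewrite ge0_integralZr//; last 2 first.
  by apply: measurable_funTS; mf.
  by apply: integral_ge0 => x; rewrite itv0yE; exact: f0.
by rewrite integral_expRN_pos mul1e.
Qed.

(** The same device with [x^2 e^(- x^2 t)]: after the exchange, rescaling [x] by [1 / sqrt t] leaves
    the weight [2 x e^(- x^2)] of mass 1 and, for each [x], the inversion [t -> x^2 / t]. *)
Lemma ge0_integral_pos_sqr (f : R -> \bar R) :
  measurable_fun setT f -> (forall x, (0 < x)%R -> 0 <= f x) ->
  \int[mu]_(x in D) f x = \int[mu]_(x in D) (f (x ^+ 2)%R * (2 * x)%:E).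
Proof.
move=> mf f0; apply/esym.
pose k (x t : R) : \bar R := f (x ^+ 2)%R * (2 * x ^+ 3 * expR (- (x ^+ 2 * t)))%:E.
have k0 x t : D x -> D t -> 0 <= k x t.
  rewrite !itv0yE => x0 t0; rewrite /k mule_ge0 ?f0 ?exprn_gt0//.
  by rewrite lee_fin !mulr_ge0 ?expR_ge0 ?exprn_ge0 ?(ltW x0).
transitivity (\int[mu]_(x in D) \int[mu]_(t in D) k x t).
  apply: eq_integral => x; rewrite in_itv0y => x0.
  transitivity (f (x ^+ 2)%R * (2 * x)%:E *
      \int[mu]_(t in D) (x ^+ 2 * expR (- (x ^+ 2 * t)))%:E).
    by rewrite integral_exp_pos ?mule1// exprn_gt0.
  rewrite -ge0_integralZl//; last 3 first.
    by apply: measurable_funTS; mf.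
    by move=> t _; rewrite lee_fin mulr_ge0 ?expR_ge0 ?exprn_ge0 ?ltW.
    by rewrite mule_ge0 ?lee_fin ?mulr_ge0 ?f0 ?exprn_gt0 ?ltW.
  apply: eq_integral => t _; rewrite /k -!muleA -!EFinM; congr (_ * _%:E).
  by ring.
rewrite tonelli_mu//; last first.
  by apply: measurable_funTS; rewrite /k; mf.
transitivity (\int[mu]_(t in D) \int[mu]_(x in D)
    (f (x ^+ 2 / t)%R * (x ^+ 2 / t ^+ 2 * (2 * x * expR (- x ^+ 2)))%:E)).
  apply: eq_integral => t; rewrite in_itv0y => t0.
  have st0 : (0 < Num.sqrt t)%R by rewrite sqrtr_gt0.
  have st2 : t = (Num.sqrt t ^+ 2)%R by rewrite sqr_sqrtr// ltW.
  rewrite (@ge0_integral_pos_scale (Num.sqrt t)^-1) ?invr_gt0//; last 2 first.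
    by apply: measurable_funTS; rewrite /k; mf.
      by move=> x x0; apply: k0; rewrite itv0yE.
  rewrite -ge0_integralZl ?lee_fin ?invr_ge0 ?(ltW st0)//; last 2 first.
    by apply: measurable_funTS; rewrite /k; mf.
      by move=> x; rewrite itv0yE => x0; apply: k0; rewrite itv0yE ?mulr_gt0 ?invr_gt0.
  apply: eq_integral => x; rewrite in_itv0y => x0.
  rewrite /k muleC -!muleA -!EFinM; congr (f _ * _%:E).
    by rewrite [in RHS]st2; field; rewrite !gt_eqF.
  have -> : (((Num.sqrt t)^-1 * x) ^+ 2 * t = x ^+ 2)%R.
    by rewrite [X in (_ * X)%R]st2; field; rewrite gt_eqF.
  by rewrite [in RHS]st2; field; rewrite !gt_eqF.
rewrite tonelli_mu//; last 2 first.
  by apply: measurable_funTS; mf.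
  move=> t x; rewrite !itv0yE => t0 x0.
  rewrite mule_ge0 ?f0 ?lee_fin ?mulr_ge0 ?expR_ge0 ?invr_ge0 ?exprn_ge0 ?(ltW x0) ?(ltW t0)//.
  by rewrite divr_gt0 ?exprn_gt0.
transitivity (\int[mu]_(x in D) ((2 * x * expR (- x ^+ 2))%:E * \int[mu]_(t in D) f t)).
  apply: eq_integral => x; rewrite in_itv0y => x0.
  rewrite [in RHS](@ge0_integral_pos_inv (x ^+ 2)) ?exprn_gt0//.
  rewrite -ge0_integralZl//; last 3 first.
    by apply: measurable_funTS; mf.
      move=> t; rewrite itv0yE => t0.
    by rewrite mule_ge0 ?f0 ?lee_fin ?divr_ge0 ?divr_gt0 ?exprn_gt0 ?exprn_ge0 ?ltW.
    by rewrite lee_fin !mulr_ge0 ?expR_ge0 ?ltW.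
  by apply: eq_integral => t _; rewrite [RHS]muleC EFinM muleA.
rewrite ge0_integralZr//; last 3 first.
  by apply: measurable_funTS; mf.
  by move=> x; rewrite itv0yE => x0; rewrite lee_fin !mulr_ge0 ?expR_ge0 ?ltW.
  by apply: integral_ge0 => x; rewrite itv0yE; exact: f0.
by rewrite integral_gauss_pos mul1e.
Qed.

End halfline.

(** * Lebesgue integrals over row vectors *)

Section enorm.
Context {R : realType} {n : nat}.
Implicit Types (x y : 'rV[R]_n) (c : R).

Lemma enorm_ge0 x : 0 <= enorm x. Proof. exact: sqrtr_ge0. Qed.

Lemma sqr_enorm x : enorm x ^+ 2 = dotv x x.
Proof.
rewrite sqr_sqrtr; last by apply: sumr_ge0 => i _; exact: sqr_ge0.
by apply: eq_bigr => i _; rewrite expr2.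
Qed.

Lemma dotvC x y : dotv x y = dotv y x.
Proof. by apply: eq_bigr => i _; rewrite mulrC. Qed.

Lemma dotvDl x y z : dotv (x + y) z = dotv x z + dotv y z.
Proof. by rewrite -big_split; apply: eq_bigr => i _; rewrite mxE mulrDl. Qed.

Lemma dotvDr x y z : dotv z (x + y) = dotv z x + dotv z y.
Proof. by rewrite dotvC dotvDl !(dotvC z). Qed.

Lemma dotvZl c x y : dotv (c *: x) y = c * dotv x y.
Proof. by rewrite mulr_sumr; apply: eq_bigr => i _; rewrite mxE mulrA. Qed.

Lemma dotvZr c x y : dotv x (c *: y) = c * dotv x y.
Proof. by rewrite dotvC dotvZl dotvC. Qed.

Lemma dotvNl x y : dotv (- x) y = - dotv x y.
Proof. by rewrite -scaleN1r dotvZl mulN1r. Qed.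

Lemma dotvNr x y : dotv x (- y) = - dotv x y.
Proof. by rewrite dotvC dotvNl dotvC. Qed.

Lemma enormZ c x : enorm (c *: x) = `|c| * enorm x.
Proof.
rewrite /enorm -sqrtr_sqr -sqrtrM ?sqr_ge0// mulr_sumr; congr Num.sqrt.
by apply: eq_bigr => i _; rewrite mxE exprMn.
Qed.

Lemma enormN x : enorm (- x) = enorm x.
Proof. by rewrite -scaleN1r enormZ normrN1 mul1r. Qed.

Lemma enorm0 : enorm (0 : 'rV[R]_n) = 0.
Proof. by rewrite -(scale0r 0) enormZ normr0 mul0r. Qed.

Lemma enorm_eq0 x : (enorm x == 0) = (x == 0).
Proof.
apply/idP/eqP => [|->]; last by rewrite enorm0.
rewrite sqrtr_eq0 => x0; apply/rowP => i; rewrite mxE; apply/eqP.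
have : \sum_(i < n) x 0 i ^+ 2 == 0.
  by rewrite eq_le x0 sumr_ge0// => j _; rewrite sqr_ge0.
rewrite psumr_eq0; last by move=> j _; rewrite sqr_ge0.
by move=> /allP/(_ i); rewrite mem_index_enum => /(_ isT); rewrite sqrf_eq0.
Qed.

Lemma enorm_gt0 x : (0 < enorm x) = (x != 0).
Proof. by rewrite lt_neqAle enorm_ge0 andbT eq_sym enorm_eq0. Qed.

(** Cauchy-Schwarz, read off from [0 <= | |y| x - |x| y |^2 = 2 |x| |y| (|x| |y| - x.y)]. *)
Lemma dotv_le x y : dotv x y <= enorm x * enorm y.
Proof.
have [->|x0] := eqVneq x 0.
  by rewrite -(scale0r 0) dotvZl mul0r mulr_ge0// enorm_ge0.
have [->|y0] := eqVneq y 0.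
  by rewrite -(scale0r 0) dotvZr mul0r mulr_ge0// enorm_ge0.
have ex : 0 < enorm x by rewrite enorm_gt0.
have ey : 0 < enorm y by rewrite enorm_gt0.
have : 0 <= enorm (enorm y *: x - enorm x *: y) ^+ 2 by exact: sqr_ge0.
rewrite sqr_enorm !(dotvDl, dotvDr, dotvNl, dotvNr, dotvZl, dotvZr) -!sqr_enorm.
rewrite (dotvC y x) => H.
have {}H : 0 <= 2 * (enorm x * enorm y) * (enorm x * enorm y - dotv x y).
  by apply: le_trans H _; rewrite le_eqVlt; apply/orP; left; apply/eqP; ring.
by rewrite -subr_ge0; move: H; rewrite pmulr_rge0// mulr_gt0// mulr_gt0.
Qed.

Lemma enormD x y : enorm (x + y) <= enorm x + enorm y.
Proof.
rewrite -(@ler_pXn2r _ 2)// ?nnegrE ?addr_ge0 ?enorm_ge0//.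
rewrite sqr_enorm !(dotvDl, dotvDr) -!sqr_enorm (dotvC y x).
have := dotv_le x y; lra.
Qed.

End enorm.

Section lebesgue_rV_integral.
Local Open Scope ereal_scope.
Context {R : realType}.
Local Notation mu := (@lebesgue_measure R).

Lemma lebesgue_rV_sigma_finite n : sigma_finite setT (@lebesgue_rV R n).
Proof.
exists (fun k => [set v : 'rV[R]_n | forall i, `[(- k%:R)%R, k%:R]%classic (v 0%R i)]).
  apply/seteqP; split => // v _.
  (* The sum of integer bounds of the coordinates bounds each of them. *)
  exists (\sum_(i < n) (Num.truncn `|v 0%R i|%R).+1)%N => //= i.
  rewrite in_itv/= -ler_norml; apply: (@le_trans _ _ (Num.truncn `|v 0%R i|%R).+1%:R).
    by rewrite ltW// truncnS_gt.
  by rewrite ler_nat (bigD1 i)//= leq_addr.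
move=> k; split.
  rewrite (_ : [set _ | _] =
      \bigcap_(i in [set: 'I_n]) (@rV_coord R n i @^-1` `[(- k%:R)%R, k%:R]%classic)).
    apply: fin_bigcap_measurable => // i _.
    by rewrite -[X in measurable X]setTI; exact: measurable_rV_coord.
  by apply/seteqP; split => v /= H i; [move=> _|]; exact: H.
rewrite (@lebesgue_rV_box R n (fun=> `[(- k%:R)%R, k%:R]%classic))//.
rewrite (eq_bigr (fun=> (k%:R + k%:R)%:E)); last first.
  move=> i _; rewrite lebesgue_measure_itv/= lte_fin; case: ifPn => [_|].
    by rewrite -EFinB opprK.
  by rewrite -leNgt => kk; apply/eqP; rewrite eqe eq_le; have := ler0n R k; lra.
by rewrite prodEFin ltry.
Qed.

HB.instance Definition _ n := @Measure_isSigmaFinite.Build _ _ _ (@lebesgue_rV R n)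
  (lebesgue_rV_sigma_finite n).

Lemma tonelli_rV n (D2 : set R) (f : 'rV[R]_n -> R -> \bar R) :
  measurable D2 ->
  measurable_fun setT (fun z : 'rV[R]_n * R => f z.1 z.2) ->
  (forall x y, D2 y -> 0 <= f x y)%E ->
  \int[@lebesgue_rV R n]_x \int[mu]_(y in D2) f x y =
  \int[mu]_(y in D2) \int[@lebesgue_rV R n]_x f x y.
Proof.
move=> mD2 mf f0.
rewrite (@tonelli_in _ _ _ _ R (@lebesgue_rV R n) mu)//.
- exact: measurable_funTS.
- by move=> x y _; exact: f0.
Qed.

Lemma ge0_integral_rVS n (f : 'rV[R]_n.+1 -> \bar R) :
  measurable_fun setT f -> (forall x, 0 <= f x) ->
  \int[@lebesgue_rV R n.+1]_x f x =
  \int[@lebesgue_rV R n]_v \int[mu]_a f (rV_cons (v, a)).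
Proof.
move=> mf f0.
have mc := @measurable_rV_cons R n.
transitivity (\int[pushforward (@lebesgue_rV R n \x mu) (@rV_cons R n)]_x f x).
  by [].
rewrite ge0_integral_pushforward//= (@fubini_tonelli1 _ _ _ _ _ (@lebesgue_rV R n) mu)//.
- by apply: measurableT_comp.
Qed.

Lemma ge0_integral_rV0 (f : 'rV[R]_0 -> \bar R) :
  measurable_fun setT f ->
  \int[@lebesgue_rV R 0%N]_x f x = f 0%R.
Proof. by move=> mf; rewrite /= integral_dirac// diracT mul1e. Qed.

End lebesgue_rV_integral.

(** * Gaussians, polar coordinates and inversion in several dimensions *)

Section rV_change_of_variables.
Local Open Scope ereal_scope.
Context {R : realType}.
Local Notation mu := (@lebesgue_measure R).
Local Notation D := (`]0%R, +oo[%classic : set R).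

Lemma rV_consD n (v w : 'rV[R]_n) (a b : R) :
  (rV_cons (v, a) + rV_cons (w, b) = rV_cons (v + w, a + b))%R.
Proof. by apply/rowP => i; rewrite !mxE; case: unliftP => [j|] _ /=; rewrite ?mxE. Qed.

Lemma rV_consZ n (c : R) (v : 'rV[R]_n) (a : R) :
  (c *: rV_cons (v, a) = rV_cons (c *: v, c * a))%R.
Proof. by apply/rowP => i; rewrite !mxE; case: unliftP => [j|] _ /=; rewrite ?mxE. Qed.

Lemma rV_consN n (v : 'rV[R]_n) (a : R) :
  (- rV_cons (v, a) = rV_cons (- v, - a))%R.
Proof. by rewrite -scaleN1r rV_consZ scaleN1r mulN1r. Qed.

Lemma rV_cons_eta n (w : 'rV[R]_n.+1) :
  rV_cons (\row_i w 0%R (lift ord0 i), w 0%R ord0) = w.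
Proof.
apply/rowP => i; rewrite !mxE; case: (unliftP ord0 i) => [j|] -> /=; last by [].
by rewrite mxE.
Qed.

Lemma sqr_enorm_rV_cons n (v : 'rV[R]_n) (a : R) :
  (enorm (rV_cons (v, a)) ^+ 2 = enorm v ^+ 2 + a ^+ 2)%R.
Proof.
rewrite !sqr_enorm /dotv big_ord_recl addrC !mxE unlift_none/= expr2; congr +%R.
by apply: eq_bigr => i _; rewrite !mxE liftK.
Qed.

Lemma mf_rV_cons d (T : measurableType d) n (g : T -> 'rV[R]_n) (a : T -> R) :
  measurable_fun setT g -> measurable_fun setT a ->
  measurable_fun setT (fun x => rV_cons (g x, a x)).
Proof.
move=> mg ma; apply: (measurableT_comp (@measurable_rV_cons R n)).
exact: measurable_fun_pair.
Qed.

Lemma measurable_integral_rV_cons n (f : 'rV[R]_n.+1 -> \bar R) (b : R -> R) :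
  measurable_fun setT f -> measurable_fun setT b -> (forall x, 0 <= f x) ->
  measurable_fun setT (fun v => \int[mu]_a f (rV_cons (v, b a))).
Proof.
move=> mf mb f0.
apply: (@measurable_integral_in _ _ _ _ R mu) => //.
rewrite setXTT; apply: (measurableT_comp mf); by apply: mf_rV_cons; mf.
Qed.

(** Induction on the dimension: each coordinate contributes one factor [c]. *)
Lemma ge0_integral_rV_affine n (c : R) (w : 'rV[R]_n) (f : 'rV[R]_n -> \bar R) :
  (0 < c)%R -> measurable_fun setT f -> (forall x, 0 <= f x) ->
  \int[@lebesgue_rV R n]_x f x =
  (c ^+ n)%:E * \int[@lebesgue_rV R n]_x f (c *: x + w)%R.
Proof.
move=> c0; elim: n w f => [|n IH] w f mf f0.
  rewrite !ge0_integral_rV0//; last by apply: (measurableT_comp mf); mf.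
  by rewrite expr0 mul1e; congr f; apply/rowP => -[].
rewrite !ge0_integral_rVS//; last by apply: (measurableT_comp mf); mf.
set w' := (\row_i w 0%R (lift ord0 i))%R; set w0 := w 0%R ord0.
transitivity (\int[@lebesgue_rV R n]_v (c%:E * \int[mu]_a f (rV_cons (v, c * a + w0)%R))).
  apply: eq_integral => v _; rewrite (@ge0_integral_affine _ c w0 _ c0)//.
  by apply: (measurableT_comp mf); apply: mf_rV_cons; mf.
have mg : measurable_fun setT (fun v => \int[mu]_a f (rV_cons (v, c * a + w0)%R)).
  by apply: (@measurable_integral_rV_cons n f (fun a => c * a + w0)%R) => //; mf.
have g0 v : 0 <= \int[mu]_a f (rV_cons (v, c * a + w0)%R) by exact: integral_ge0.
rewrite (@ge0_integralZl _ _ _ _ _ _ _ mg) ?lee_fin ?(ltW c0)//.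
transitivity (c%:E * ((c ^+ n)%:E *
    \int[@lebesgue_rV R n]_v \int[mu]_a f (rV_cons (c *: v + w', c * a + w0)%R))).
  by congr *%E; exact: (IH w' _ mg g0).
rewrite exprS EFinM -muleA; congr *%E; congr *%E; apply: eq_integral => v _.
apply: eq_integral => a _; rewrite rV_consZ -[in RHS](@rV_cons_eta n w).
by rewrite rV_consD.
Qed.

Lemma ge0_integral_rV_opp n (f : 'rV[R]_n -> \bar R) :
  measurable_fun setT f -> (forall x, 0 <= f x) ->
  \int[@lebesgue_rV R n]_x f x = \int[@lebesgue_rV R n]_x f (- x)%R.
Proof.
elim: n f => [|n IH] f mf f0.
  rewrite !ge0_integral_rV0//; last by apply: (measurableT_comp mf); mf.
  by congr f; apply/rowP => -[].
rewrite !ge0_integral_rVS//; last by apply: (measurableT_comp mf); mf.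
rewrite IH; last 2 first.
  by apply: (@measurable_integral_rV_cons n f id) => //; mf.
  by move=> v; exact: integral_ge0.
apply: eq_integral => v _; rewrite ge0_integral_oppr//.
  by apply: eq_integral => a _; rewrite rV_consN.
by apply: (measurableT_comp mf); apply: mf_rV_cons; mf.
Qed.

Lemma integral_rV_gauss n :
  \int[@lebesgue_rV R n]_x (expR (- enorm x ^+ 2))%:E = (pi `^ (n%:R / 2))%:E.
Proof.
elim: n => [|n IH].
  rewrite ge0_integral_rV0; last by mf.
  by rewrite enorm0 expr0n/= oppr0 expR0 mul0r powRr0.
rewrite ge0_integral_rVS//; last by mf.
transitivity (\int[@lebesgue_rV R n]_v ((expR (- enorm v ^+ 2))%:E * (Num.sqrt pi)%:E)).
  apply: eq_integral => v _; rewrite -integralT_gauss -ge0_integralZl ?lee_fin ?expR_ge0//.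
  - apply: eq_integral => a _; rewrite -EFinM /gauss_fun -expRD -opprD.
    by rewrite sqr_enorm_rV_cons.
  - by rewrite /gauss_fun; mf.
  - by move=> a _; rewrite lee_fin gauss_fun_ge0.
rewrite ge0_integralZr ?lee_fin ?sqrtr_ge0//; last by mf.
rewrite IH -EFinM; congr _%:E; rewrite -powR12_sqrt ?pi_ge0// -powRD.
  by congr (_ `^ _)%R; rewrite -[in RHS]natr1; field.
by rewrite (gt_eqF (pi_gt0 R)) implybT.
Qed.

Lemma integral_rV_gauss_center n (p : R) (w : 'rV[R]_n) : (0 < p)%R ->
  \int[@lebesgue_rV R n]_x (expR (- (p * enorm (x - w) ^+ 2)))%:E =
  ((pi / p) `^ (n%:R / 2))%:E.
Proof.
move=> p0.
have sp0 : (0 < Num.sqrt p)%R by rewrite sqrtr_gt0.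
rewrite (@ge0_integral_rV_affine n (Num.sqrt p)^-1 w) ?invr_gt0//; last by mf.
under eq_integral => x _.
  rewrite addrK enormZ ger0_norm ?invr_ge0 ?sqrtr_ge0// exprMn exprVn.
  rewrite sqr_sqrtr ?(ltW p0)// mulrA divff ?gt_eqF// mul1r.
  over.
rewrite integral_rV_gauss -EFinM; congr _%:E.
rewrite powRM ?pi_ge0 ?invr_ge0 ?(ltW p0)// mulrC; congr (_ * _)%R.
transitivity ((p `^ (- 2^-1)) `^ n%:R)%R.
  by rewrite powR_mulrn ?powR_ge0// powRN powR12_sqrt ?(ltW p0).
rewrite -(powR_inv1 (ltW p0)) -!powRrM.
by congr (_ `^ _)%R; field.
Qed.

(** Completing the square: the centre is [t w / (p + t)] and the remainder [p t |w|^2 / (p + t)]. *)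
Lemma integral_rV_gauss2 n (p t : R) (w : 'rV[R]_n) : (0 < p)%R -> (0 < t)%R ->
  \int[@lebesgue_rV R n]_x (expR (- (p * enorm x ^+ 2)) *
                            expR (- (t * enorm (w - x) ^+ 2)))%:E =
  ((pi / (p + t)) `^ (n%:R / 2) * expR (- (p * t / (p + t) * enorm w ^+ 2)))%:E.
Proof.
move=> p0 t0; have pt0 : (0 < p + t)%R by rewrite addr_gt0.
transitivity (\int[@lebesgue_rV R n]_x
    ((expR (- ((p + t) * enorm (x - (t / (p + t)) *: w) ^+ 2)))%:E *
     (expR (- (p * t / (p + t) * enorm w ^+ 2)))%:E)).
  apply: eq_integral => x _; rewrite -EFinM -!expRD; congr (expR _)%:E.
  rewrite !sqr_enorm !(dotvDl, dotvDr, dotvNl, dotvNr, dotvZl, dotvZr) (dotvC w x).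
  by field; rewrite gt_eqF.
rewrite ge0_integralZr ?lee_fin ?expR_ge0//.
- by rewrite integral_rV_gauss_center// EFinM.
- by mf.
Qed.

(* Polar coordinates without a surface measure: the weight [|x| e^-|x|], whose
   integral along each ray is [1] for [dt/t], plays the part of the sphere. *)
Lemma ge0_integral_rV_polar n (f : 'rV[R]_n -> \bar R) : f 0%R = 0 ->
  measurable_fun setT f -> (forall x, 0 <= f x) ->
  \int[@lebesgue_rV R n]_x f x =
  \int[@lebesgue_rV R n]_x ((enorm x * expR (- enorm x))%:E *
     \int[mu]_(t in D) (f (t *: x)%R * (t ^+ n / t)%:E)).
Proof.
move=> f00 mf f0; apply/esym.
have fk0 x t : D t -> 0 <= (enorm x * expR (- enorm x))%:E * (f (t *: x)%R * (t ^+ n / t)%:E).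
  rewrite itv0yE => t0; rewrite mule_ge0 ?mule_ge0 ?lee_fin//.
    by rewrite mulr_ge0 ?expR_ge0 ?enorm_ge0.
  by rewrite divr_ge0 ?exprn_ge0 ?(ltW t0).
transitivity (\int[@lebesgue_rV R n]_x \int[mu]_(t in D)
   ((enorm x * expR (- enorm x))%:E * (f (t *: x)%R * (t ^+ n / t)%:E))).
  apply: eq_integral => x _; rewrite ge0_integralZl//; last 3 first.
    by apply: measurable_funTS; mf.
    move=> t; rewrite itv0yE => t0; rewrite mule_ge0// lee_fin.
    by rewrite divr_ge0 ?exprn_ge0 ?ltW.
  by rewrite lee_fin mulr_ge0 ?expR_ge0 ?enorm_ge0.
rewrite (@tonelli_rV _ n D (fun x t => (enorm x * expR (- enorm x))%:E * (f (t *: x)%R * (t ^+ n / t)%:E)))//; last by mf.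
transitivity (\int[mu]_(t in D) \int[@lebesgue_rV R n]_x
    (f x * (enorm x / t ^+ 2 * expR (- (enorm x / t)))%:E)).
  apply: eq_integral => t; rewrite in_itv0y => t0.
  rewrite (@ge0_integral_rV_affine n t^-1 0%R) ?invr_gt0//; last 2 first.
    by mf.
    by move=> x; apply: fk0; rewrite itv0yE.
  rewrite -ge0_integralZl//; last 3 first.
    by mf.
    by move=> x _; apply: fk0; rewrite itv0yE.
    by rewrite lee_fin exprn_ge0// invr_ge0 ltW.
  apply: eq_integral => x _; rewrite addr0 scalerA divff ?gt_eqF// scale1r.
  rewrite enormZ ger0_norm ?invr_ge0 ?(ltW t0)// muleA -EFinM muleCA -EFinM.
  congr (f x * _%:E); rewrite (mulrC (t^-1)%R (enorm x)) exprVn; field.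
  by rewrite gt_eqF// expf_neq0// gt_eqF.
rewrite -(@tonelli_rV _ n D (fun x t => (f x * (enorm x / t ^+ 2 * expR (- (enorm x / t)))%:E)))//; last 2 first.
  by mf.
  move=> x t; rewrite itv0yE => t0; rewrite mule_ge0// lee_fin.
  by rewrite mulr_ge0 ?expR_ge0// divr_ge0 ?enorm_ge0 ?exprn_ge0 ?ltW.
apply: eq_integral => x _; rewrite ge0_integralZl//; last 2 first.
  by apply: measurable_funTS; mf.
  move=> t; rewrite itv0yE => t0.
  by rewrite lee_fin mulr_ge0 ?expR_ge0// divr_ge0 ?enorm_ge0 ?exprn_ge0 ?ltW.
have [->|x0] := eqVneq x 0%R; first by rewrite f00 mul0e.
transitivity (f x * \int[mu]_(t in D) (enorm x * expR (- (enorm x * t)))%:E); last first.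
  by rewrite integral_exp_pos ?mule1// enorm_gt0.
congr *%E; rewrite [RHS](@ge0_integral_pos_inv _ 1)//; last 2 first.
  by mf.
  by move=> t t0; rewrite lee_fin mulr_ge0 ?expR_ge0 ?enorm_ge0.
apply: eq_integral => t; rewrite in_itv0y => t0.
by rewrite -EFinM !mul1r mulrAC.
Qed.

(** Along the ray of [x] the inversion is [t -> (C / |x|^2) / t], which preserves [dt / t]; the
    Jacobian therefore comes from the factor [t ^+ n] of polar coordinates alone. *)
Lemma ge0_integral_rV_inv n (C : R) (f : 'rV[R]_n -> \bar R) : (0 < n)%N ->
  (0 < C)%R -> f 0%R = 0 -> measurable_fun setT f -> (forall x, 0 <= f x) ->
  \int[@lebesgue_rV R n]_x f x =
  \int[@lebesgue_rV R n]_x (f ((C / enorm x ^+ 2) *: x)%R *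
                            (C ^+ n / (enorm x ^+ 2) ^+ n)%:E).
Proof.
move=> n0 C0 f00 mf f0.
rewrite [RHS]ge0_integral_rV_polar; last 3 first.
  (* At the origin the weight is 0, because [0 ^+ n = 0] for [n > 0] and division by 0 returns 0. *)
  have -> : (C ^+ n / (enorm (0 : 'rV[R]_n) ^+ 2) ^+ n = 0)%R.
    by rewrite enorm0 expr0n/= expr0n gtn_eqF// invr0 mulr0.
  by rewrite mule0.
  by mf.
  by move=> x; rewrite mule_ge0// lee_fin divr_ge0 ?exprn_ge0 ?enorm_ge0 ?ltW.
rewrite ge0_integral_rV_polar//; apply: eq_integral => x _.
have [->|x0] := eqVneq x 0%R; first by rewrite enorm0 mul0r !mul0e.
have ex0 : (0 < enorm x)%R by rewrite enorm_gt0.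
congr *%E.
rewrite [LHS](@ge0_integral_pos_inv _ (C / enorm x ^+ 2)) ?divr_gt0 ?exprn_gt0//; last 2 first.
  by mf.
  move=> t t0; rewrite mule_ge0// lee_fin divr_ge0 ?exprn_ge0 ?ltW//.
apply: eq_integral => t; rewrite in_itv0y => t0.
rewrite enormZ gtr0_norm// scalerA -!muleA -!EFinM; congr (f _ * _%:E).
  by congr (_ *: _)%R; field; rewrite !gt_eqF.
move: (enorm x) ex0 => e e0.
have [m ->] : exists m, n = m.+1 by exists n.-1; rewrite prednK.
rewrite !(exprS _ m) !(exprMn, exprVn).
field.
by rewrite ?expf_neq0 ?gt_eqF.
Qed.

End rV_change_of_variables.

Ltac msr := solve [by apply: measurable_funTS; mf | by mf].

Ltac nneg_leaf := first [assumption | (apply: ltW; assumption) | done].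

Ltac nneg_step :=
  lazymatch goal with
  | |- is_true (@Order.le _ _ _ (EFin _)) => rewrite lee_fin
  | |- is_true (@Order.le _ _ _ (mule _ _)) => apply: mule_ge0
  | |- is_true (@Order.le _ _ _ (adde _ _)) => apply: adde_ge0
  | |- is_true (@Order.le _ _ _ (powR _ _)) => exact: powR_ge0
  | |- is_true (@Order.le _ _ _ (expR _)) => exact: expR_ge0
  | |- is_true (@Order.le _ _ _ (enorm _)) => exact: enorm_ge0
  | |- is_true (@Order.le _ _ _ (`| _ |)) => exact: normr_ge0
  | |- is_true (@Order.le _ _ _ (Num.sqrt _)) => exact: sqrtr_ge0
  | |- is_true (@Order.le _ _ _ (_ * _)) => first [nneg_leaf | apply: mulr_ge0]
  | |- is_true (@Order.le _ _ _ (_ + _)) => first [nneg_leaf | apply: addr_ge0]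
  | |- is_true (@Order.le _ _ _ (_ ^-1)) => rewrite invr_ge0
  | |- is_true (@Order.le _ _ _ (_ ^+ _)) => first [exact: sqr_ge0 | apply: exprn_ge0]
  | |- is_true (@Order.le _ _ _ (if _ then _ else _)) => case: ifP => _
  | |- _ => nneg_leaf
  end.

Ltac nneg := solve [intros; cbv beta; repeat nneg_step].

(** * The Gamma function *)

(** Weighted arithmetic-geometric mean inequality, from [ln y <= y - 1] at [y = x / m] and
    [y = 1 / m], where [m] is the right-hand side: with weights [s] and [1 - s] the two bounds add
    up to 0. *)
Lemma powR_ge_tangent {R : realType} (s x : R) : 0 <= s <= 1 -> 0 < x ->
  x `^ s <= 1 - s + s * x.
Proof.
move=> /andP[s0 s1] x0.
have m0 : 0 < 1 - s + s * x.
  have [s1'|s1'] := ltP s 1; last first.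
    by rewrite (_ : s = 1) ?subrr ?add0r ?mul1r//; lra.
  have : 0 <= s * x by rewrite mulr_ge0// ltW.
  lra.
set m := 1 - s + s * x in m0 *.
have xm : 0 < x / m by rewrite divr_gt0.
have im : 0 < m^-1 by rewrite invr_gt0.
have H1 : ln (x / m) <= x / m - 1.
  by rewrite -[X in ln X](subrK 1) addrC le_ln1Dx// ltrBrDr addNr.
have H2 : ln m^-1 <= m^-1 - 1.
  by rewrite -[X in ln X](subrK 1) addrC le_ln1Dx// ltrBrDr addNr.
have H3 : s * ln (x / m) + (1 - s) * ln m^-1 <= 0.
  apply: (@le_trans _ _ (s * (x / m - 1) + (1 - s) * (m^-1 - 1))).
    by rewrite lerD// ler_wpM2l// subr_ge0.
  rewrite le_eqVlt; apply/orP; left; apply/eqP.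
  have -> : s * (x / m - 1) + (1 - s) * (m^-1 - 1) = m / m - 1 by rewrite {3}/m; ring.
  by rewrite divff ?subrr// gt_eqF.
rewrite /powR gt_eqF// -[leRHS]lnK ?posrE// ler_expR.
move: H3; rewrite ln_div ?posrE// lnV ?posrE//; lra.
Qed.

Section gamma.
Local Open Scope ereal_scope.
Context {R : realType}.
Local Notation mu := (@lebesgue_measure R).
Local Notation D := (`]0%R, +oo[%classic : set R).

Lemma integral_powR_tail (x : R) : (0 < x)%R ->
  \int[mu]_(v in `[1%R, +oo[) (v `^ (- x - 1))%:E = (x^-1)%:E.
Proof.
move=> x0.
have dF (v : R) : (1 <= v)%R ->
    is_derive v 1%R (fun v : R => - x^-1 * v `^ (- x))%R (v `^ (- x - 1))%R.
  move=> v1; have v0 : (0 < v)%R by exact: lt_le_trans v1.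
  have ? := @is_derive1_powR R (- x) v v0.
  apply: is_derive_eq; rewrite /GRing.scale/=.
  by field; rewrite gt_eqF.
rewrite (@ftc_itvcy _ _ _ _ (- x^-1 * 0)%R dF).
- by rewrite powR1 mulr1 mulr0 add0r opprK.
- move=> v v1; have v0 : (0 < v)%R by exact: lt_le_trans v1.
  apply: differentiable_continuous; apply/derivable1_diffP.
  by apply: derivable_powR; rewrite in_itv/= andbT.
- by move=> v _; exact: powR_ge0.
- apply: cvgMr; apply/cvgrPdist_lt => e e0; near=> v.
  have v0 : (0 < v)%R by near: v; exact: nbhs_pinfty_gt.
  rewrite sub0r normrN powRN ger0_norm ?invr_ge0 ?powR_ge0//.
  rewrite invf_plt ?posrE ?powR_gt0//.
  have -> : (e^-1 = (e^-1 `^ x^-1) `^ x)%R.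
    by rewrite -powRrM mulVf ?gt_eqF// powRr1// invr_ge0 ltW.
  rewrite gt0_ltr_powR ?nnegrE ?powR_ge0 ?(ltW v0)//.
Unshelve. all: by end_near. Qed.

Lemma integral_exp_tail (t : R) : (0 < t)%R ->
  \int[mu]_(v in `[1%R, +oo[) (t * expR (- (t * v)))%:E = (expR (- t))%:E.
Proof.
move=> t0.
have dF (v : R) : (1 <= v)%R ->
    is_derive v 1%R (fun v : R => - expR (- (t * v)))%R (t * expR (- (t * v)))%R.
  by move=> _; apply: is_derive_eq; rewrite /GRing.scale/=; ring.
rewrite (@ftc_itvcy _ _ _ _ (- 0)%R dF).
- by rewrite oppr0 add0r opprK mulr1.
- move=> v _; apply: cvgM; first exact: cvg_cst.
  apply: (@continuous_comp _ _ _ (fun v => - (t * v))%R expR); last exact: continuous_expR.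
  by apply: cvgN; apply: cvgM; [exact: cvg_cst|exact: cvg_id].
- by move=> v _; rewrite mulr_ge0 ?expR_ge0 ?ltW.
- apply: cvgN.
  apply: (@cvg_comp _ _ _ (fun v => t * v)%R (fun z => expR (- z))%R _ (pinfty_nbhs R)).
    exact: gt0_cvgMry.
  exact: cvgr_expR.
Qed.

(** Extended-real valued, so that integrals can be exchanged before finiteness is known; the open
    half-line avoids the default value of [powR] at 0. *)
Definition eGamma (x : R) : \bar R := \int[mu]_(t in D) (t `^ (x - 1) * expR (- t))%:E.

Lemma eGamma_ge0 x : 0 <= eGamma x.
Proof. by apply: integral_ge0 => t _; rewrite lee_fin mulr_ge0 ?powR_ge0 ?expR_ge0. Qed.

Lemma eGamma_scale (x p : R) : (0 < p)%R ->
  \int[mu]_(t in D) (t `^ (x - 1) * expR (- (p * t)))%:E = (p `^ (- x))%:E * eGamma x.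
Proof.
move=> p0; rewrite /eGamma [in RHS](@ge0_integral_pos_scale _ p)//; last 2 first.
  by apply: measurable_funTS; mf.
  by move=> t _; rewrite lee_fin mulr_ge0 ?powR_ge0 ?expR_ge0.
rewrite muleA -EFinM -ge0_integralZl//; last 3 first.
  by apply: measurable_funTS; mf.
  by move=> t _; rewrite lee_fin mulr_ge0 ?powR_ge0 ?expR_ge0.
  by rewrite lee_fin mulr_ge0 ?powR_ge0 ?(ltW p0).
apply: eq_integral => t; rewrite in_itv0y => t0.
rewrite -EFinM powRM ?(ltW p0) ?(ltW t0)//; congr _%:E.
have H : (p `^ (- x) * p * p `^ (x - 1) = 1)%R.
  rewrite -{2}[p]powRr1 ?(ltW p0)// -!powRD ?(gt_eqF p0) ?implybT//.
  by rewrite (_ : _ + _ = 0)%R ?powRr0//; ring.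
transitivity (p `^ (- x) * p * p `^ (x - 1) * (t `^ (x - 1) * expR (- (p * t))))%R.
  by rewrite H mul1r.
by ring.
Qed.

(** Tonelli in place of integration by parts: [1 / x] and [e^(- t)] are integrals of [v^(- x - 1)]
    and [t e^(- t v)] over [v >= 1], and scaling by [v] identifies the two double integrals.
    Finiteness is not presupposed. *)
Lemma eGammaS (x : R) : (0 < x)%R -> eGamma (x + 1) = x%:E * eGamma x.
Proof.
move=> x0.
have H : eGamma x = (x^-1)%:E * eGamma (x + 1).
  rewrite -integral_powR_tail// -ge0_integralZr ?eGamma_ge0//; last 2 first.
    by apply: measurable_funTS; mf.
    by move=> t _; rewrite lee_fin powR_ge0.
  transitivity (\int[mu]_(t in D) \int[mu]_(v in `[1%R, +oo[)
      (t `^ (x + 1 - 1) * expR (- (v * t)))%:E).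
    apply: eq_integral => t; rewrite in_itv0y => t0.
    rewrite EFinM -integral_exp_tail// -ge0_integralZl ?lee_fin ?powR_ge0//; last 2 first.
      by apply: measurable_funTS; mf.
      by move=> v _; rewrite lee_fin mulr_ge0 ?expR_ge0 ?ltW.
    apply: eq_integral => v _; rewrite -EFinM; congr _%:E.
    rewrite addrK mulrA (mulrC v t); congr *%R.
    by rewrite mulrC mulr_powRB1 ?ltW.
  rewrite tonelli_mu//; last 2 first.
    by apply: measurable_funTS; mf.
    by move=> t v _ _; rewrite lee_fin mulr_ge0 ?powR_ge0 ?expR_ge0.
  apply: eq_integral => v; rewrite inE/= in_itv/= andbT => v1.
  have v0 : (0 < v)%R by exact: lt_le_trans v1.
  by rewrite eGamma_scale// opprD.
by rewrite H muleA -EFinM divff ?gt_eqF// mul1e.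
Qed.

(** The functional equation shifts the argument to [x + 1], where the integrand has no singularity
    at 0. *)
Lemma eGamma_lty (x : R) : (0 < x)%R -> eGamma x < +oo.
Proof.
move=> x0; suff : eGamma (x + 1) < +oo.
  rewrite eGammaS//; have := eGamma_ge0 x.
  by case: (eGamma x) => [r|//|//] _; rewrite ?ltry// gt0_muley ?lte_fin.
(* From [t <= m e^(t / m)] one gets [t^x <= m^x e^(t x / m)]; this [m] makes [x / m < 1 / 2], so
   that a factor [e^(- t / 2)] is left for convergence. *)
pose m : R := (2 * (x + 1))%R.
have m0 : (0 < m)%R by rewrite /m; lra.
apply: (@le_lt_trans _ _ (\int[mu]_(t in D) ((m `^ x * 2)%:E * (2^-1 * expR (- (2^-1 * t)))%:E))).
  apply: ge0_le_integral => //; try msr; try nneg.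
  move=> t; rewrite itv0yE => t0; rewrite -EFinM lee_fin addrK.
  have tm : (t <= m * expR (t / m))%R.
    rewrite mulrC -ler_pdivrMr//; apply: le_trans (expR_ge1Dx _).
    by rewrite lerDr.
  apply: (@le_trans _ _ ((m * expR (t / m)) `^ x * expR (- t)))%R.
    rewrite ler_wpM2r ?expR_ge0//; apply: ge0_ler_powR => //.
    - exact: ltW.
    - by rewrite nnegrE ltW.
    - by rewrite nnegrE mulr_ge0 ?expR_ge0// ltW.
  rewrite powRM ?expR_ge0 ?(ltW m0)// -expRM.
  rewrite (_ : m `^ x * 2 * _ = m `^ x * expR (- (2^-1 * t)))%R; last by field.
  rewrite -mulrA ler_wpM2l ?powR_ge0// -expRD ler_expR.
  have -> : (t / m * x = 2^-1 * t - t / m)%R.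
    by rewrite /m; field; rewrite gt_eqF//; lra.
  have : (0 <= t / m)%R by rewrite divr_ge0 ?ltW.
  lra.
rewrite ge0_integralZl ?lee_fin ?mulr_ge0 ?powR_ge0//; try msr; try nneg.
by rewrite integral_exp_pos ?mule1 ?ltry// invr_gt0.
Qed.

Lemma eGamma_gt0 (x : R) : (0 < x)%R -> 0 < eGamma x.
Proof.
move=> x0.
have H : (0 < (2 `^ `|x - 1|)^-1 * expR (- 2 : R))%R.
  by rewrite mulr_gt0 ?expR_gt0 ?invr_gt0 ?powR_gt0.
have HI : \int[mu]_(t in `[1%R, 2%R]) ((2 `^ `|x - 1|)^-1 * expR (- 2))%:E =
          ((2 `^ `|x - 1|)^-1 * expR (- 2))%:E.
  rewrite integral_cst//= lebesgue_measure_itv/= lte_fin ltr1n -EFinB.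
  by rewrite (_ : 2 - 1 = 1 :> R)%R ?mule1//; lra.
apply: (@lt_le_trans _ _ (\int[mu]_(t in `[1%R, 2%R])
   ((2 `^ `|x - 1|)^-1 * expR (- 2))%:E)); first by rewrite HI lte_fin.
apply: (@le_trans _ _ (\int[mu]_(t in `[1%R, 2%R]) (t `^ (x - 1) * expR (- t))%:E)).
  apply: ge0_le_integral => //; try msr; try nneg.
  move=> t; rewrite /= in_itv/= => /andP[t1 t2].
  have t0 : (0 < t)%R by exact: lt_le_trans t1.
  rewrite lee_fin ler_pM ?invr_ge0 ?powR_ge0 ?expR_ge0//; last by rewrite ler_expR lerN2.
  apply: (@le_trans _ _ (t `^ (- `|x - 1|)))%R.
    rewrite powRN lef_pV2 ?posrE ?powR_gt0// ge0_ler_powR ?nnegrE// ltW//.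
  by apply: ler_powR => //; rewrite lerNnormlW.
apply: ge0_subset_integral => //.
- by apply: measurable_funTS; mf.
- by move=> t _; rewrite lee_fin mulr_ge0 ?powR_ge0 ?expR_ge0.
- move=> t; rewrite /= !in_itv/= andbT => /andP[t1 _]; exact: lt_le_trans t1.
Qed.

Lemma GammaE (x : R) : (0 < x)%R -> (Gamma x)%:E = eGamma x.
Proof.
move=> x0; rewrite /Gamma x0 /Gamma_pos /Rintegral.
rewrite -integral_itv_obnd_cbnd; last by apply: measurable_funTS; mf.
by rewrite fineK// ge0_fin_numE ?eGamma_ge0// eGamma_lty.
Qed.

Lemma Gamma_gt0 (x : R) : (0 < x)%R -> (0 < Gamma x)%R.
Proof. by move=> x0; rewrite -lte_fin GammaE// eGamma_gt0. Qed.

Lemma GammaS (x : R) : (0 < x)%R -> (Gamma (x + 1) = x * Gamma x)%R.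
Proof.
by move=> x0; apply: EFin_inj; rewrite EFinM !GammaE ?eGammaS//; lra.
Qed.

Lemma Gamma1 : Gamma 1 = 1%R :> R.
Proof.
apply: EFin_inj; rewrite GammaE// /eGamma -integral_expRN_pos.
by apply: eq_integral => t _; rewrite subrr powRr0 mul1r.
Qed.

(** [Gamma (a + b) / (1 + t)^(a + b)] is the integral of [u^(a + b - 1) e^(- (1 + t) u)]; in the
    resulting double integral the [t]-integral is again a Gamma integral. *)
Lemma integral_beta (a b : R) : (0 < a)%R -> (0 < b)%R ->
  \int[mu]_(t in D) (t `^ (b - 1) / (1 + t) `^ (a + b))%:E =
  (Gamma a * Gamma b / Gamma (a + b))%:E.
Proof.
move=> a0 b0; have ab0 : (0 < a + b)%R by exact: addr_gt0.
suff H : (Gamma (a + b))%:E *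
    (\int[mu]_(t in D) (t `^ (b - 1) / (1 + t) `^ (a + b))%:E) =
    (Gamma a * Gamma b)%:E.
  rewrite mulrC EFinM -H muleA -EFinM mulVf ?mul1e//.
  by rewrite gt_eqF ?Gamma_gt0.
rewrite -ge0_integralZl ?lee_fin ?(ltW (Gamma_gt0 _ ab0))//; try msr; try nneg.
transitivity (\int[mu]_(t in D) \int[mu]_(u in D)
    (t `^ (b - 1) * (u `^ (a + b - 1) * expR (- ((1 + t) * u))))%:E).
  apply: eq_integral => t; rewrite in_itv0y => t0.
  under [RHS]eq_integral do rewrite EFinM.
  rewrite ge0_integralZl ?lee_fin ?powR_ge0//; last 2 first.
    by apply: measurable_funTS; mf.
    by move=> u _; rewrite lee_fin mulr_ge0 ?powR_ge0 ?expR_ge0.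
  rewrite eGamma_scale ?addr_gt0// -GammaE// -!EFinM powRN; congr _%:E.
  by rewrite [LHS]mulrC [RHS]mulrA.
rewrite tonelli_mu//; last 2 first.
  by apply: measurable_funTS; mf.
  by move=> t v _ _; rewrite lee_fin !mulr_ge0 ?powR_ge0 ?expR_ge0.
transitivity (\int[mu]_(u in D) ((u `^ (a - 1) * expR (- u))%:E * (Gamma b)%:E)).
  apply: eq_integral => u; rewrite in_itv0y => u0.
  transitivity (\int[mu]_(t in D) ((u `^ (a + b - 1) * expR (- u))%:E *
      (t `^ (b - 1) * expR (- (u * t)))%:E)).
    apply: eq_integral => t _; rewrite -EFinM; congr _%:E.
    have -> : (- ((1 + t) * u) = - u + - (u * t))%R by ring.
    by rewrite expRD; ring.
  rewrite ge0_integralZl//; last 3 first.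
    by apply: measurable_funTS; mf.
    by move=> t _; rewrite lee_fin mulr_ge0 ?powR_ge0 ?expR_ge0.
    by rewrite lee_fin mulr_ge0 ?powR_ge0 ?expR_ge0.
  rewrite eGamma_scale// -GammaE// -!EFinM mulrA; congr (_ * _)%:E.
  rewrite mulrAC -powRD ?(gt_eqF u0) ?implybT//.
  by congr (_ `^ _ * _)%R; ring.
rewrite ge0_integralZr ?lee_fin ?(ltW (Gamma_gt0 _ b0))//; try msr; try nneg.
by rewrite EFinM (GammaE a a0).
Qed.

(** Wendel's inequality: the tangent bound for [t^s] at [t = x], integrated against
    [t^(x - 1) e^(- t)]. *)
Lemma Gamma_le_powR (x s : R) : (0 < x)%R -> (0 <= s <= 1)%R ->
  (Gamma (x + s) <= x `^ s * Gamma x)%R.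
Proof.
move=> x0 /andP[s0 s1].
rewrite -lee_fin GammaE; last by lra.
apply: (@le_trans _ _ (\int[mu]_(t in D)
   ((x `^ s * (1 - s))%:E * (t `^ (x - 1) * expR (- t))%:E +
    (x `^ s * (s / x))%:E * (t `^ (x + 1 - 1) * expR (- t))%:E))).
  apply: ge0_le_integral => //; try msr; try nneg.
  move=> t; rewrite itv0yE => t0; rewrite -!EFinM -EFinD lee_fin.
  have -> : (x + s - 1 = x - 1 + s)%R by ring.
  rewrite powRD ?(gt_eqF t0) ?implybT// addrK.
  have -> : (t `^ x = t * t `^ (x - 1))%R by rewrite mulr_powRB1// ltW.
  have H : (t `^ s <= x `^ s * (1 - s + s * (t / x)))%R.
    have -> : (t `^ s = x `^ s * (t / x) `^ s)%R.
      rewrite -powRM ?divr_ge0 ?(ltW t0) ?(ltW x0)//; congr (_ `^ _)%R.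
      by field; rewrite gt_eqF.
    by rewrite ler_wpM2l ?powR_ge0// powR_ge_tangent ?s0 ?divr_gt0.
  apply: (@le_trans _ _ (t `^ (x - 1) * (x `^ s * (1 - s + s * (t / x))) * expR (- t)))%R.
    by rewrite ler_wpM2r ?expR_ge0// ler_wpM2l ?powR_ge0.
  by rewrite le_eqVlt; apply/orP; left; apply/eqP; ring.
have c1 : (0 <= x `^ s * (1 - s))%R by rewrite mulr_ge0 ?powR_ge0 ?subr_ge0.
have c2 : (0 <= x `^ s * (s / x))%R.
  by rewrite !mulr_ge0 ?powR_ge0// invr_ge0 ltW.
rewrite ge0_integralD//; last 4 first.
  by move=> t _; rewrite mule_ge0 ?lee_fin// mulr_ge0 ?powR_ge0 ?expR_ge0.
  by apply: measurable_funTS; mf.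
  by move=> t _; rewrite mule_ge0 ?lee_fin// mulr_ge0 ?powR_ge0 ?expR_ge0.
  by apply: measurable_funTS; mf.
rewrite !ge0_integralZl ?lee_fin//; last 4 first.
  by apply: measurable_funTS; mf.
  by move=> t _; rewrite lee_fin mulr_ge0 ?powR_ge0 ?expR_ge0.
  by apply: measurable_funTS; mf.
  by move=> t _; rewrite lee_fin mulr_ge0 ?powR_ge0 ?expR_ge0.
rewrite -/(eGamma x) -/(eGamma (x + 1)) -!GammaE//; last by lra.
rewrite -!EFinM -EFinD lee_fin GammaS// le_eqVlt; apply/orP; left; apply/eqP.
by field; rewrite gt_eqF.
Qed.

End gamma.

(** * The reflection formula *)

Section reflection.
Context {R : realType}.
Local Notation mu := (@lebesgue_measure R).

Let J : set R := `[0%R, (pi / 2)%R]%classic.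

(** Cauchy's cosine integral, a multiple of [1 / (Gamma (N + 1 + s) Gamma (N + 1 - s))]. For [s = 0]
    it is the Wallis integral; for [N = 0] it produces the sine of the reflection formula. *)
Definition wallis (s : R) (N : nat) : R :=
  \int[mu]_(x in `[0%R, (pi / 2)%R]) (cos (2 * s * x) * cos x ^+ N.*2).

Let pihalf_gt0 : 0 < (pi : R) / 2. Proof. by rewrite divr_gt0 ?pi_gt0. Qed.

Let cont_cosM (s x : R) : {for x, continuous (fun x => cos (2 * s * x))}.
Proof.
apply: (@continuous_comp _ _ _ (fun x => 2 * s * x) (@cos R)); last exact: continuous_cos.
by apply: cvgM; [exact: cvg_cst|exact: cvg_id].
Qed.

Let cont_wallis (s : R) N : continuous (fun x => cos (2 * s * x) * cos x ^+ N).
Proof.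
move=> x; apply: cvgM; first exact: cont_cosM.
by apply: (@continuous_comp _ _ _ (@cos R) (fun y => y ^+ N)); [exact: continuous_cos|exact: exprn_continuous].
Qed.

Let int_continuous (f : R -> R) : continuous f -> mu.-integrable J (EFin \o f).
Proof.
move=> cf; apply: continuous_compact_integrable; first exact: segment_compact.
exact: continuous_subspaceT.
Qed.

Lemma wallis0 (s : R) : s != 0 -> wallis s 0 = sin (pi * s) / (2 * s).
Proof.
move=> s0; rewrite /wallis /Rintegral.
under eq_integral do rewrite expr0 mulr1.
have dF (x : R) : 0 <= x <= pi / 2 ->
    is_derive x 1 (fun x : R => (2 * s)^-1 * sin (2 * s * x)) (cos (2 * s * x)).
  by move=> _; apply: is_derive_eq; rewrite /GRing.scale/=; field.
rewrite (@ftc_itvcc _ _ _ _ _ pihalf_gt0 dF)/=; last by move=> x _; exact: cont_cosM.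
by rewrite mulr0 sin0 mulr0 subr0 mulrC; congr (sin _ / _); field.
Qed.

Lemma wallis00 : wallis 0 0 = pi / 2.
Proof.
rewrite /wallis /Rintegral.
under eq_integral do rewrite expr0 mulr1 mulr0 mul0r cos0.
rewrite integral_cst//= lebesgue_measure_itv/= lte_fin pihalf_gt0.
by rewrite oppr0 adde0 mul1e.
Qed.

Lemma is_derive_cosX (x : R) n :
  is_derive x 1 (fun x : R => cos x ^+ n.+1) (n.+1%:R * cos x ^+ n * - sin x).
Proof.
have H := @is_deriveX R R (@cos R) n.+1 x 1 (- sin x) (is_derive_cos x).
by rewrite exprfctE in H; exact: H.
Qed.

(** Two integrations by parts packed into one antiderivative [F], which vanishes at 0 through the
    sines and at [pi / 2] through the cosine. *)
Lemma wallisS (s : R) N :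
  (N.+1%:R ^+ 2 - s ^+ 2) * wallis s N.+1 = N.+1%:R * (N%:R + 2^-1) * wallis s N.
Proof.
pose M : R := N.+1.*2%:R.
have ME : M = 2 * N.+1%:R by rewrite /M -muln2 natrM mulrC.
have N1 : N.+1%:R = N%:R + 1 :> R by rewrite natr1.
pose F (x : R) := M * cos x ^+ N.*2.+1 * sin x * cos (2 * s * x)
   - 2 * s * cos x ^+ N.+1.*2 * sin (2 * s * x).
pose f (x : R) := (M ^+ 2 - 4 * s ^+ 2) * (cos (2 * s * x) * cos x ^+ N.+1.*2)
   - M * (M - 1) * (cos (2 * s * x) * cos x ^+ N.*2).
have dF (x : R) : 0 <= x <= pi / 2 -> is_derive x 1 F (f x).
  move=> _; rewrite /F.
  have d1 := is_derive_cosX x N.*2.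
  have d2 := is_derive_cosX x N.*2.+1; rewrite -doubleS in d2.
  have d3 : is_derive x 1 (fun x : R => cos (2 * s * x)) (- sin (2 * s * x) * (2 * s)).
    by apply: is_derive_eq; rewrite /GRing.scale/=; ring.
  have d4 : is_derive x 1 (fun x : R => sin (2 * s * x)) (cos (2 * s * x) * (2 * s)).
    by apply: is_derive_eq; rewrite /GRing.scale/=; ring.
  apply: is_derive_eq; rewrite /GRing.scale/= /f.
  have H : N.*2.+1%:R = M - 1 by rewrite /M doubleS -[in RHS]natr1 addrK.
  have H2 : N.*2.+2%:R = M by rewrite /M doubleS.
  have sc : sin x * sin x = 1 - cos x * cos x by rewrite -!expr2 sin2cos2.
  have e1 : cos x ^+ N.*2.+1 = cos x * cos x ^+ N.*2 by rewrite exprS.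
  have e2 : cos x ^+ N.+1.*2 = cos x * (cos x * cos x ^+ N.*2) by rewrite doubleS !exprS.
  rewrite H2 H e1 e2.
  move: (cos x) (sin x) (cos x ^+ _) (cos (2 * s * x)) (sin (2 * s * x)) sc.
  move=> c t u c2 s2 sc.
  transitivity (M * ((M - 1) * u * - (t * t) + c * u * c) * c2
    - 4 * s ^+ 2 * (c * (c * u)) * c2); first by ring.
  by rewrite sc; ring.
have cf : continuous f.
  by move=> x; apply: cvgB; (apply: cvgM; [exact: cvg_cst|exact: cont_wallis]).
have H : \int[mu]_(x in J) f x = 0.
  rewrite /Rintegral (@ftc_itvcc _ _ _ _ _ pihalf_gt0 dF)/=; last by move=> x _; exact: cf.
  by rewrite /F cos_pihalf !mulr0 sin0 doubleS !exprS !(mul0r, mulr0) !subrr.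
have i1 := int_continuous _ (cont_wallis s N.+1.*2).
have i0 := int_continuous _ (cont_wallis s N.*2).
have c1 : mu.-integrable J (EFin \o (fun x => (M ^+ 2 - 4 * s ^+ 2) * (cos (2 * s * x) * cos x ^+ N.+1.*2))).
  by apply: int_continuous => x; apply: cvgM; [exact: cvg_cst|exact: cont_wallis].
have c0 : mu.-integrable J (EFin \o (fun x => M * (M - 1) * (cos (2 * s * x) * cos x ^+ N.*2))).
  by apply: int_continuous => x; apply: cvgM; [exact: cvg_cst|exact: cont_wallis].
have mJ : measurable J by exact: measurable_itv.
move: H; rewrite /f RintegralB// !RintegralZl//.
rewrite -/(wallis s N.+1) -/(wallis s N) ME N1 => H.
apply: (@mulfI _ 4) => //; apply/eqP; rewrite -subr_eq0 -H; apply/eqP.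
by field.
Qed.

Lemma wallis0_gt0 N : 0 < wallis 0 N.
Proof.
elim: N => [|N IH]; first by rewrite wallis00.
have := wallisS 0 N; rewrite expr0n/= subr0 => H.
have N1 : 0 < N.+1%:R :> R by rewrite ltr0n.
have : 0 < N.+1%:R ^+ 2 * wallis 0 N.+1.
  by rewrite H !mulr_gt0// ltr_wpDl// invr_gt0.
by rewrite pmulr_rgt0// exprn_gt0.
Qed.

Lemma cos_mul2_ge (s x : R) : 0 <= s <= 1 -> 0 <= x <= pi / 2 ->
  2 * cos x ^+ 2 - 1 <= cos (2 * s * x).
Proof.
move=> /andP[s0 s1] /andP[x0 x1].
have xpi : x <= pi by apply: le_trans x1 _; have := pi_gt0 R; lra.
have sx0 : 0 <= s * x by rewrite mulr_ge0.
have sxx : s * x <= x by rewrite ler_piMl.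
have -> : 2 * s * x = (s * x) *+ 2 by rewrite mulr2n; ring.
rewrite cos_mulr2n (_ : cos (s * x) ^+ 2 *+ 2 = 2 * cos (s * x) ^+ 2); last by rewrite mulr_natl.
rewrite lerD2r ler_pM2l// ler_pXn2r// ?nnegrE.
- have [->//|sxn] := eqVneq (s * x) x.
  apply/ltW; rewrite ltr_cos ?in_itv/= ?x0 ?sx0 ?xpi ?(le_trans sxx)//.
  by rewrite lt_neqAle sxn.
- by apply: cos_ge0_pihalf; rewrite x1 andbT; apply: le_trans x0; have := pi_gt0 R; lra.
- apply: cos_ge0_pihalf; rewrite (le_trans sxx)// andbT; apply: le_trans sx0.
  have := pi_gt0 R; lra.
Qed.

(** Integrates [cos (2 x) <= cos (2 s x) <= 1] against [cos(x)^(2 N)]. With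
    [cos (2 x) = 2 cos(x)^2 - 1] the lower end is twice the Wallis integral of index [N + 1] minus
    that of index [N], and the recursion evaluates it. *)
Lemma wallis_bounds (s : R) N : 0 <= s <= 1 ->
  N%:R / N.+1%:R * wallis 0 N <= wallis s N <= wallis 0 N.
Proof.
move=> s01.
have i0 M := int_continuous _ (cont_wallis 0 M).
have ints := int_continuous _ (cont_wallis s N.*2).
have c2 : mu.-integrable J (EFin \o (fun x => 2 * (cos (2 * 0 * x) * cos x ^+ N.+1.*2))).
  by apply: int_continuous => x; apply: cvgM; [exact: cvg_cst|exact: cont_wallis].
have cosN0 (x : R) : J x -> 0 <= cos x ^+ N.*2.
  by move=> _; rewrite -mul2n exprM exprn_ge0// sqr_ge0.
apply/andP; split.
  have N1 : 0 < N.+1%:R :> R by rewrite ltr0n.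
  have -> : N%:R / N.+1%:R * wallis 0 N = 2 * wallis 0 N.+1 - wallis 0 N.
    have := wallisS 0 N; rewrite expr0n/= subr0 => H.
    have -> : wallis 0 N.+1 = (N%:R + 2^-1) / N.+1%:R * wallis 0 N.
      apply: (@mulfI _ (N.+1%:R ^+ 2)); first by rewrite expf_neq0// gt_eqF.
      by rewrite H; field; rewrite ?(addrC 1) natr1 gt_eqF.
    by rewrite -natr1; field; rewrite ?(addrC 1) natr1 gt_eqF.
  rewrite /wallis -RintegralZl// -RintegralB//.
  apply: le_Rintegral => //.
    apply: int_continuous => x; apply: cvgB; last exact: cont_wallis.
    by apply: cvgM; [exact: cvg_cst|exact: cont_wallis].
  move=> x Jx; rewrite mulr0 mul0r cos0.
  have -> : 2 * (1 * cos x ^+ N.+1.*2) - 1 * cos x ^+ N.*2 =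
      (2 * cos x ^+ 2 - 1) * cos x ^+ N.*2 by rewrite doubleS !exprS; ring.
  by rewrite ler_wpM2r ?cosN0// cos_mul2_ge.
apply: le_Rintegral => // x Jx; rewrite mulr0 mul0r cos0.
by rewrite ler_wpM2r ?cosN0// cos_le1.
Qed.

(* Both sides satisfy the same two-term recursion in [N]; as [N] grows the two
   bounds on [wallis] and on [Gamma] pinch it to the reflection formula. *)
Lemma wallis_Gamma (s : R) N : 0 < s < 1 ->
  wallis s N * (Gamma (N%:R + 1 + s) * Gamma (N%:R + 1 - s)) * pi =
  wallis 0 N * Gamma (N%:R + 1) ^+ 2 * (sin (pi * s) * (Gamma s * Gamma (1 - s))).
Proof.
move=> /andP[s0 s1]; elim: N => [|N IH].
  rewrite wallis0 ?gt_eqF// wallis00 !add0r Gamma1 (addrC 1) GammaS//.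
  by field; rewrite gt_eqF.
have N0 : 0 <= N%:R :> R by rewrite ler0n.
have Hs := wallisS s N; have H0 := wallisS 0 N.
have E : N.+1%:R = N%:R + 1 :> R by rewrite natr1.
move: Hs H0; rewrite E expr0n/= subr0 => Hs H0.
set n := N%:R in IH Hs H0 N0 *.
have -> : n + 1 + 1 + s = n + 1 + s + 1 by ring.
have -> : n + 1 + 1 - s = n + 1 - s + 1 by ring.
rewrite (@GammaS _ (n + 1 + s)); last by lra.
rewrite (@GammaS _ (n + 1 - s)); last by lra.
rewrite (@GammaS _ (n + 1)); last by lra.
transitivity (((n + 1) ^+ 2 - s ^+ 2) * wallis s N.+1 * (Gamma (n + 1 + s) * Gamma (n + 1 - s)) * pi).
  by ring.
rewrite Hs.
transitivity ((n + 1) ^+ 2 * wallis 0 N.+1 * Gamma (n + 1) ^+ 2 * (sin (pi * s) * (Gamma s * Gamma (1 - s)))).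
  rewrite H0; transitivity ((n + 1) * (n + 2^-1) * (wallis s N * (Gamma (n + 1 + s) * Gamma (n + 1 - s)) * pi)).
    by ring.
  by rewrite IH; ring.
by ring.
Qed.

(** Each side multiplies two instances of [Gamma (x + s) <= x^s Gamma x], one with exponent [s] and
    one with [1 - s]. The powers left over have a ratio at most [((n + 1) / n)^s], hence at most
    [(n + 1) / n]. *)
Lemma Gamma_shift_bounds (s : R) N : 0 < s < 1 -> (0 < N)%N ->
  N%:R / (N%:R + 1) * Gamma (N%:R + 1) ^+ 2 <=
  Gamma (N%:R + 1 + s) * Gamma (N%:R + 1 - s) <=
  (N%:R + 1) / N%:R * Gamma (N%:R + 1) ^+ 2.
Proof.
move=> /andP[s0 s1] N0; set n : R := N%:R.
have n0 : 0 < n by rewrite ltr0n.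
have r1 : 1 <= (n + 1) / n by rewrite ler_pdivlMr// mul1r lerDl.
have rs : ((n + 1) / n) `^ s <= (n + 1) / n by rewrite ler1_powR// ltW.
have n10 : 0 < n + 1 by lra.
have Gn1 : Gamma (n + 1) = n * Gamma n by rewrite GammaS.
have g1 : 0 < Gamma (n + 1) by apply: Gamma_gt0; lra.
have gA : 0 < Gamma (n + 1 + s) by apply: Gamma_gt0; lra.
have gB : 0 < Gamma (n + 1 - s) by apply: Gamma_gt0; lra.
have split1 (y : R) : 0 < y -> y `^ (1 - s) = y / y `^ s.
  by move=> y0; rewrite powRB ?powRr1 ?(ltW y0)// (gt_eqF y0) implybT.
have split2 (y z : R) : 0 < y -> 0 < z -> y `^ s / z `^ s = (y / z) `^ s.
  move=> y0 z0; rewrite powRM ?invr_ge0 ?(ltW y0) ?(ltW z0)//; congr (_ * _).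
  by rewrite -(powR_inv1 (ltW z0)) -powRrM mulN1r powRN.
apply/andP; split.
  have K1 : Gamma (n + 1) <= Gamma (n + 1 + s) / (n + s) `^ s.
    have ns0 : 0 < n + s by lra.
    have := @Gamma_le_powR _ (n + s) (1 - s) ns0.
    have -> : n + s + (1 - s) = n + 1 by ring.
    have -> : n + 1 + s = n + s + 1 by ring.
    have h01 : 0 <= 1 - s <= 1 by lra.
    rewrite (@GammaS _ (n + s))// split1// => H; apply: le_trans (H h01) _.
    by rewrite mulrAC lexx.
  have K2 : Gamma (n + 1) <= (n + 1 - s) `^ s * Gamma (n + 1 - s).
    have ns0 : 0 < n + 1 - s by lra.
    have := @Gamma_le_powR _ (n + 1 - s) s ns0.
    have -> : n + 1 - s + s = n + 1 by ring.
    by apply; lra.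
  apply: (@le_trans _ _ (n / (n + 1) * ((n + 1) / n * (Gamma (n + 1 + s) * Gamma (n + 1 - s))))).
    rewrite ler_wpM2l//; first by rewrite divr_ge0 ?(ltW n0) ?(ltW n10).
    apply: (@le_trans _ _ (Gamma (n + 1 + s) / (n + s) `^ s * ((n + 1 - s) `^ s * Gamma (n + 1 - s)))).
      by rewrite expr2 ler_pM// ltW.
    have -> : Gamma (n + 1 + s) / (n + s) `^ s * ((n + 1 - s) `^ s * Gamma (n + 1 - s)) =
        ((n + 1 - s) `^ s / (n + s) `^ s) * (Gamma (n + 1 + s) * Gamma (n + 1 - s)) by ring.
    rewrite ler_wpM2r ?mulr_ge0 ?(ltW gA) ?(ltW gB)// split2; [|lra|lra].
    apply: le_trans rs; apply: ge0_ler_powR; first by lra.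
    - by rewrite nnegrE divr_ge0//; lra.
    - by rewrite nnegrE divr_ge0//; lra.
    - rewrite ler_pdivrMr; last by lra.
      rewrite mulrAC ler_pdivlMr//; nra.
  by rewrite mulrA le_eqVlt; apply/orP; left; apply/eqP; field; rewrite !gt_eqF//; lra.
have K1 : Gamma (n + 1 + s) <= (n + 1) `^ s * Gamma (n + 1).
  by apply: Gamma_le_powR => //; lra.
have K2 : Gamma (n + 1 - s) <= Gamma (n + 1) / n `^ s.
  have := @Gamma_le_powR _ n (1 - s) n0.
  have -> : n + (1 - s) = n + 1 - s by ring.
  have h01 : 0 <= 1 - s <= 1 by lra.
  rewrite split1// Gn1 => H; apply: le_trans (H h01) _.
  by rewrite mulrAC lexx.
apply: (@le_trans _ _ ((n + 1) `^ s * Gamma (n + 1) * (Gamma (n + 1) / n `^ s))).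
  by rewrite ler_pM// ltW.
have -> : (n + 1) `^ s * Gamma (n + 1) * (Gamma (n + 1) / n `^ s) =
  (n + 1) `^ s / n `^ s * Gamma (n + 1) ^+ 2 by ring.
by rewrite ler_wpM2r ?sqr_ge0// split2.
Qed.

Lemma Gamma_reflection (s : R) : 0 < s < 1 ->
  sin (pi * s) * (Gamma s * Gamma (1 - s)) = pi.
Proof.
move=> s01; have /andP[s0 s1] := s01.
set X := sin (pi * s) * _.
have pi0 := pi_gt0 R.
have X0 : 0 < X.
  rewrite /X mulr_gt0//; last by rewrite mulr_gt0// Gamma_gt0//; lra.
  by apply: sin_gt0_pi; rewrite mulr_gt0//= gtr_pMr.
have key N : (0 < N)%N ->
    (N%:R / (N%:R + 1)) ^+ 2 * pi <= X /\ X <= (N%:R + 1) / N%:R * pi.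
  move=> N0; set n : R := N%:R.
  have n0 : 0 < n by rewrite ltr0n.
  have n1 : 0 < n + 1 by lra.
  have H := wallis_Gamma s N s01.
  have /andP[G1 G2] := Gamma_shift_bounds s N s01 N0.
  have /andP[W1 W2] : N%:R / N.+1%:R * wallis 0 N <= wallis s N <= wallis 0 N.
    by apply: wallis_bounds; rewrite !ltW.
  move: H G1 G2 W1; rewrite -natr1 -/n -/X => H G1 G2 W1.
  have W0 := wallis0_gt0 N.
  have g0 : 0 < Gamma (n + 1) by apply: Gamma_gt0.
  set P := Gamma (n + 1 + s) * _ in H G1 G2.
  have c0 : 0 < wallis 0 N * Gamma (n + 1) ^+ 2 by rewrite mulr_gt0// exprn_gt0.
  have P0 : 0 <= P by apply: le_trans G1; rewrite mulr_ge0 ?sqr_ge0// divr_ge0 ?ltW.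
  have r0 : 0 <= n / (n + 1) by rewrite divr_ge0 ?ltW.
  split; rewrite -(ler_pM2l c0).
    rewrite -H.
    have -> : wallis 0 N * Gamma (n + 1) ^+ 2 * ((n / (n + 1)) ^+ 2 * pi) =
      (n / (n + 1) * wallis 0 N) * (n / (n + 1) * Gamma (n + 1) ^+ 2) * pi by ring.
    by rewrite ler_wpM2r ?(ltW pi0)// ler_pM// mulr_ge0 ?sqr_ge0 ?(ltW W0).
  apply: (@le_trans _ _ (wallis 0 N * ((n + 1) / n * Gamma (n + 1) ^+ 2) * pi)).
    rewrite -H ler_wpM2r ?(ltW pi0)// ler_pM//.
    by apply: le_trans W1; rewrite mulr_ge0// ltW.
  by rewrite le_eqVlt; apply/orP; left; apply/eqP; ring.
apply/eqP; rewrite eq_le; apply/andP; split; apply/ler_addgt0Pr => e e0.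
  (* [N > pi / e] makes the excess [pi / N] smaller than [e]. *)
  pose N := (Num.truncn (pi / e)).+1.
  have [_ H] := key N isT.
  apply: le_trans H _.
  have N0 : 0 < N%:R :> R by rewrite ltr0n.
  have : pi / e < N%:R by rewrite truncnS_gt.
  rewrite ltr_pdivrMr// => H.
  rewrite mulrAC ler_pdivrMr//; nra.
(* Here the defect is [1 - (n / (n + 1))^2 <= 2 / n], hence the factor 2. *)
pose N := (Num.truncn (2 * pi / e)).+1.
have [H _] := key N isT.
apply: (@le_trans _ _ ((N%:R / (N%:R + 1)) ^+ 2 * pi + e)); last by rewrite lerD2r.
have N0 : 0 < N%:R :> R by rewrite ltr0n.
have : 2 * pi / e < N%:R by rewrite truncnS_gt.
rewrite ltr_pdivrMr// => H2.
set n : R := N%:R in N0 H2 *.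
have n1 : 0 < n + 1 by lra.
rewrite expr_div_n mulrAC -lerBlDr ler_pdivlMr ?exprn_gt0//.
nra.
Qed.

Lemma Gamma_half : Gamma 2^-1 = Num.sqrt pi :> R.
Proof.
have h : 0 < (2^-1 : R) < 1 by apply/andP; split; lra.
have := Gamma_reflection _ h.
have -> : 1 - 2^-1 = 2^-1 :> R by lra.
rewrite sin_pihalf mul1r -expr2 => H.
by rewrite -H sqrtr_sqr gtr0_norm// Gamma_gt0//; lra.
Qed.

End reflection.

(** * Uniqueness for the Laplace transform *)

Section laplace.
Local Open Scope ereal_scope.
Context {R : realType}.
Local Notation mu := (@lebesgue_measure R).
Local Notation D := (`]0%R, +oo[%classic : set R).

Definition laplace (f : R -> \bar R) (p : R) : \bar R :=
  \int[mu]_(v in D) (f v * (expR (- (p * v)))%:E).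

Let step (k : R) n v : R := ((1 - expR (- (k * v))) ^+ n)%R.

Let step_ge0 k n v : (0 <= k)%R -> (0 < v)%R -> (0 <= step k n v)%R.
Proof.
move=> k0 v0; rewrite exprn_ge0// subr_ge0 expR_le1 oppr_le0 mulr_ge0//.
exact: ltW.
Qed.

Let step_le1 k n v : (0 <= k)%R -> (0 < v)%R -> (step k n v <= 1)%R.
Proof.
move=> k0 v0; rewrite exprn_ile1//.
- by rewrite subr_ge0 expR_le1 oppr_le0 mulr_ge0// ltW.
Qed.

Lemma laplace_step_ge0 (f : R -> \bar R) p k n v : (forall v, D v -> 0 <= f v) ->
  (0 <= k)%R -> D v -> 0 <= f v * (expR (- (p * v)) * step k n v)%:E.
Proof.
move=> f0 k0 Dv; rewrite mule_ge0 ?f0// lee_fin mulr_ge0 ?expR_ge0// step_ge0//.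
by rewrite itv0yE in Dv.
Qed.

Lemma laplace_moment_le (f : R -> \bar R) p k n : measurable_fun setT f ->
  (forall v, D v -> 0 <= f v) -> (0 <= k)%R ->
  \int[mu]_(v in D) (f v * (expR (- (p * v)) * step k n v)%:E) <= laplace f p.
Proof.
move=> mf f0 k0; apply: ge0_le_integral => //.
- by move=> v Dv; exact: laplace_step_ge0.
- by apply: measurable_funTS; rewrite /step; mf.
- by apply: measurable_funTS; mf.
move=> v Dv; rewrite lee_wpmul2l ?f0// lee_fin ler_piMr ?expR_ge0// step_le1//.
by rewrite itv0yE in Dv.
Qed.

(* The weights [(1 - e^(-k v))^n] are polynomials in [e^(-k v)], so that the
   integrals against them are determined by the transform. *)
Lemma laplace_moment (f g : R -> \bar R) :
  measurable_fun setT f -> measurable_fun setT g ->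
  (forall v, D v -> 0 <= f v) -> (forall v, D v -> 0 <= g v) ->
  (forall p, (0 < p)%R -> laplace f p = laplace g p) ->
  (forall p, (0 < p)%R -> laplace f p < +oo) ->
  forall k n p, (0 <= k)%R -> (0 < p)%R ->
  \int[mu]_(v in D) (f v * (expR (- (p * v)) * step k n v)%:E) =
  \int[mu]_(v in D) (g v * (expR (- (p * v)) * step k n v)%:E).
Proof.
move=> mf mg f0 g0 fg flty k n p k0; elim: n p => [|n IH] p p0.
  by rewrite /step; under eq_integral do rewrite expr0 mulr1;
    under [RHS]eq_integral do rewrite expr0 mulr1; exact: fg.
(* [step k n.+1] is [step k n] minus [e^(- k v) step k n], and the subtracted term is a moment at
   [p + k]: this is why the induction is over all [p]. The identity is kept as a sum, and the finite
   term is cancelled at the end. *)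
have split h : measurable_fun setT h -> (forall v, D v -> 0 <= h v) ->
    \int[mu]_(v in D) (h v * (expR (- (p * v)) * step k n v)%:E) =
    \int[mu]_(v in D) (h v * (expR (- (p * v)) * step k n.+1 v)%:E) +
    \int[mu]_(v in D) (h v * (expR (- ((p + k) * v)) * step k n v)%:E).
  move=> mh h0; rewrite -ge0_integralD//; last 4 first.
    by move=> v Dv; exact: laplace_step_ge0.
    by apply: measurable_funTS; rewrite /step; mf.
    by move=> v Dv; exact: laplace_step_ge0.
    by apply: measurable_funTS; rewrite /step; mf.
  apply: eq_integral => v; rewrite inE => Dv.
  have v0 : (0 < v)%R by rewrite itv0yE in Dv.
  rewrite -ge0_muleDr ?lee_fin ?mulr_ge0 ?expR_ge0 ?step_ge0//.
  congr (h v * _); rewrite -EFinD; congr _%:E; rewrite /step exprS.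
  have -> : (- ((p + k) * v) = - (p * v) + - (k * v))%R by ring.
  by rewrite expRD; ring.
have pk0 : (0 < p + k)%R by rewrite ltr_wpDr.
have finB : \int[mu]_(v in D) (g v * (expR (- ((p + k) * v)) * step k n v)%:E) \is a fin_num.
  rewrite ge0_fin_numE; last by apply: integral_ge0 => v Dv; exact: laplace_step_ge0.
  apply: (le_lt_trans (@laplace_moment_le g (p + k) k n mg g0 k0)).
  by rewrite -fg// flty.
have := IH p p0; rewrite !split// IH// => /(congr1 (fun z => z - _)) H.
by have := H (\int[mu]_(v in D) (g v * (expR (- ((p + k) * v)) * step k n v)%:E)); rewrite !addeK.
Qed.

Let expo (A : R) (n : nat) : nat := (Num.truncn (expR (n%:R * A))).+1.

(* With [k = n] and exponent [~ e^(n A)], the weight tends to the indicator of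
   [v > A]. *)
Let step_cvg1 (A v : R) : (A < v)%R -> (0 < v)%R ->
  step n%:R (expo A n) v @[n --> \oo] --> (1 : R)%R.
Proof.
move=> Av v0.
apply: (@squeeze_cvgr _ _ _ _ (fun n => 1 - (expR (- (n%:R * (v - A))) + expR (- (n%:R * v))))%R (fun=> 1%R)).
- apply: nearW => n; apply/andP; split; last exact: step_le1.
  have x1 : (0 <= expR (- (n%:R * v)) <= 1)%R.
    by rewrite expR_ge0/= expR_le1 oppr_le0 mulr_ge0// ltW.
  have bern m (x : R) : (0 <= x <= 1 -> 1 - m%:R * x <= (1 - x) ^+ m)%R.
    move=> /andP[x0 x1']; elim: m => [|m IH]; first by rewrite mul0r subr0 expr0.
    rewrite exprS; apply: (@le_trans _ _ ((1 - x) * (1 - m%:R * x)))%R; last first.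
      by rewrite ler_wpM2l// subr_ge0.
    rewrite -natr1; have : (0 <= m%:R * (x * x))%R by rewrite !mulr_ge0.
    by lra.
  apply: le_trans (bern _ _ x1).
  (* The successor in [expo] costs the additional term [e^(- n v)]. *)
  rewrite lerD2l lerN2 /expo -natr1 mulrDl mul1r lerD2r.
  apply: (@le_trans _ _ (expR (n%:R * A) * expR (- (n%:R * v))))%R.
    by rewrite ler_wpM2r ?expR_ge0// truncn_le expR_ge0.
  by rewrite -expRD ler_expR; lra.
- have e0 (c : R) : (0 < c)%R -> expR (- (n%:R * c)) @[n --> \oo] --> (0 : R)%R.
    move=> c0; have -> : (fun n => expR (- (n%:R * c))) = (fun n => (expR (- c)) ^+ n)%R.
      by apply/funext => n; rewrite -expRM_natl mulrN.
    by apply: cvg_expr; rewrite ger0_norm ?expR_ge0// expR_lt1 oppr_lt0.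
  have e1 := e0 (v - A)%R; rewrite subr_gt0 in e1.
  have e2 := cvgD (e1 Av) (e0 _ v0); rewrite addr0 in e2.
  rewrite -[X in _ --> X]subr0; apply: cvgB; first exact: cvg_cst.
  exact: e2.
- exact: cvg_cst.
Qed.

Let step_cvg0 (A v : R) : (v < A)%R -> (0 < v)%R ->
  step n%:R (expo A n) v @[n --> \oo] --> (0 : R)%R.
Proof.
move=> vA v0.
apply: (@squeeze_cvgr _ _ _ _ (fun=> 0%R) (fun n => expR (- (n%:R * (A - v))))%R).
- apply: nearW => n; apply/andP; split; first exact: step_ge0.
  set q := expR (- (n%:R * v)).
  have q0 : (0 < q)%R by exact: expR_gt0.
  have y0 : (0 < expR (n%:R * (A - v)))%R by exact: expR_gt0.
  (* With [M = expo A n]: [(1 - q)^M <= e^(- M q) <= 1 / (1 + M q)], and [M q] exceeds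
     [e^(n (A - v))]. *)
  have le1 : (step n%:R (expo A n) v <= expR (- q) ^+ expo A n)%R.
    rewrite /step lerXn2r ?nnegrE ?expR_ge0//.
      by rewrite subr_ge0 expR_le1 oppr_le0 mulr_ge0// ltW.
    by have := expR_ge1Dx (- q).
  apply: le_trans le1 _.
  rewrite -expRM_natl mulrN !expRN lef_pV2 ?posrE ?expR_gt0//.
  apply: le_trans (expR_ge1Dx _).
  apply: (@le_trans _ _ ((expo A n)%:R * q))%R; last by rewrite lerDr.
  have -> : (expR (n%:R * (A - v)) = expR (n%:R * A) * q)%R by rewrite -expRD; congr expR; ring.
  by rewrite ler_wpM2r ?(ltW q0)// ltW// truncnS_gt.
- exact: cvg_cst.
- have -> : (fun n => expR (- (n%:R * (A - v)))) = (fun n => (expR (- (A - v))) ^+ n)%R.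
    by apply/funext => n; rewrite -expRM_natl mulrN.
  by apply: cvg_expr; rewrite ger0_norm ?expR_ge0// expR_lt1 oppr_lt0 subr_gt0.
Qed.

Lemma laplace_tail_cvg (f : R -> \bar R) (A : R) : measurable_fun setT f ->
  (forall v, D v -> 0 <= f v) -> laplace f 1 < +oo ->
  \int[mu]_(v in D) (f v * (expR (- (1 * v)) * step n%:R (expo A n) v)%:E) @[n --> \oo]
  --> \int[mu]_(v in D) (f v * (if (A < v)%R then expR (- (1 * v)) else 0%R)%:E).
Proof.
move=> mf f0 flty.
have iF : mu.-integrable D (fun v => f v * (expR (- (1 * v)))%:E).
  apply/integrableP; split; first by apply: measurable_funTS; mf.
  apply: le_lt_trans flty; rewrite le_eqVlt; apply/orP; left; apply/eqP.
  apply: eq_integral => v; rewrite inE => Dv.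
  by rewrite gee0_abs// mule_ge0 ?f0// lee_fin expR_ge0.
have [] // := @dominated_convergence _ _ R mu D _
   (fun n v => f v * (expR (- (1 * v)) * step n%:R (expo A n) v)%:E)
   (fun v => f v * (if (A < v)%R then expR (- (1 * v)) else 0%R)%:E)
   (fun v => f v * (expR (- (1 * v)))%:E).
- by move=> n; apply: measurable_funTS; rewrite /step; mf.
- by apply: measurable_funTS; mf.
(* At [v = A] the weights need tend to neither 0 nor 1; a single point is null. *)
- have aeA : {ae mu, forall v : R, v != A}.
    exists [set A]; split; [exact: measurable_set1|exact: lebesgue_measure_set1|].
    by move=> v /=; move/negP; rewrite negbK => /eqP.
  apply: filterS2 (integrable_ae _ iF) aeA => // v fin vA Dv.
  have v0 : (0 < v)%R by rewrite itv0yE in Dv.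
  have ffin : f v \is a fin_num.
    move: (fin Dv) (f0 v Dv); case: (f v) => [r||] //.
    by rewrite gt0_mulye ?lte_fin ?expR_gt0.
  apply: cvgeZl => //; apply: cvg_EFin; first exact: nearW.
  case: ifPn => Av.
    rewrite -[X in _ --> X]mulr1; apply: cvgM; first exact: cvg_cst.
    exact: step_cvg1.
  rewrite -(mulr0 (expR (- (1 * v)))); apply: cvgM; first exact: cvg_cst.
  by apply: step_cvg0 => //; rewrite lt_neqAle vA leNgt.
- apply: aeW => v n Dv.
  rewrite gee0_abs; last exact: laplace_step_ge0.
  rewrite lee_wpmul2l ?f0// lee_fin ler_piMr ?expR_ge0// step_le1//.
  by rewrite itv0yE in Dv.
Qed.

Lemma laplace_tail (f g : R -> \bar R) :
  measurable_fun setT f -> measurable_fun setT g ->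
  (forall v, D v -> 0 <= f v) -> (forall v, D v -> 0 <= g v) ->
  (forall p, (0 < p)%R -> laplace f p = laplace g p) ->
  (forall p, (0 < p)%R -> laplace f p < +oo) ->
  forall A : R,
  \int[mu]_(v in D) (f v * (if (A < v)%R then expR (- (1 * v)) else 0%R)%:E) =
  \int[mu]_(v in D) (g v * (if (A < v)%R then expR (- (1 * v)) else 0%R)%:E).
Proof.
move=> mf mg f0 g0 fg flty A.
have cf := @laplace_tail_cvg f A mf f0 (flty _ ltr01).
have glty : laplace g 1 < +oo by rewrite -fg// flty.
have cg := @laplace_tail_cvg g A mg g0 glty.
apply: cvg_unique cf _ => //.
rewrite (_ : (fun n => _) = (fun n => \int[mu]_(v in D) (g v * (expR (- (1 * v)) * step n%:R (expo A n) v)%:E))) //.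
by apply/funext => n; exact: laplace_moment.
Qed.

(* The transform determines a function only almost everywhere; the value at [v0]
   comes from the monotonicity of [g] and the continuity of [f] at [v0]. *)
Lemma laplace_pointwise (f g : R -> \bar R) (v0 : R) :
  measurable_fun setT f -> measurable_fun setT g ->
  (forall v, D v -> 0 <= f v) -> (forall v, D v -> 0 <= g v) ->
  (forall p, (0 < p)%R -> laplace f p = laplace g p) ->
  (forall p, (0 < p)%R -> laplace f p < +oo) ->
  (0 < v0)%R -> {homo g : x y / (x <= y)%R >-> x <= y} ->
  (forall k : R, (1 < k)%R -> exists2 e : R, (0 < e)%R &
    forall v, (`|v - v0| < e)%R -> f v <= k%:E * f v0 /\ f v0 <= k%:E * f v) ->
  f v0 = g v0.
Proof.
move=> mf mg f0 g0 fg flty v00 gmono fcont.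
have tail := laplace_tail f g mf mg f0 g0 fg flty.
have split h A B : measurable_fun setT h -> (forall v, D v -> 0 <= h v) -> (0 < A < B)%R ->
  \int[mu]_(v in D) (h v * (if (A < v)%R then expR (- (1 * v)) else 0%R)%:E) =
  \int[mu]_(v in `]A, B]) (h v * (expR (- (1 * v)))%:E) +
  \int[mu]_(v in D) (h v * (if (B < v)%R then expR (- (1 * v)) else 0%R)%:E).
  move=> mh h0 /andP[A0 AB].
  have AD : `]A, B]%classic `<=` D.
    by move=> v; rewrite itv0yE/= in_itv/= => /andP[+ _]; exact: lt_trans.
  have -> : \int[mu]_(v in `]A, B]) (h v * (expR (- (1 * v)))%:E) =
      \int[mu]_(v in D) (h v * (if (A < v <= B)%R then expR (- (1 * v)) else 0%R)%:E).
    rewrite integral_mkcond [RHS]integral_mkcond; apply: eq_integral => v _.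
    rewrite !patchE; case: (boolP (v \in `]A, B]%classic)) => [vAB|vAB].
      have vD : v \in D by rewrite inE; apply: AD; rewrite inE in vAB.
      by rewrite vD; move: vAB; rewrite inE/= in_itv/= => ->.
    case: ifPn => // _; case: ifPn => [H|_]; last by rewrite mule0.
    by move: vAB; rewrite notin_setE/= in_itv/= H.
  have sg (b : R -> bool) v : D v -> 0 <= h v * (if b v then expR (- (1 * v)) else 0%R)%:E.
    by move=> Dv; rewrite mule_ge0 ?h0// lee_fin; case: ifP => _ //; exact: expR_ge0.
  rewrite -ge0_integralD//; last 4 first.
    by move=> v; exact: (sg (fun v => A < v <= B)%R).
    by apply: measurable_funTS; mf.
    by move=> v; exact: (sg (fun v => B < v)%R).
    by apply: measurable_funTS; mf.
  apply: eq_integral => v _; have [Av|vA] := ltP A v => /=.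
    have [Bv|vB] := ltP B v; first by rewrite mule0 add0e.
    by rewrite mule0 adde0.
  by rewrite ltNge (le_trans vA (ltW AB))/= !mule0 adde0.
have tail_lty h A : measurable_fun setT h -> (forall v, D v -> 0 <= h v) ->
    laplace h 1 < +oo ->
    \int[mu]_(v in D) (h v * (if (A < v)%R then expR (- (1 * v)) else 0%R)%:E) \is a fin_num.
  move=> mh h0 hlty.
  have sg v : D v -> 0 <= h v * (if (A < v)%R then expR (- (1 * v)) else 0%R)%:E.
    by move=> Dv; rewrite mule_ge0 ?h0// lee_fin; case: ifP => _ //; exact: expR_ge0.
  rewrite ge0_fin_numE; last exact: integral_ge0.
  apply: le_lt_trans hlty; apply: ge0_le_integral => //.
  - by apply: measurable_funTS; mf.
  - by apply: measurable_funTS; mf.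
  move=> v Dv; rewrite lee_wpmul2l ?h0// lee_fin; case: ifP => // _; exact: expR_ge0.
have eqI A B : (0 < A < B)%R ->
   \int[mu]_(v in `]A, B]) (f v * (expR (- (1 * v)))%:E) =
   \int[mu]_(v in `]A, B]) (g v * (expR (- (1 * v)))%:E).
  move=> AB; have := tail A; rewrite (split f A B)// (split g A B)// tail => H.
  have glty : laplace g 1 < +oo by rewrite -fg// flty.
  have finT := tail_lty g B mg g0 glty.
  by rewrite -[LHS](addeK _ finT) H addeK.
(* The mass of the weight on []A, B]], positive and finite, hence cancellable in inequalities
   between extended reals. *)
pose E A B : \bar R := \int[mu]_(v in `]A, B]) (expR (- (1 * v)))%:E.
have E_gt0 A B : (A < B)%R -> 0 < E A B.
  move=> AB; apply: (@lt_le_trans _ _ (\int[mu]_(v in `]A, B]) (expR (- B))%:E)).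
    rewrite integral_cst//= lebesgue_measure_itv/= lte_fin AB.
    by rewrite -EFinB -EFinM lte_fin mulr_gt0 ?expR_gt0// subr_gt0.
  apply: ge0_le_integral => //.
  - by apply: measurable_funTS; mf.
  by move=> v /=; rewrite in_itv/= => /andP[_ vB]; rewrite lee_fin ler_expR lerN2 mul1r.
have E_lty A B : (0 < A < B)%R -> E A B < +oo.
  move=> /andP[A0 AB]; apply: (@le_lt_trans _ _ (\int[mu]_(v in `]A, B]) 1)).
    apply: ge0_le_integral => //.
      - by apply: measurable_funTS; mf.
    move=> v /=; rewrite in_itv/= => /andP[Av _].
    by rewrite lee_fin expR_le1 mul1r oppr_le0 ltW// (lt_trans A0).
  by rewrite integral_cst//= lebesgue_measure_itv/= lte_fin AB mul1e -EFinB ltry.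
have cstE A B (c : \bar R) : (0 < A < B)%R -> 0 <= c ->
    \int[mu]_(v in `]A, B]) (c * (expR (- (1 * v)))%:E) = c * E A B.
  move=> AB c0; rewrite ge0_integralZl//.
  by apply: measurable_funTS; mf.
have cancelE A B (a b : \bar R) : (0 < A < B)%R -> a * E A B <= b * E A B -> a <= b.
  move=> AB; have /andP[_ AB'] := AB.
  have Ef : E A B \is a fin_num by rewrite ge0_fin_numE ?ltW// ?E_lty// E_gt0.
  have := E_gt0 A B AB'; rewrite -(fineK Ef) lte_fin => ?.
  by rewrite lee_pmul2r// lte_fin.
have onI A B v : (0 < A < B)%R -> `]A, B]%classic v -> D v.
  by move=> /andP[A0 AB]; rewrite itv0yE/= in_itv/= => /andP[+ _]; exact: lt_trans.
have fv0 : 0 <= f v0 by apply: f0; rewrite itv0yE.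
have gv0 : 0 <= g v0 by apply: g0; rewrite itv0yE.
(* Lets [k] decrease to 1. Continuity of [f] is expressed by factors [k > 1], which makes sense for
   infinite values too. *)
have limk (a b : \bar R) : 0 <= a -> 0 <= b ->
    (forall k : R, (1 < k)%R -> a <= k%:E * b) -> a <= b.
  move=> a0 b0 H; have [b00|bn0] := eqVneq b 0.
    by apply: (le_trans (H 2%R _)); rewrite ?ltr1n// b00 mule0.
  move: b0 bn0 H; case: b => [b|_ _ _|//]; last by rewrite leey.
  rewrite lee_fin eqe => b0 bn0 H; have b1 : (0 < b)%R by rewrite lt_neqAle eq_sym bn0.
  apply/lee_addgt0Pr => e e0.
  have := H (1 + e / b)%R; rewrite ltrDl divr_gt0// => /(_ isT) /le_trans; apply.
  by rewrite -EFinM lee_fin mulrDl mul1r divfK.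
apply/eqP; rewrite eq_le; apply/andP; split; apply: limk => // k k1;
  have [e e0 He] := fcont k k1; have k0 : (0 < k)%R by apply: lt_trans k1.
(* [f v0 <= k g v0] is found on an interval to the left of [v0], where [g <= g v0]; the minimum
   keeps [A] positive. *)
- pose A := (v0 - Num.min (e / 2) (v0 / 2))%R.
  have m1 : (Num.min (e / 2) (v0 / 2) <= e / 2)%R by rewrite ge_min lexx.
  have m2 : (Num.min (e / 2) (v0 / 2) <= v0 / 2)%R by rewrite ge_min lexx orbT.
  have m3 : (0 < Num.min (e / 2) (v0 / 2))%R by rewrite lt_min !divr_gt0.
  have AB : (0 < A < v0)%R by rewrite /A; apply/andP; split; lra.
  apply: (cancelE A v0 _ _ AB); rewrite -!cstE ?mule_ge0 ?lee_fin ?(ltW k0)//.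
  apply: (@le_trans _ _ (\int[mu]_(v in `]A, v0]) (k%:E * (f v * (expR (- (1 * v)))%:E)))).
    apply: ge0_le_integral => //.
    - by move=> v _; rewrite mule_ge0// lee_fin expR_ge0.
    - by apply: measurable_funTS; mf.
    - by apply: measurable_funTS; mf.
    move=> v vI; rewrite muleA lee_wpmul2r ?lee_fin ?expR_ge0//.
    move: vI => /=; rewrite in_itv/= /A => /andP[Av vB].
    have vv : (`|v - v0| < e)%R by rewrite ltr_norml; apply/andP; split; lra.
    by have [] := He v vv.
  rewrite ge0_integralZl ?lee_fin ?(ltW k0)//; last 2 first.
    by apply: measurable_funTS; mf.
    by move=> v vI; rewrite mule_ge0 ?lee_fin ?expR_ge0// f0//; exact: onI vI.
  rewrite eqI// -ge0_integralZl ?lee_fin ?(ltW k0)//; last 2 first.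
    by apply: measurable_funTS; mf.
    by move=> v vI; rewrite mule_ge0 ?lee_fin ?expR_ge0// g0//; exact: onI vI.
  apply: ge0_le_integral => //.
  - by move=> v vI; rewrite !mule_ge0 ?lee_fin ?expR_ge0 ?(ltW k0)// g0//; exact: onI vI.
  - by apply: measurable_funTS; mf.
  - by apply: measurable_funTS; mf.
  move=> v vI; rewrite muleA lee_wpmul2r ?lee_fin ?expR_ge0// lee_wpmul2l ?lee_fin ?(ltW k0)//.
  by apply: gmono; move: vI => /=; rewrite in_itv/= => /andP[].
(* The opposite bound uses an interval to the right, where [g v0 <= g]. *)
- pose B := (v0 + e / 2)%R.
  have AB : (0 < v0 < B)%R by rewrite v00 /B ltrDl divr_gt0.
  apply: (cancelE v0 B _ _ AB); rewrite -!cstE ?mule_ge0 ?lee_fin ?(ltW k0)//.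
  apply: (@le_trans _ _ (\int[mu]_(v in `]v0, B]) (g v * (expR (- (1 * v)))%:E))).
    apply: ge0_le_integral => //.
    - by move=> v _; rewrite mule_ge0// lee_fin expR_ge0.
    - by apply: measurable_funTS; mf.
    - by apply: measurable_funTS; mf.
    move=> v vI; rewrite lee_wpmul2r ?lee_fin ?expR_ge0//.
    by apply: gmono; move: vI => /=; rewrite in_itv/= => /andP[/ltW].
  rewrite -eqI//; apply: ge0_le_integral => //.
  - by move=> v vI; rewrite !mule_ge0 ?lee_fin ?expR_ge0// f0//; exact: onI vI.
  - by apply: measurable_funTS; mf.
  - by apply: measurable_funTS; mf.
  move=> v vI; rewrite lee_wpmul2r ?lee_fin ?expR_ge0//.
  move: vI => /=; rewrite in_itv/= /B => /andP[Av vB].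
  have vv : (`|v - v0| < e)%R by rewrite ltr_norml; apply/andP; split; lra.
  by have [] := He v vv.
Qed.

End laplace.

(** * The Riesz potential of the ball in high dimension *)

Section riesz_ball.
Local Open Scope ereal_scope.
Context {R : realType}.
Local Notation mu := (@lebesgue_measure R).
Local Notation D := (`]0%R, +oo[%classic : set R).

Lemma ge0_integral_pos_shift (c : R) (h : R -> \bar R) : (0 <= c)%R ->
  measurable_fun setT h -> (forall x, (0 < x)%R -> 0 <= h x) ->
  \int[mu]_(v in D) (if (c < v)%R then h (v - c)%R else 0) = \int[mu]_(v in D) h v.
Proof.
move=> c0 mh h0.
have mif : measurable_fun setT (fun v => if (c < v)%R then h (v - c)%R else 0).
  by apply: mf_ife => //; mf.
rewrite integral_mkcond (@ge0_integral_affine _ 1 c)//; last 2 first.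
  by apply/(measurable_restrictT _ _).1 => //; exact: measurable_funTS.
  move=> x; apply: erestrict_ge0 => {}x _; case: ifP => // cx.
  by apply: h0; rewrite subr_gt0.
rewrite mul1e [RHS]integral_mkcond; apply: eq_integral => x _.
rewrite mul1r !patchE !in_itv0y ltrDr addrK.
have [x0|x0] := ltP 0%R x; first by rewrite ltr_wpDr.
by case: ifP.
Qed.

Variables (n : nat) (s : R).
Hypotheses (s0 : (0 < s)%R) (s1 : (s < 1)%R) (ns : (2 * s < n%:R)%R).

Let a : R := (n%:R / 2 - s)%R.
Let a_gt0 : (0 < a)%R.
Proof. by rewrite subr_gt0 ltr_pdivlMr// mulrC. Qed.

(* Gaussian subordination of [|w - y|^(2 s - n)], to which it is equal for
   [y <> w]. *)
Definition riesz_kernel (w y : 'rV[R]_n) : \bar R :=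
  (Gamma a)^-1%:E *
  \int[mu]_(t in D) (t `^ (a - 1) * expR (- (t * enorm (w - y) ^+ 2)))%:E.

Lemma riesz_kernel_ge0 w y : 0 <= riesz_kernel w y.
Proof.
rewrite mule_ge0 ?lee_fin ?invr_ge0 ?(ltW (Gamma_gt0 _ a_gt0))//.
by apply: integral_ge0 => t _; nneg.
Qed.

Lemma measurable_riesz_kernel w : measurable_fun setT (riesz_kernel w).
Proof.
apply: mfMe; first exact: measurable_cst.
apply: (@measurable_integral_in _ _ _ _ R mu) => //; last by move=> *; nneg.
by apply: measurable_funTS; mf.
Qed.

Lemma riesz_kernelE w y : y != w -> riesz_kernel w y = (enorm (w - y) `^ (2 * s - n%:R))%:E.
Proof.
move=> yw; have e0 : (0 < enorm (w - y))%R by rewrite enorm_gt0 subr_eq0 eq_sym.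
rewrite /riesz_kernel; under eq_integral do rewrite [X in expR (- X)]mulrC.
rewrite eGamma_scale ?exprn_gt0// -GammaE// -!EFinM; congr _%:E.
rewrite mulrCA mulVf ?gt_eqF ?Gamma_gt0// mulr1 -powR_mulrn ?(ltW e0)// -powRrM.
by congr (_ `^ _)%R; rewrite /a; field.
Qed.

(** The squared radius [v] is the variable, because the density depends on [v - |y|^2] only and its
    Laplace transform in [v] splits off [e^(- p |y|^2)]. *)
Definition riesz_pot (w : 'rV[R]_n) (v : R) : \bar R :=
  \int[@lebesgue_rV R n]_y
    ((if (enorm y ^+ 2 < v)%R then (v - enorm y ^+ 2) `^ (- s) else 0%R)%:E *
     riesz_kernel w y).

Definition riesz_const : R := (pi `^ (n%:R / 2) * Gamma (1 - s) / Gamma a)%R.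

(** For [W = |w|^2] and [v = r^2] the condition says [t > r_0]. In this form the tail is monotone in
    [v], which the pointwise uniqueness uses. *)
Definition beta_tail (W v : R) : \bar R :=
  riesz_const%:E * \int[mu]_(t in D)
    (if (W < v * (1 + t))%R then t `^ (s - 1) / (1 + t) `^ (n%:R / 2) else 0%R)%:E.

Let riesz_const_gt0 : (0 < riesz_const)%R.
Proof.
by rewrite /riesz_const divr_gt0 ?mulr_gt0 ?powR_gt0 ?pi_gt0 ?Gamma_gt0// subr_gt0.
Qed.

(** The value that both Laplace transforms take, with [W = |w|^2]. *)
Let common (W p : R) : \bar R := (riesz_const / p)%:E *
  \int[mu]_(t in D) (t `^ (s - 1) / (1 + t) `^ (n%:R / 2) * expR (- (p * W / (1 + t))))%:E.

Let ite_ge0 (b : bool) (x : R) : (0 <= x)%R -> (0 <= if b then x else 0)%R.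
Proof. by case: b. Qed.

Let measurable_shell w : measurable_fun setT (fun z : R * 'rV[R]_n =>
  (if (enorm z.2 ^+ 2 < z.1)%R then (z.1 - enorm z.2 ^+ 2) `^ (- s) else 0%R)%:E *
     riesz_kernel w z.2).
Proof.
by move: (riesz_kernel w) (measurable_riesz_kernel w) => K mK; mf.
Qed.

Lemma riesz_pot_ge0 w v : 0 <= riesz_pot w v.
Proof.
apply: integral_ge0 => y _; rewrite mule_ge0 ?riesz_kernel_ge0// lee_fin.
by apply: ite_ge0; exact: powR_ge0.
Qed.

Lemma measurable_riesz_pot w : measurable_fun setT (riesz_pot w).
Proof.
have := @measurable_integral_in _ _ _ _ R (@lebesgue_rV R n) setT setT
  (fun v y => (if (enorm y ^+ 2 < v)%R then (v - enorm y ^+ 2) `^ (- s) else 0%R)%:E *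
     riesz_kernel w y) measurableT measurableT.
apply.
- by rewrite setXTT; exact: measurable_shell.
- move=> v y _ _; rewrite mule_ge0 ?riesz_kernel_ge0// lee_fin.
  by apply: ite_ge0; exact: powR_ge0.
Qed.

Lemma beta_tail_ge0 W v : 0 <= beta_tail W v.
Proof.
rewrite mule_ge0 ?lee_fin ?(ltW riesz_const_gt0)//; apply: integral_ge0 => t _.
by rewrite lee_fin; apply: ite_ge0; nneg.
Qed.

Lemma measurable_beta_tail W : measurable_fun setT (beta_tail W).
Proof.
apply: mfMe; first exact: measurable_cst.
apply: (@measurable_integral_in _ _ _ _ R mu) => //.
  by apply: measurable_funTS; mf.
by move=> v t _ _; rewrite lee_fin; apply: ite_ge0; nneg.
Qed.

(** For fixed [t] the indicator of [v > W / (1 + t)] has the transform [e^(- p W / (1 + t)) / p]. *)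
Lemma laplace_beta_tail W p : (0 <= W)%R -> (0 < p)%R ->
  laplace (beta_tail W) p = common W p.
Proof.
move=> W0 p0; rewrite /laplace /beta_tail.
pose b v t : R := (if (W < v * (1 + t))%R then t `^ (s - 1) / (1 + t) `^ (n%:R / 2) else 0)%R.
have b0 v t : (0 <= b v t)%R by rewrite /b; apply: ite_ge0; nneg.
transitivity (\int[mu]_(v in D) (riesz_const%:E *
    \int[mu]_(t in D) (b v t * expR (- (p * v)))%:E)).
  apply: eq_integral => v _; rewrite -muleA; congr *%E.
  rewrite -ge0_integralZr ?lee_fin ?expR_ge0//.
  - by apply: measurable_funTS; rewrite /b; mf.
  - by move=> t _; rewrite lee_fin; exact: b0.
rewrite ge0_integralZl ?lee_fin ?(ltW riesz_const_gt0)//; last 2 first.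
  apply: (@measurable_integral_in _ _ _ _ R mu) => //.
    by apply: measurable_funTS; rewrite /b; mf.
  by move=> *; nneg.
  by move=> v _; apply: integral_ge0 => t _; nneg.
rewrite tonelli_mu//; last 2 first.
  by apply: measurable_funTS; rewrite /b; mf.
  by move=> *; nneg.
rewrite /common (_ : (riesz_const / p)%:E = riesz_const%:E * p^-1%:E)// -muleA; congr *%E.
rewrite -ge0_integralZl ?lee_fin ?invr_ge0 ?(ltW p0)//; last 2 first.
  by apply: measurable_funTS; mf.
  by move=> *; nneg.
apply: eq_integral => t; rewrite in_itv0y => t0.
have t1 : (0 < 1 + t)%R by rewrite addr_gt0.
set c := (W / (1 + t))%R.
have c0 : (0 <= c)%R by rewrite divr_ge0 ?(ltW t1).
set g := (t `^ (s - 1) / (1 + t) `^ (n%:R / 2))%R.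
have g0 : (0 <= g)%R by rewrite /g; nneg.
transitivity (\int[mu]_(v in D) (if (c < v)%R then (g * expR (- (p * (v - c + c))))%:E else 0)).
  apply: eq_integral => v _; rewrite /b /c ltr_pdivrMr// -/g subrK.
  by case: ifP => //; rewrite mul0r.
rewrite (@ge0_integral_pos_shift c (fun v => (g * expR (- (p * (v + c))))%:E))//; last 2 first.
  by mf.
  by move=> *; nneg.
transitivity (\int[mu]_(v in D) ((p^-1 * (g * expR (- (p * c))))%:E * (p * expR (- (p * v)))%:E)).
  apply: eq_integral => v _; rewrite -EFinM; congr _%:E.
  rewrite mulrDr opprD expRD; field.
  by rewrite gt_eqF.
rewrite ge0_integralZl ?lee_fin//; last 3 first.
  by apply: measurable_funTS; mf.
  by move=> v _; rewrite lee_fin mulr_ge0 ?expR_ge0 ?ltW.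
  by rewrite mulr_ge0 ?invr_ge0 ?(ltW p0)// mulr_ge0 ?expR_ge0.
by rewrite integral_exp_pos// mule1 EFinM /c mulrA.
Qed.

(** The density transforms into [Gamma (1 - s) p^(s - 1) e^(- p |y|^2)]. Against the Gaussians of
    the kernel the [y]-integral is explicit, and only the subordination variable [t] remains. *)
Lemma laplace_riesz_pot w p : (0 < p)%R ->
  laplace (riesz_pot w) p = common (enorm w ^+ 2) p.
Proof.
move=> p0; have mK := measurable_riesz_kernel w.
have K0 := riesz_kernel_ge0 w.
rewrite /laplace /riesz_pot.
have [K KE] : exists K, K = riesz_kernel w by exists (riesz_kernel w).
rewrite -KE in mK K0 *.
pose b (v : R) (y : 'rV[R]_n) : R := (if (enorm y ^+ 2 < v)%R then (v - enorm y ^+ 2) `^ (- s) else 0)%R.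
have b0 v (y : 'rV[R]_n) : (0 <= b v y)%R by rewrite /b; apply: ite_ge0; nneg.
transitivity (\int[mu]_(v in D) \int[@lebesgue_rV R n]_y
    ((b v y * expR (- (p * v)))%:E * K y)).
  apply: eq_integral => v _; rewrite -ge0_integralZr ?lee_fin ?expR_ge0//.
  - by apply: eq_integral => y _; rewrite muleAC -EFinM.
  - by mf.
  - by move=> y _; rewrite mule_ge0// lee_fin b0.
rewrite -(@tonelli_rV _ n D (fun y v => (b v y * expR (- (p * v)))%:E * K y))//; last 2 first.
  by rewrite /b; mf.
  by move=> y v _; rewrite mule_ge0// lee_fin mulr_ge0 ?expR_ge0.
transitivity (\int[@lebesgue_rV R n]_y
   ((p `^ (s - 1) * Gamma (1 - s))%:E * ((expR (- (p * enorm y ^+ 2)))%:E * K y))).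
  apply: eq_integral => y _; rewrite ge0_integralZr//; last 2 first.
    by apply: measurable_funTS; rewrite /b; mf.
    by move=> v _; rewrite lee_fin mulr_ge0 ?expR_ge0.
  rewrite muleA -EFinM; congr *%E.
  transitivity (\int[mu]_(v in D) (if (enorm y ^+ 2 < v)%R then
     ((v - enorm y ^+ 2) `^ (- s) * expR (- (p * (v - enorm y ^+ 2 + enorm y ^+ 2))))%:E else 0)).
    apply: eq_integral => v _; rewrite /b subrK.
    by case: ifP => //; rewrite mul0r.
  rewrite (@ge0_integral_pos_shift _ (fun v => (v `^ (- s) * expR (- (p * (v + enorm y ^+ 2))))%:E)) ?sqr_ge0//; last 2 first.
    by mf.
    by move=> *; nneg.
  transitivity (\int[mu]_(v in D) ((expR (- (p * enorm y ^+ 2)))%:E *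
      (v `^ (1 - s - 1) * expR (- (p * v)))%:E)).
    apply: eq_integral => v _; rewrite -EFinM; congr _%:E.
    rewrite mulrDr opprD expRD (_ : 1 - s - 1 = - s)%R; last by ring.
    by ring.
  rewrite ge0_integralZl ?lee_fin ?expR_ge0//; last 2 first.
    by apply: measurable_funTS; mf.
    by move=> *; nneg.
  rewrite eGamma_scale// -GammaE ?subr_gt0// -!EFinM opprB; congr _%:E.
  by ring.
have c0 : (0 <= p `^ (s - 1) * Gamma (1 - s))%R.
  by rewrite mulr_ge0 ?powR_ge0 ?ltW ?Gamma_gt0 ?subr_gt0.
rewrite ge0_integralZl//; last 2 first.
  by mf.
  by move=> y _; rewrite mule_ge0// lee_fin expR_ge0.
have gv0 : (0 <= (Gamma a)^-1)%R by rewrite invr_ge0 ltW ?Gamma_gt0.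
transitivity ((p `^ (s - 1) * Gamma (1 - s))%:E * ((Gamma a)^-1%:E *
   \int[@lebesgue_rV R n]_y \int[mu]_(t in D)
    (t `^ (a - 1) * (expR (- (p * enorm y ^+ 2)) * expR (- (t * enorm (w - y) ^+ 2))))%:E)).
  congr *%E; rewrite -ge0_integralZl//; last 2 first.
    apply: (@measurable_integral_in _ _ _ _ R mu) => //.
      by apply: measurable_funTS; mf.
    by move=> *; nneg.
    by move=> y _; apply: integral_ge0 => *; nneg.
  apply: eq_integral => y _; rewrite KE /riesz_kernel muleCA; congr *%E.
  rewrite -ge0_integralZl ?lee_fin ?expR_ge0//; last 2 first.
    by apply: measurable_funTS; mf.
    by move=> *; nneg.
  by apply: eq_integral => t _; rewrite -EFinM mulrCA.
rewrite (@tonelli_rV _ n D (fun y t => (t `^ (a - 1) * (expR (- (p * enorm y ^+ 2)) * expR (- (t * enorm (w - y) ^+ 2))))%:E))//; last 2 first.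
  by mf.
  by move=> *; nneg.
transitivity ((p `^ (s - 1) * Gamma (1 - s))%:E * ((Gamma a)^-1%:E *
   \int[mu]_(t in D) (t `^ (a - 1) * ((pi / (p + t)) `^ (n%:R / 2) *
      expR (- (p * t / (p + t) * enorm w ^+ 2))))%:E)).
  congr (_ * (_ * _)); apply: eq_integral => t; rewrite in_itv0y => t0.
  under eq_integral do rewrite EFinM.
  rewrite ge0_integralZl ?lee_fin ?powR_ge0//; try msr; try nneg.
  by rewrite EFinM; congr *%E; exact: integral_rV_gauss2.
(* [t -> p / t] turns [p t / (p + t)] into [p / (1 + t)], the exponent of [common]. *)
rewrite (@ge0_integral_pos_inv _ p)//; last 2 first.
  by mf.
  by move=> *; nneg.
transitivity ((p `^ (s - 1) * Gamma (1 - s))%:E * ((Gamma a)^-1%:E *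
   \int[mu]_(t in D) ((pi `^ (n%:R / 2) * p `^ (- s))%:E *
    (t `^ (s - 1) / (1 + t) `^ (n%:R / 2) * expR (- (p * enorm w ^+ 2 / (1 + t))))%:E))).
  congr (_ * (_ * _)); apply: eq_integral => t; rewrite in_itv0y => t0.
  have t1 : (0 < 1 + t)%R by rewrite addr_gt0.
  rewrite -!EFinM; congr _%:E.
  have pt : (p + p / t = p * (1 + t) / t)%R by field; rewrite gt_eqF.
  have -> : (p * (p / t) / (p + p / t) * enorm w ^+ 2 = p * enorm w ^+ 2 / (1 + t))%R.
    by rewrite pt; field; rewrite ?(gt_eqF p0) ?(gt_eqF t0) ?(gt_eqF t1).
  have -> : (pi / (p + p / t) = pi * (p^-1 * (t * (1 + t)^-1)))%R.
    by rewrite pt; field; rewrite ?(gt_eqF p0) ?(gt_eqF t0) ?(gt_eqF t1).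
  have inv_powR (x y : R) : (0 < x)%R -> (x^-1 `^ y = x `^ (- y))%R.
    by move=> x0; rewrite -(powR_inv1 (ltW x0)) -powRrM mulN1r.
  have -> (y : R) : ((pi * (p^-1 * (t * (1 + t)^-1))) `^ y =
      pi `^ y * (p `^ (- y) * (t `^ y * (1 + t) `^ (- y))))%R.
    have it0 : (0 <= (1 + t)^-1)%R by rewrite invr_ge0 ltW.
    have ip0 : (0 <= p^-1)%R by rewrite invr_ge0 ltW.
    by rewrite !powRM ?pi_ge0 ?mulr_ge0 ?(ltW t0)// !inv_powR.
  have -> (y : R) : ((p / t) `^ y = p `^ y * t `^ (- y))%R.
    by rewrite powRM ?invr_ge0 ?(ltW p0) ?(ltW t0)// inv_powR.
  have P x : (p `^ x != 0)%R by rewrite gt_eqF// powR_gt0.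
  have e1 : (p `^ (a - 1) * p `^ (- (n%:R / 2)) * p = p `^ (- s))%R.
    rewrite -{3}[p]powRr1 ?(ltW p0)// -!powRD ?(gt_eqF p0) ?implybT//.
    by congr (_ `^ _)%R; rewrite /a; field.
  have e2 : (t `^ (- (a - 1)) * t `^ (n%:R / 2) / t ^+ 2 = t `^ (s - 1))%R.
    rewrite -(powR_invn _ (ltW t0)) -!powRD ?(gt_eqF t0) ?implybT//.
    by congr (_ `^ _)%R; rewrite /a; field.
  by rewrite -e1 -e2 (powRN (1 + t)); ring.
rewrite ge0_integralZl ?lee_fin ?mulr_ge0 ?powR_ge0//; last 2 first.
  by apply: measurable_funTS; mf.
  by move=> *; nneg.
rewrite /common !muleA -!EFinM; congr (_%:E * _).
have e3 : (p `^ (s - 1) * p `^ (- s) = p^-1)%R.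
  rewrite -powRD ?(gt_eqF p0) ?implybT// -(powR_inv1 (ltW p0)); congr (_ `^ _)%R.
  by ring.
by rewrite -e3 /riesz_const; ring.
Qed.

Lemma common_lty W p : (0 <= W)%R -> (0 < p)%R -> common W p < +oo.
Proof.
move=> W0 p0.
apply: (@le_lt_trans _ _ ((riesz_const / p)%:E *
  \int[mu]_(t in D) (t `^ (s - 1) / (1 + t) `^ (a + s))%:E)).
  apply: lee_wpmul2l.
    by rewrite lee_fin divr_ge0 ?(ltW riesz_const_gt0) ?(ltW p0).
  apply: ge0_le_integral => //.
  - by move=> *; nneg.
  - by apply: measurable_funTS; mf.
  - by apply: measurable_funTS; mf.
  move=> t; rewrite itv0yE => t0; rewrite lee_fin /a subrK ler_piMr//; first by nneg.
  by rewrite expR_le1 oppr_le0 divr_ge0 ?mulr_ge0 ?addr_ge0 ?(ltW p0) ?(ltW t0).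
by rewrite integral_beta// -EFinM ltry.
Qed.

Lemma beta_tail_mono W : {homo beta_tail W : x y / (x <= y)%R >-> x <= y}.
Proof.
move=> x y xy; apply: lee_wpmul2l; first by rewrite lee_fin ltW.
apply: ge0_le_integral => //.
- by move=> t _; rewrite lee_fin; apply: ite_ge0; nneg.
- by apply: measurable_funTS; mf.
- by apply: measurable_funTS; mf.
move=> t; rewrite itv0yE => t0; rewrite lee_fin.
case: ifPn => Wx; last by apply: ite_ge0; nneg.
rewrite ifT// (lt_le_trans Wx)// ler_wpM2r//.
by rewrite addr_ge0// ltW.
Qed.

(** The potential rescaled to the unit ball: the radius enters only through [l = 1 / r], in a kernel
    that has no singularity as long as [l |w| > 1]. *)
Let riesz_unit (w : 'rV[R]_n) (l : R) : \bar R :=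
  \int[@lebesgue_rV R n]_u (if (enorm u < 1)%R then
     (1 - enorm u ^+ 2) `^ (- s) * enorm (l *: w - u) `^ (2 * s - n%:R) else 0%R)%:E.

Let riesz_unit_ge0 w l : 0 <= riesz_unit w l.
Proof. by apply: integral_ge0 => u _; rewrite lee_fin; apply: ite_ge0; nneg. Qed.

Let measurable_unit w l : measurable_fun setT (fun u : 'rV[R]_n =>
  (if (enorm u < 1)%R then
     (1 - enorm u ^+ 2) `^ (- s) * enorm (l *: w - u) `^ (2 * s - n%:R) else 0%R)%:E).
Proof. by mf. Qed.

Let sqr_lt (x y : R) : (0 <= x)%R -> (0 <= y)%R -> (x ^+ 2 < y ^+ 2)%R = (x < y)%R.
Proof. by move=> x0 y0; rewrite ltr_pXn2r. Qed.

Lemma riesz_potE (w : 'rV[R]_n) (r : R) : (0 < r)%R -> (r < enorm w)%R ->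
  riesz_pot w (r ^+ 2) =
  \int[@lebesgue_rV R n]_y (if (enorm y < r)%R then
     (r ^+ 2 - enorm y ^+ 2) `^ (- s) * enorm (w - y) `^ (2 * s - n%:R) else 0%R)%:E.
Proof.
move=> r0 rw; rewrite /riesz_pot; apply: eq_integral => y _.
rewrite sqr_lt ?enorm_ge0 ?(ltW r0)//; case: ifPn => yr; last by rewrite mul0e.
rewrite riesz_kernelE ?EFinM//; apply: contraTneq yr => ->.
by rewrite -leNgt ltW.
Qed.

(** Volume, density and kernel scale with the exponents [n], [- 2 s] and [2 s - n], whose sum is
    0. *)
Let riesz_pot_unit (w : 'rV[R]_n) (r : R) : (0 < r)%R -> (r < enorm w)%R ->
  riesz_pot w (r ^+ 2) = riesz_unit w r^-1.
Proof.
move=> r0 rw; rewrite (riesz_potE _ _ r0 rw).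
rewrite (@ge0_integral_rV_affine _ n r 0%R)//; last 2 first.
  by mf.
  by move=> u; rewrite lee_fin; apply: ite_ge0; nneg.
rewrite -ge0_integralZl//; last 3 first.
  by mf.
  by move=> u _; rewrite lee_fin; apply: ite_ge0; nneg.
  by rewrite lee_fin exprn_ge0// ltW.
apply: eq_integral => u _; rewrite addr0 -EFinM; congr _%:E.
rewrite enormZ (gtr0_norm r0) (gtr_pMr _ r0).
have [u1|u1] := ltP (enorm u) 1%R; last first.
  by rewrite mulr0.
have u0 := enorm_ge0 u.
have -> : (r ^+ 2 - (r * enorm u) ^+ 2 = r ^+ 2 * (1 - enorm u ^+ 2))%R by ring.
have -> : (w - r *: u = r *: (r^-1 *: w - u))%R.
  by rewrite scalerBr scalerA divff ?gt_eqF// scale1r.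
rewrite enormZ (gtr0_norm r0).
have h1 : (0 <= 1 - enorm u ^+ 2)%R by rewrite subr_ge0 expr_le1// ltW.
rewrite (powRM _ (sqr_ge0 r) h1) (powRM _ (ltW r0) (enorm_ge0 _)).
rewrite -!(powR_mulrn _ (ltW r0)) -!powRrM.
have e : (r `^ n%:R * r `^ (2%:R * - s) * r `^ (2 * s - n%:R) = 1)%R.
  rewrite -!powRD ?(gt_eqF r0) ?implybT//.
  by rewrite (_ : _ + _ = 0)%R ?powRr0//; ring.
transitivity (r `^ n%:R * r `^ (2%:R * - s) * r `^ (2 * s - n%:R) *
  ((1 - enorm u ^+ 2) `^ (- s) * enorm (r^-1 *: w - u) `^ (2 * s - n%:R)))%R.
  by ring.
by rewrite e mul1r.
Qed.

(** A Harnack-type comparison. If [l w] moves by at most [q - 1] times its distance [l |w| - 1] to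
    the unit ball, every distance [|l w - u|] grows at most by the factor [q], and the kernel
    [|.|^(- 2 a)] loses at most [q^(2 a) = k]. *)
Let riesz_unit_le (w : 'rV[R]_n) (l l' k : R) : (1 < k)%R ->
  (1 < l * enorm w)%R -> (0 < l)%R -> (1 < l' * enorm w)%R -> (0 < l')%R ->
  (`|l' - l| * enorm w <= (k `^ (2 * a)^-1 - 1) * (l * enorm w - 1))%R ->
  riesz_unit w l <= k%:E * riesz_unit w l'.
Proof.
move=> k1 lw l0 lw' l0' H; have k0 : (0 < k)%R by apply: lt_trans k1.
set q := (k `^ (2 * a)^-1)%R in H.
have a2 : (0 < 2 * a)%R by rewrite mulr_gt0.
have q1 : (1 < q)%R.
  apply: (@le_lt_trans _ _ (1 `^ (2 * a)^-1)%R); first by rewrite powR1.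
  by rewrite gt0_ltr_powR ?invr_gt0 ?nnegrE// ltW.
have qk : (q `^ (2 * a) = k)%R.
  by rewrite /q -powRrM mulVf ?gt_eqF// powRr1// ltW.
rewrite -ge0_integralZl ?lee_fin ?(ltW k0)//; last first.
  by move=> u _; rewrite lee_fin; apply: ite_ge0; nneg.
apply: ge0_le_integral => //.
- by move=> u _; rewrite lee_fin; apply: ite_ge0; nneg.
- by mf.
move=> u _; rewrite -EFinM lee_fin.
have [u1|u1] := ltP (enorm u) 1%R; last by rewrite mulr0.
rewrite mulrCA ler_wpM2l ?powR_ge0//.
have tri (t : R) : (1 < t * enorm w -> 0 < t -> t * enorm w - 1 <= enorm (t *: w - u))%R.
  move=> tw t0; have := enormD (t *: w - u) u; rewrite subrK enormZ gtr0_norm//.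
  by lra.
have d0 := tri l lw l0; have d0' := tri l' lw' l0'.
have dl : (0 < enorm (l *: w - u))%R by lra.
have dl' : (0 < enorm (l' *: w - u))%R by lra.
have dd : (enorm (l' *: w - u) <= q * enorm (l *: w - u))%R.
  have -> : (l' *: w - u = (l *: w - u) + (l' - l) *: w)%R.
    by rewrite scalerBl; apply/rowP => i; rewrite !mxE; ring.
  apply: le_trans (enormD _ _) _; rewrite enormZ.
  have : ((q - 1) * (l * enorm w - 1) <= (q - 1) * enorm (l *: w - u))%R.
    by rewrite ler_wpM2l// subr_ge0 ltW.
  by lra.
have -> : (2 * s - n%:R = - (2 * a))%R by rewrite /a; field.
rewrite !powRN -qk ler_pdivlMr ?powR_gt0// mulrC ler_pdivrMr ?powR_gt0//.
have q0 : (0 <= q)%R by apply: ltW; apply: lt_trans q1.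
have dl0 := ltW dl.
rewrite -powRM//; apply: (ge0_ler_powR (ltW a2)) => //.
  by rewrite nnegrE (ltW dl').
by rewrite nnegrE mulr_ge0.
Qed.

Lemma riesz_pot_beta_tail (w : 'rV[R]_n) (r : R) : (0 < r)%R -> (r < enorm w)%R ->
  riesz_pot w (r ^+ 2) = beta_tail (enorm w ^+ 2) (r ^+ 2).
Proof.
move=> r0 rw; have w0 : (0 < enorm w)%R by exact: lt_trans rw.
apply: laplace_pointwise.
- exact: measurable_riesz_pot.
- exact: measurable_beta_tail.
- by move=> v _; exact: riesz_pot_ge0.
- by move=> v _; exact: beta_tail_ge0.
- by move=> p p0; rewrite laplace_riesz_pot// laplace_beta_tail// sqr_ge0.
- by move=> p p0; rewrite laplace_riesz_pot// common_lty// sqr_ge0.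
- by rewrite exprn_gt0.
- exact: beta_tail_mono.
move=> k k1; set q := (k `^ (2 * a)^-1)%R.
have a2 : (0 < 2 * a)%R by rewrite mulr_gt0.
have q1 : (1 < q)%R.
  apply: (@le_lt_trans _ _ (1 `^ (2 * a)^-1)%R); first by rewrite powR1.
  by rewrite gt0_ltr_powR ?invr_gt0 ?nnegrE// ltW// (lt_trans ltr01).
pose phi (v : R) : R := (Num.sqrt v)^-1%R.
have cphi : {for (r ^+ 2)%R, continuous phi}.
  apply: (@continuousV R R (@Num.sqrt R)); last exact: sqrt_continuous.
  by rewrite gt_eqF// sqrtr_gt0 exprn_gt0.
have phir : (phi (r ^+ 2) = r^-1)%R by rewrite /phi sqrtr_sqr gtr0_norm.
have lw : (1 < r^-1 * enorm w)%R by rewrite mulrC ltr_pdivlMr// mul1r.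
have cd : {for (r ^+ 2)%R, continuous (fun v : R => `|phi v - phi (r ^+ 2)%R| * enorm w : R)%R}.
  apply: cvgM; last exact: cvg_cst.
  by apply: cvg_norm; apply: cvgB; [exact: cphi|exact: cvg_cst].
have c1 : {for (r ^+ 2)%R, continuous (fun v : R => (q - 1) * (phi (r ^+ 2)%R * enorm w - 1) -
    `|phi v - phi (r ^+ 2)%R| * enorm w : R)%R}.
  by apply: cvgB; [exact: cvg_cst|exact: cd].
have c2 : {for (r ^+ 2)%R, continuous (fun v : R => (q - 1) * (phi v * enorm w - 1) -
    `|phi v - phi (r ^+ 2)%R| * enorm w : R)%R}.
  apply: cvgB; last exact: cd.
  apply: cvgM; first exact: cvg_cst.
  by apply: cvgB; [apply: cvgM; [exact: cphi|exact: cvg_cst]|exact: cvg_cst].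
have pos0 : (0 < (q - 1) * (r^-1 * enorm w - 1))%R by rewrite mulr_gt0// subr_gt0.
(* Two bounds on the displacement, one relative to each of the two points, since the comparison is
   needed in both directions. *)
have near_v : \forall v \near (r ^+ 2)%R, [/\ (0 < v)%R, (v < enorm w ^+ 2)%R,
    (0 < (q - 1) * (phi (r ^+ 2)%R * enorm w - 1) - `|phi v - phi (r ^+ 2)%R| * enorm w)%R &
    (0 < (q - 1) * (phi v * enorm w - 1) - `|phi v - phi (r ^+ 2)%R| * enorm w)%R].
  near=> v; split.
  - by near: v; apply: lt_nbhsr; rewrite exprn_gt0.
  - by near: v; apply: lt_nbhsl; rewrite sqr_lt// ltW.
  - near: v; apply: (cvgr_gt _ c1); rewrite /= subrr normr0 mul0r subr0 phir//.
  - near: v; apply: (cvgr_gt _ c2); rewrite /= subrr normr0 mul0r subr0 phir//.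
have [e e0 He] := (@nbhs_ballP R R (r ^+ 2)%R _).1 near_v.
exists e => // v vr; have /He[v0 vw h1 h2] : ball (r ^+ 2)%R e v by rewrite /ball/= distrC.
have sv0 : (0 < Num.sqrt v)%R by rewrite sqrtr_gt0.
have svE : (Num.sqrt v ^+ 2 = v)%R by rewrite sqr_sqrtr// ltW.
have svw : (Num.sqrt v < enorm w)%R by rewrite -sqr_lt ?sqrtr_ge0 ?(ltW w0)// svE.
have lwv : (1 < (Num.sqrt v)^-1 * enorm w)%R by rewrite mulrC ltr_pdivlMr// mul1r.
rewrite -[in riesz_pot w v]svE !riesz_pot_unit//; split.
- apply: riesz_unit_le; rewrite ?invr_gt0//.
  rewrite -/q; move: h2; rewrite subr_gt0 phir /phi distrC => /ltW.
  exact.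
- apply: riesz_unit_le; rewrite ?invr_gt0//.
  by rewrite -/q; move: h1; rewrite subr_gt0 phir /phi => /ltW.
Unshelve. all: by end_near. Qed.

End riesz_ball.

(** * Potentials of the interval *)

Section interval_potential.
Local Open Scope ereal_scope.
Context {R : realType}.
Local Notation mu := (@lebesgue_measure R).
Local Notation D := (`]0%R, +oo[%classic : set R).

(** The Cayley substitution [y = r (1 - u) / (1 + u)], composed of the affine map [y = 2 r t - r],
    the inversion [t = 1 / v] and the shift [v = 1 + u]. *)
Lemma ge0_integral_ball_subst (r : R) (g : R -> \bar R) : (0 < r)%R ->
  measurable_fun setT g -> (forall y, (- r < y < r)%R -> 0 <= g y) ->
  \int[mu]_(y in `](- r)%R, r[) g y =
  \int[mu]_(u in D) (g (r * ((1 - u) / (1 + u)))%R * (2 * r / (1 + u) ^+ 2)%:E).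
Proof.
move=> r0 mg g0; have r20 : (0 < 2 * r)%R by rewrite mulr_gt0.
have eB (t : R) : (- r < 2 * r * t + - r < r)%R = (0 < t < 1)%R.
  apply/andP/andP => -[h1 h2]; split.
  - by rewrite -(pmulr_rgt0 t r20); lra.
  - by rewrite -(ltr_pM2l r20); lra.
  - by have := mulr_gt0 r20 h1; lra.
  - by rewrite -(ltr_pM2l r20) in h2; lra.
rewrite integral_mkcond (@ge0_integral_affine _ (2 * r)%R (- r)%R _ r20); last 2 first.
- by apply/(measurable_restrictT _ _).1 => //; exact: measurable_funTS.
- by move=> y; apply: erestrict_ge0 => {}y; rewrite /= in_itv/=; exact: g0.
transitivity ((2 * r)%:E *
    \int[mu]_(t in D) (if (t < 1)%R then g (2 * r * t - r)%R else 0)).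
  congr *%E; rewrite [RHS]integral_mkcond; apply: eq_integral => t _.
  rewrite !patchE !mem_setE in_itv/= eB in_itv/= andbT.
  by case: (0 < t)%R.
rewrite (@ge0_integral_pos_inv _ 1%R _ ltr01); last 2 first.
- by mf.
- by move=> t t0; case: ifP => // t1; apply: g0; rewrite eB t0 t1.
pose h (u : R) : \bar R := g (2 * r * (1 / (u + 1)) - r)%R * (1 / (u + 1) ^+ 2)%:E.
transitivity ((2 * r)%:E *
    \int[mu]_(v in D) (if (1 < v)%R then h (v - 1)%R else 0)).
  congr *%E; apply: eq_integral => v; rewrite in_itv0y => v0.
  rewrite div1r invf_lt1// /h subrK.
  by case: ifP; rewrite ?mul0e// div1r.
have hE (u : R) : (0 < u)%R -> h u = g (r * ((1 - u) / (1 + u)))%R * (1 / (u + 1) ^+ 2)%:E.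
  move=> u0; rewrite /h; congr (g _ * _); field.
  by rewrite gt_eqF// addr_gt0.
have inB (u : R) : (0 < u)%R -> (- r < r * ((1 - u) / (1 + u)) < r)%R.
  move=> u0; have u1 : (0 < 1 + u)%R by rewrite addr_gt0.
  have := mulr_gt0 r0 u0; rewrite mulrA ltr_pdivlMr// ltr_pdivrMr//; lra.
have h0 (u : R) : (0 < u)%R -> 0 <= h u.
  move=> u0; rewrite hE// mule_ge0 ?g0 ?inB// lee_fin divr_ge0// exprn_ge0// ltW//.
  by rewrite addr_gt0.
have mh : measurable_fun setT h by rewrite /h; mf.
rewrite ge0_integral_pos_shift// -ge0_integralZl//; last 3 first.
- exact: measurable_funTS.
- by move=> u; rewrite itv0yE; exact: h0.
- by rewrite lee_fin ltW.
apply: eq_integral => u; rewrite in_itv0y => u0.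
rewrite hE// muleCA -EFinM; congr (_ * _%:E).
by rewrite addrC mulrA mulr1.
Qed.

Lemma ball_substE (r u : R) : (0 < u)%R ->
  (r ^+ 2 - (r * ((1 - u) / (1 + u))) ^+ 2 = (2 * r) ^+ 2 * u / (1 + u) ^+ 2)%R.
Proof.
by move=> u0; field; rewrite gt_eqF// addr_gt0.
Qed.

Section powers.
Variables (s r : R).
Hypotheses (s0 : (0 < s)%R) (s1 : (s < 1)%R) (r0 : (0 < r)%R).
Local Notation k := (fun y : R => (r ^+ 2 - y ^+ 2) `^ (- s))%R.

Let inv_powR (x y : R) : (0 < x)%R -> (x^-1 `^ y = x `^ (- y))%R.
Proof.
by move=> x0; rewrite -(powR_inv1 (ltW x0)) -powRrM mulN1r.
Qed.

Lemma ball_weight_subst (u : R) : (0 < u)%R ->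
  (k (r * ((1 - u) / (1 + u))) * (2 * r / (1 + u) ^+ 2) =
  (2 * r) `^ (1 - 2 * s) * (u `^ (- s) * (1 + u) `^ (2 * s - 2)))%R.
Proof.
move=> u0; have u1 : (0 < 1 + u)%R by rewrite addr_gt0.
have r20 : (0 < 2 * r)%R by rewrite mulr_gt0.
rewrite ball_substE//; move: (2 * r)%R r20 => q q0.
rewrite !powRM ?mulr_ge0 ?invr_ge0 ?exprn_ge0 ?(ltW q0) ?(ltW u0) ?(ltW u1)//.
rewrite inv_powR ?exprn_gt0// -!powR_mulrn ?(ltW q0) ?(ltW u1)// -!powRrM.
rewrite -powRN.
have -> : (q * (1 + u) `^ (- 2%:R) = q `^ 1 * (1 + u) `^ (- 2%:R))%R.
  by rewrite powRr1 ?(ltW q0).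
have -> : (q `^ (1 - 2 * s) = q `^ (- s) * q `^ (- s) * q `^ 1)%R.
  rewrite -!powRD ?(gt_eqF q0) ?implybT//; congr (_ `^ _)%R; ring.
have -> : ((1 + u) `^ (2 * s - 2) = (1 + u) `^ (2%:R * - - s) * (1 + u) `^ (- 2%:R))%R.
  rewrite -powRD ?(gt_eqF u1) ?implybT//; congr (_ `^ _)%R; ring.
ring.
Qed.

(** The potential at the endpoint [r], where the path of exterior points starts. After the
    substitution the powers of [2 r] cancel and a Beta integral with [a + b = 1] remains. *)
Lemma integral_ball_pole :
  \int[mu]_(y in `](- r)%R, r[) (k y * (r - y) `^ (2 * s - 1))%:E =
  (Gamma (1 - s) * Gamma s)%:E.
Proof.
rewrite ge0_integral_ball_subst//; last 2 first.
- by mf.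
- by move=> y _; nneg.
have := @integral_beta R (1 - s) s; rewrite subr_gt0 => /(_ s1 s0).
rewrite subrK Gamma1 divr1 => <-.
apply: eq_integral => u; rewrite in_itv0y => u0; rewrite -EFinM; congr _%:E.
have u1 : (0 < 1 + u)%R by rewrite addr_gt0.
have r20 : (0 < 2 * r)%R by rewrite mulr_gt0.
rewrite mulrAC ball_weight_subst//.
have -> : (r - r * ((1 - u) / (1 + u)) = 2 * r * u * (1 + u)^-1)%R.
  by field; rewrite gt_eqF.
move: (2 * r)%R r20 => q q0.
rewrite !powRM ?mulr_ge0 ?invr_ge0 ?(ltW q0) ?(ltW u0) ?(ltW u1)//.
rewrite inv_powR// powRr1 ?(ltW u1)//.
have e1 : (q `^ (1 - 2 * s) * q `^ (2 * s - 1) = 1)%R.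
  by rewrite -powRD ?(gt_eqF q0) ?implybT// (_ : _ + _ = 0)%R ?powRr0//; ring.
have e2 : (u `^ (- s) * u `^ (2 * s - 1) = u `^ (s - 1))%R.
  by rewrite -powRD ?(gt_eqF u0) ?implybT//; congr (_ `^ _)%R; ring.
have e3 : ((1 + u) `^ (2 * s - 2) * (1 + u) `^ (- (2 * s - 1)) = (1 + u)^-1)%R.
  rewrite -(powR_inv1 (ltW u1)) -powRD ?(gt_eqF u1) ?implybT//.
  by congr (_ `^ _)%R; ring.
rewrite -e2 -e3.
transitivity (q `^ (1 - 2 * s) * q `^ (2 * s - 1) *
  (u `^ (- s) * u `^ (2 * s - 1) * ((1 + u) `^ (2 * s - 2) * (1 + u) `^ (- (2 * s - 1)))))%R.
  by ring.
by rewrite e1 mul1r.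
Qed.

(** Up to the factor [2 s - 1] this is the derivative in [v] of the potential at [v]. Scaling [u] by
    [c = (v - r) / (v + r)] makes [(v - r) + (v + r) u] proportional to [1 + x] and leaves a Beta
    integral with both parameters [1 - s]. *)
Lemma integral_ball_outer (v : R) : (r < v)%R ->
  \int[mu]_(y in `](- r)%R, r[) (k y * (v - y) `^ (2 * s - 2))%:E =
  ((2 * r) `^ (1 - 2 * s) * (v ^+ 2 - r ^+ 2) `^ (s - 1) *
   (Gamma (1 - s) ^+ 2 / Gamma (2 - 2 * s)))%:E.
Proof.
move=> rv; have r20 : (0 < 2 * r)%R by rewrite mulr_gt0.
have v1 : (0 < v - r)%R by rewrite subr_gt0.
have v2 : (0 < v + r)%R by rewrite addr_gt0// (lt_trans r0).
rewrite ge0_integral_ball_subst//; last 2 first.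
- by mf.
- by move=> y _; nneg.
have [c cE] : exists c, c = ((v - r) / (v + r))%R by eexists.
have c0 : (0 < c)%R by rewrite cE divr_gt0.
transitivity (\int[mu]_(u in D) (((2 * r) `^ (1 - 2 * s))%:E *
    (u `^ (- s) * ((v - r) + (v + r) * u) `^ (2 * s - 2))%:E)).
  apply: eq_integral => u; rewrite in_itv0y => u0; rewrite -!EFinM; congr _%:E.
  have u1 : (0 < 1 + u)%R by rewrite addr_gt0.
  rewrite mulrAC ball_weight_subst//.
  have -> : (v - r * ((1 - u) / (1 + u)) = ((v - r) + (v + r) * u) * (1 + u)^-1)%R.
    by field; rewrite gt_eqF.
  have hv : (0 <= v - r + (v + r) * u)%R.
    by apply: addr_ge0; [exact: ltW|apply: mulr_ge0; exact: ltW].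
  have hu : (0 <= (1 + u)^-1)%R by rewrite invr_ge0 ltW.
  rewrite (powRM _ hv hu) inv_powR// (powRN (1 + u)).
  move: (2 * r)%R => q.
  by field; rewrite gt_eqF// powR_gt0.
rewrite ge0_integralZl ?lee_fin ?powR_ge0//; try msr; try nneg.
rewrite -mulrA EFinM; congr *%E.
rewrite (@ge0_integral_pos_scale _ c _ c0); try msr; last by move=> u u0; nneg.
have := @integral_beta R (1 - s) (1 - s); rewrite subr_gt0 => /(_ s1 s1).
rewrite (_ : 1 - s + (1 - s) = 2 - 2 * s)%R; last by ring.
rewrite -expr2 => e.
rewrite (EFinM ((v ^+ 2 - r ^+ 2) `^ (s - 1))%R) -e -!ge0_integralZl ?lee_fin ?powR_ge0 ?(ltW c0)//; try msr; try nneg.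
apply: eq_integral => x; rewrite in_itv0y => x0; rewrite -!EFinM; congr _%:E.
have x1 : (0 < 1 + x)%R by rewrite addr_gt0.
have -> : (v - r + (v + r) * (c * x) = (v - r) * (1 + x))%R.
  by rewrite cE; field; rewrite gt_eqF.
have -> : (v ^+ 2 - r ^+ 2 = (v - r) * (v + r))%R by ring.
have ve0 : (0 <= (v + r)^-1)%R by rewrite invr_ge0 ltW.
rewrite !powRM ?(ltW v1) ?(ltW v2) ?(ltW x1) ?(ltW c0) ?(ltW x0)//.
have e0 : (c * c `^ (- s) = (v - r) `^ (1 - s) * (v + r) `^ (s - 1))%R.
  rewrite -{1}[c]powRr1 ?(ltW c0)// -powRD ?(gt_eqF c0) ?implybT//.
  rewrite cE powRM ?(ltW v1)// inv_powR//; congr (_ * _ `^ _)%R; ring.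
have e1 : ((v - r) `^ (1 - s) * (v - r) `^ (2 * s - 2) = (v - r) `^ (s - 1))%R.
  by rewrite -powRD ?(gt_eqF v1) ?implybT//; congr (_ `^ _)%R; ring.
transitivity (c * c `^ (- s) * (x `^ (- s) * ((v - r) `^ (2 * s - 2) *
  (1 + x) `^ (2 * s - 2))))%R; first by ring.
rewrite e0 -e1 (_ : 1 - s - 1 = - s)%R; last by ring.
rewrite (_ : 2 * s - 2 = - (2 - 2 * s))%R; last by ring.
by rewrite (powRN (1 + x)); ring.
Qed.

(* The exterior point at [t] satisfies [|w|^2 = r^2 (1 + t)], so that [t] runs up
   to [r_0]. *)
Definition sphere_path (t : R) : R := (r * Num.sqrt (1 + t))%R.

(** [r / (2 sqrt (1 + t))] is the speed of [sphere_path]. After the exchange the [y]-integral is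
    known, and [sphere_path t ^+ 2 - r ^+ 2 = r ^+ 2 * t] makes all powers of [r] cancel. *)
Lemma integral_ball_increment (T : R) : (0 <= T)%R ->
  \int[mu]_(y in `](- r)%R, r[) \int[mu]_(t in `[0%R, T])
     (k y * (r / (2 * Num.sqrt (1 + t)) * (sphere_path t - y) `^ (2 * s - 2)))%:E =
  (2 `^ (- (2 * s)) * (Gamma (1 - s) ^+ 2 / Gamma (2 - 2 * s)))%:E *
  \int[mu]_(t in `[0%R, T]) (t `^ (s - 1) / (t + 1) `^ (2^-1))%:E.
Proof.
move=> T0; have r20 : (0 < 2 * r)%R by rewrite mulr_gt0.
set B := (Gamma (1 - s) ^+ 2 / Gamma (2 - 2 * s))%R.
have B0 : (0 <= B)%R.
  rewrite divr_ge0 ?sqr_ge0// ltW// Gamma_gt0//.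
  have := s1; lra.
rewrite tonelli_mu//; last 2 first.
- by apply: measurable_funTS; rewrite /sphere_path; mf.
- by move=> y t _; rewrite /= in_itv/= => /andP[t0 _]; have := ltW r0; nneg.
rewrite -[LHS]integral_itv_obnd_cbnd; last first.
  apply: (@measurable_integral_in _ _ _ _ R mu) => //.
  - by apply: measurable_funTS; rewrite /sphere_path; mf.
  - by move=> t y _ _; have := ltW r0; nneg.
rewrite -[in RHS]integral_itv_obnd_cbnd; last by msr.
have C0 : (0 <= 2 `^ (- (2 * s)) * B)%R by rewrite mulr_ge0 ?powR_ge0.
rewrite -ge0_integralZl ?lee_fin//; try msr; try nneg.
apply: eq_integral => t; rewrite mem_setE in_itv/= => /andP[t0 _].
have t1 : (0 < 1 + t)%R by rewrite addr_gt0.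
have q0 : (0 < Num.sqrt (1 + t))%R by rewrite sqrtr_gt0.
have rp : (r < sphere_path t)%R.
  rewrite /sphere_path ltr_pMr// -[X in (X < _)%R]sqrtr1 ltr_sqrt//.
  by rewrite ltrDl.
transitivity (\int[mu]_(y in `](- r)%R, r[) ((r / (2 * Num.sqrt (1 + t)))%:E *
    (k y * (sphere_path t - y) `^ (2 * s - 2))%:E)).
  by apply: eq_integral => y _; rewrite -EFinM; congr _%:E; ring.
have rq : (0 <= r / (2 * Num.sqrt (1 + t)))%R by rewrite divr_ge0 ?mulr_ge0// ltW.
rewrite ge0_integralZl ?lee_fin//; try msr; try nneg.
rewrite integral_ball_outer// -!EFinM; congr _%:E; rewrite -/B.
have -> : (sphere_path t ^+ 2 - r ^+ 2 = r ^+ 2 * t)%R.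
  by rewrite /sphere_path exprMn sqr_sqrtr ?(ltW t1)//; ring.
rewrite !powRM ?exprn_ge0 ?(ltW t0) ?(ltW r0)//.
rewrite -powR12_sqrt ?(ltW t1)// (addrC t).
have e1 : (r * (r `^ (1 - 2 * s) * (r `^ (s - 1) * r `^ (s - 1))) = 1)%R.
  rewrite -{1}[r]powRr1 ?(ltW r0)// -!powRD ?(gt_eqF r0) ?implybT//.
  by rewrite (_ : _ + _ = 0)%R ?powRr0//; ring.
have e2 : (2 `^ (1 - 2 * s) = 2 * 2 `^ (- (2 * s)) :> R)%R.
  rewrite powRD ?powRr1//; last by rewrite pnatr_eq0 implybT.
rewrite e2.
transitivity (r * (r `^ (1 - 2 * s) * (r `^ (s - 1) * r `^ (s - 1))) *
  (2 `^ (- (2 * s)) * B * (t `^ (s - 1) / (1 + t) `^ 2^-1)))%R; last by rewrite e1 mul1r.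
by field; rewrite gt_eqF// powR_gt0.
Qed.

End powers.

End interval_potential.

Lemma is_derive1_continuous {R : realType} (f : R -> R) (x l : R) :
  is_derive x 1 f l -> {for x, continuous f}.
Proof.
by move=> df; apply: differentiable_continuous; apply/derivable1_diffP.
Qed.

Section interval_potential_formulas.
Local Open Scope ereal_scope.
Context {R : realType}.
Local Notation mu := (@lebesgue_measure R).
Local Notation D := (`]0%R, +oo[%classic : set R).
Variable r : R.
Hypothesis r0 : (0 < r)%R.

Lemma sphere_path_gt (t y : R) : (0 <= t)%R -> (y < r)%R -> (y < sphere_path r t)%R.
Proof.
move=> t0 yr; apply: (lt_le_trans yr); rewrite /sphere_path ler_peMr ?(ltW r0)//.
by rewrite -[X in (X <= _)%R]sqrtr1 ler_wsqrtr// lerDl.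
Qed.

Lemma sphere_path0 : sphere_path r 0 = r.
Proof. by rewrite /sphere_path addr0 sqrtr1 mulr1. Qed.

(** The primitive [h] is general, so as to serve both the power and the logarithm. *)
Lemma integral_sphere_path (h h' : R -> R) (T y : R) : (0 < T)%R -> (y < r)%R ->
  (forall x : R, (0 < x)%R -> is_derive x 1%R h (h' x)) ->
  (forall x : R, (0 < x)%R -> {for x, continuous h'}) ->
  \int[mu]_(t in `[0%R, T])
    (r / (2 * Num.sqrt (1 + t)) * h' (sphere_path r t - y))%:E =
  (h (sphere_path r T - y) - h (r - y))%:E.
Proof.
move=> T0 yr dh ch.
have dS (t : R) : (0 <= t)%R -> is_derive t 1%R (fun t : R => Num.sqrt (1 + t))
    (2 * Num.sqrt (1 + t))^-1%R.
  move=> t0; have t1 : (0 < 1 + t)%R by rewrite ltr_pwDl.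
  have d1 : is_derive t 1%R (fun t : R => 1 + t)%R 1%R.
    have d0 : is_derive t 1%R (fun t : R => t) 1%R by exact: is_derive_id.
    have := @is_deriveD R R R _ _ t 1%R _ _ (is_derive_cst (1 : R)%R t 1%R) d0.
    by rewrite add0r.
  have d2 := @is_derive1_sqrt R _ t1.
  have := @is_derive1_comp R Num.sqrt (fun t : R => 1 + t)%R t _ _ d2 d1.
  by rewrite mulr1.
have dp (t : R) : (0 <= t)%R -> is_derive t 1%R (fun t : R => sphere_path r t - y)%R
    (r / (2 * Num.sqrt (1 + t)))%R.
  move=> t0; have d1 := dS t t0; rewrite /sphere_path.
  by apply: is_derive_eq; rewrite /GRing.scale/= subr0; ring.
have pos (t : R) : (0 <= t)%R -> (0 < sphere_path r t - y)%R.
  by move=> t0; rewrite subr_gt0 sphere_path_gt.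
have cp (t : R) : (0 <= t)%R -> {for t, continuous (fun t : R => sphere_path r t - y)%R}.
  by move=> t0; exact: is_derive1_continuous (dp t t0).
have dF (t : R) : (0 <= t <= T)%R -> is_derive t 1%R
    (fun t => h (sphere_path r t - y)%R)
    (r / (2 * Num.sqrt (1 + t)) * h' (sphere_path r t - y))%R.
  move=> /andP[t0 _]; rewrite mulrC.
  have d1 := dp t t0; have d2 := dh _ (pos t t0).
  exact: (@is_derive1_comp R h (fun t => sphere_path r t - y)%R t _ _ d2 d1).
rewrite (ftc_itvcc _ _ _ _ T0 dF); first by rewrite sphere_path0.
move=> t /andP[t0 _]; have t1 : (0 < 1 + t)%R by rewrite ltr_pwDl.
  have cq : {for t, continuous (fun t : R => r / (2 * Num.sqrt (1 + t)))%R}.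
    apply: cvgM; first exact: cvg_cst.
    apply: (@continuousV R R (fun t : R => 2 * Num.sqrt (1 + t))%R).
      by rewrite gt_eqF// mulr_gt0// sqrtr_gt0.
    apply: cvgM; first exact: cvg_cst.
    exact: is_derive1_continuous (dS t t0).
  have chp : {for t, continuous (h' \o (fun t : R => sphere_path r t - y)%R)}.
    by apply: continuous_comp; [exact: cp|exact: ch _ (pos t t0)].
  exact: (cvgM cq chp).
Qed.

(** The value at the endpoint plus the integral of the derivative along the path; as [2 s > 1], both
    terms are nonnegative. *)
Lemma integral_ball_power_right (s T : R) : (2^-1 < s < 1)%R -> (0 < T)%R ->
  \int[mu]_(y in `](- r)%R, r[)
    ((r ^+ 2 - y ^+ 2) `^ (- s) * (sphere_path r T - y) `^ (2 * s - 1))%:E =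
  (Gamma (1 - s) * Gamma s)%:E +
  ((2 * s - 1) * (2 `^ (- (2 * s)) * (Gamma (1 - s) ^+ 2 / Gamma (2 - 2 * s))))%:E *
    \int[mu]_(t in `[0%R, T]) (t `^ (s - 1) / (t + 1) `^ (2^-1))%:E.
Proof.
move=> /andP[hs s1] T0; have s0 : (0 < s)%R by rewrite (lt_trans _ hs).
have q0 : (0 < 2 * s - 1)%R by lra.
have rE := ltW r0.
rewrite -(@integral_ball_pole R s r s0 s1 r0) EFinM -muleA.
rewrite -(@integral_ball_increment R s r s1 r0 T (ltW T0)).
rewrite -ge0_integralZl ?lee_fin ?(ltW q0)//; last 2 first.
- apply: (@measurable_integral_in _ _ _ _ R mu) => //.
    by apply: measurable_funTS; rewrite /sphere_path; mf.
  by move=> *; nneg.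
- by move=> y _; apply: integral_ge0 => t _; nneg.
rewrite -ge0_integralD//; last 4 first.
- by move=> *; nneg.
- by msr.
- move=> y _; apply: mule_ge0; first by rewrite lee_fin ltW.
  by apply: integral_ge0 => t _; nneg.
- apply: mfMe; first exact: measurable_cst.
  apply: (@measurable_integral_in _ _ _ _ R mu) => //.
    by apply: measurable_funTS; rewrite /sphere_path; mf.
  by move=> *; nneg.
apply: eq_integral => y; rewrite mem_setE in_itv/= => /andP[yr1 yr2].
have dh (x : R) : (0 < x)%R ->
    is_derive x 1%R (fun x => (2 * s - 1)^-1 * x `^ (2 * s - 1))%R (x `^ (2 * s - 2))%R.
  move=> x0; have ? := @is_derive1_powR R (2 * s - 1) x x0.
  apply: is_derive_eq; rewrite /GRing.scale/= mulrA mulVf ?gt_eqF// mul1r.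
  by congr (_ `^ _)%R; ring.
have ch (x : R) : (0 < x)%R -> {for x, continuous (fun x => x `^ (2 * s - 2))%R}.
  by move=> x0; apply: is_derive1_continuous (@is_derive1_powR R _ x x0).
have e := @integral_sphere_path _ _ T y T0 yr2 dh ch.
under [X in _ + _ * X]eq_integral do rewrite EFinM.
rewrite ge0_integralZl ?lee_fin ?powR_ge0//; last 2 first.
- by apply: measurable_funTS; rewrite /sphere_path; mf.
- by move=> *; nneg.
rewrite e -!EFinM -EFinD; congr _%:E.
by field; rewrite gt_eqF.
Qed.

(** The increment at [s = 1 / 2], where the primitive is [ln] and the constant is
    [Gamma(1/2)^2 / 2]. The ratio to the value at the endpoint keeps the integrand nonnegative. *)
Lemma integral_ball_log_ratio (T : R) : (0 < T)%R ->
  \int[mu]_(y in `](- r)%R, r[)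
    ((r ^+ 2 - y ^+ 2) `^ (- 2^-1) * ln ((sphere_path r T - y) / (r - y)))%:E =
  (pi / 2)%:E *
    \int[mu]_(t in `[0%R, T]) (t `^ (2^-1 - 1) / (t + 1) `^ (2^-1))%:E.
Proof.
move=> T0; have s0 : (0 < 2^-1 :> R)%R by [].
have s1 : (2^-1 < 1 :> R)%R by lra.
have := @integral_ball_increment R 2^-1 r s1 r0 T (ltW T0).
have -> : (1 - 2^-1 = 2^-1 :> R)%R by field.
have -> : (2 - 2 / 2 = 1 :> R)%R by field.
rewrite Gamma_half Gamma1 sqr_sqrtr ?pi_ge0// divr1 divff// powR_inv1// mulrC => <-.
apply: eq_integral => y; rewrite mem_setE in_itv/= => /andP[yr1 yr2].
have ry : (0 < r - y)%R by rewrite subr_gt0.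
have py : (0 < sphere_path r T - y)%R by rewrite subr_gt0 sphere_path_gt// ltW.
have dh (x : R) : (0 < x)%R -> is_derive x 1%R (@ln R) (x `^ (1 - 2))%R.
  move=> x0; rewrite (_ : 1 - 2 = -1)%R; last by ring.
  by rewrite powR_inv1 ?(ltW x0)//; exact: is_derive1_ln.
have ch (x : R) : (0 < x)%R -> {for x, continuous (fun x => x `^ (1 - 2))%R}.
  by move=> x0; apply: is_derive1_continuous (@is_derive1_powR R _ x x0).
have e := @integral_sphere_path _ _ T y T0 yr2 dh ch.
under [RHS]eq_integral do rewrite EFinM.
rewrite ge0_integralZl ?lee_fin ?powR_ge0//; last 2 first.
- by apply: measurable_funTS; rewrite /sphere_path; mf.
- by move=> *; have := ltW r0; nneg.
by rewrite e ln_div.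
Qed.

End interval_potential_formulas.

(** [t = q^2] gives [2 / sqrt (1 + q^2)], whose primitive is [2 arcsinh q], written as a
    logarithm. *)
Lemma integral_arcsinh {R : realType} (T : R) : 0 < T ->
  (\int[@lebesgue_measure R]_(t in `[0%R, T]) (t `^ (2^-1 - 1) / (t + 1) `^ (2^-1))%:E =
  (2 * ln (Num.sqrt T + Num.sqrt (1 + T)))%:E)%E.
Proof.
move=> T0; have q0 : 0 < Num.sqrt T by rewrite sqrtr_gt0.
rewrite -integral_itv_obnd_cbnd; last by msr.
transitivity (\int[@lebesgue_measure R]_(t in `]0%R, +oo[)
    (if t <= T then t `^ (2^-1 - 1) / (t + 1) `^ (2^-1) else 0)%:E)%E.
  rewrite integral_mkcond [RHS]integral_mkcond; apply: eq_integral => t _.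
  rewrite !patchE !mem_setE !in_itv/= andbT.
  by case: (0 < t) => //=; case: ifP.
rewrite ge0_integral_pos_sqr; last 2 first.
- by mf.
- by move=> t _; nneg.
transitivity (\int[@lebesgue_measure R]_(t in `]0%R, Num.sqrt T])
    (2 / Num.sqrt (1 + t ^+ 2))%:E)%E.
  rewrite integral_mkcond [RHS]integral_mkcond; apply: eq_integral => t _.
  rewrite !patchE !mem_setE !in_itv/= andbT.
  have [t0|] //= := ltP 0 t.
  have -> : (t ^+ 2 <= T) = (t <= Num.sqrt T).
    by rewrite -[in LHS](sqr_sqrtr (ltW T0)) ler_pXn2r// nnegrE// ltW.
  case: ifP => _; last by rewrite mul0e.
  rewrite -EFinM; congr _%:E.
  have t1 : 0 < 1 + t ^+ 2 by rewrite ltr_pwDl// sqr_ge0.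
  rewrite powR12_sqrt ?[t ^+ 2 + 1]addrC ?(ltW t1)//.
  rewrite -powR_mulrn ?(ltW t0)// -powRrM (_ : 2%:R * (2^-1 - 1) = -1)%R; last by field.
  rewrite powR_mulrn ?(ltW t0)// powR_inv1 ?(ltW t0)//.
  by field; rewrite !gt_eqF// sqrtr_gt0.
rewrite integral_itv_obnd_cbnd; last by msr.
have dF (x : R) : 0 <= x <= Num.sqrt T ->
    is_derive x 1 (fun x => 2 * ln (x + Num.sqrt (1 + x ^+ 2))) (2 / Num.sqrt (1 + x ^+ 2)).
  move=> /andP[x0 _]; have x1 : 0 < 1 + x ^+ 2 by rewrite ltr_pwDl// sqr_ge0.
  have d1 : is_derive x 1%R (fun t : R => 1 + t ^+ 2)%R (2 * x).
    by apply: is_derive_eq; rewrite /GRing.scale/=; ring.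
  have d2 := @is_derive1_comp R Num.sqrt _ x _ _ (@is_derive1_sqrt R _ x1) d1.
  have d3 : is_derive x 1%R (fun t : R => t + Num.sqrt (1 + t ^+ 2))%R
      (1 + (2 * Num.sqrt (1 + x ^+ 2))^-1 * (2 * x)).
    by apply: is_deriveD.
  have s1 : 0 < Num.sqrt (1 + x ^+ 2) by rewrite sqrtr_gt0.
  have x2 : 0 < x + Num.sqrt (1 + x ^+ 2) by rewrite ltr_pwDr.
  have d4 := @is_derive1_comp R (@ln R) _ x _ _ (is_derive1_ln x2) d3.
  apply: is_derive_eq; rewrite /GRing.scale/=.
  by field; rewrite !gt_eqF.
rewrite (ftc_itvcc _ _ _ _ q0 dF).
- rewrite expr0n/= addr0 sqrtr1 add0r ln1 mulr0 subr0.
  by rewrite sqr_sqrtr// ltW.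
- move=> x /andP[x0 _]; have x1 : 0 < 1 + x ^+ 2 by rewrite ltr_pwDl// sqr_ge0.
  apply: cvgM; first exact: cvg_cst.
  apply: (@continuousV R R (fun t : R => Num.sqrt (1 + t ^+ 2))%R).
    by rewrite gt_eqF// sqrtr_gt0.
  have d1 : is_derive x 1%R (fun t : R => 1 + t ^+ 2)%R (2 * x).
    by apply: is_derive_eq; rewrite /GRing.scale/=; ring.
  exact: is_derive1_continuous
    (@is_derive1_comp R Num.sqrt _ x _ _ (@is_derive1_sqrt R _ x1) d1).
Qed.

(** * The logarithmic potential at an interior point *)

Section real_line.
Local Open Scope ereal_scope.
Context {R : realType}.
Local Notation mu := (@lebesgue_measure R).
Local Notation D := (`]0%R, +oo[%classic : set R).

Lemma ge0_integral_halves (f : R -> \bar R) :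
  measurable_fun setT f -> (forall x, 0 <= f x) ->
  \int[mu]_x f x = \int[mu]_(x in D) (f x + f (- x)%R).
Proof.
move=> mf f0.
have mfN : measurable_fun setT (fun x : R => f (- x)%R) by mf.
rewrite ge0_integralD//; try exact: measurable_funTS.
have -> : [set: R] = `]-oo, 0%R] `|` D.
  apply/seteqP; split => // x _; have [x0|x0] := leP x 0%R.
    by left; rewrite /= in_itv.
  by right; rewrite itv0yE.
rewrite ge0_integral_setU//; last 2 first.
- by apply: measurable_funTS.
- apply/disj_setPS => x [/=]; rewrite !in_itv/= andbT => x0 /lt_le_trans /(_ x0).
  by rewrite ltxx.
rewrite addeC; congr (_ + _).
rewrite [RHS]integral_itv_obnd_cbnd; last exact: measurable_funTS.
rewrite integral_mkcond ge0_integral_oppr; last 2 first.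
- by apply/(measurable_restrictT _ _).1 => //; exact: measurable_funTS.
- by move=> x; exact: erestrict_ge0.
rewrite [RHS]integral_mkcond; apply: eq_integral => x _.
by rewrite !patchE !mem_setE !in_itv/= andbT oppr_le0.
Qed.

Lemma ge0_integral_line_inv (C : R) (f : R -> \bar R) : (0 < C)%R ->
  measurable_fun setT f -> (forall x, 0 <= f x) ->
  \int[mu]_x f x = \int[mu]_x (f (C / x)%R * (C / x ^+ 2)%:E).
Proof.
move=> C0 mf f0.
have h0 (x : R) : 0 <= (C / x ^+ 2)%:E.
  by rewrite lee_fin divr_ge0 ?sqr_ge0// ltW.
rewrite [RHS]ge0_integral_halves//; last 2 first.
- by mf.
- by move=> x; rewrite mule_ge0.
rewrite ge0_integral_halves// (ge0_integral_pos_inv _ _ C0); last 2 first.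
- by mf.
- by move=> x _; exact: adde_ge0.
apply: eq_integral => x _.
by rewrite ge0_muleDl// sqrrN invrN mulrN.
Qed.

Lemma integral_eq_except (a : R) (A : set R) (f g : R -> \bar R) : measurable A ->
  measurable_fun A f -> measurable_fun A g ->
  (forall x, A x -> x != a -> f x = g x) ->
  \int[mu]_(x in A) f x = \int[mu]_(x in A) g x.
Proof.
move=> mA mf mg fg; apply: ae_eq_integral => //.
exists [set a]; split; [exact: measurable_set1|exact: lebesgue_measure_set1|].
by move=> x /=; apply: contra_notP => /eqP xa Ax; exact: fg.
Qed.

(** In the angles with [q = tan t], [q0 = tan t0] this is [- 2 ln |sin (t - t0)|], a function of the
    difference. *)
Definition moebius_log (q q0 : R) : R :=
  ln ((1 + q ^+ 2) * (1 + q0 ^+ 2) / (q - q0) ^+ 2).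

Lemma moebius_log_ge0 (q q0 : R) : (0 <= moebius_log q q0)%R.
Proof.
rewrite /moebius_log; have [->|qq] := eqVneq q q0.
  by rewrite subrr expr0n/= invr0 mulr0 ln0.
apply: ln_ge0; rewrite ler_pdivlMr ?exprn_even_gt0 ?subr_eq0//= mul1r.
have := sqr_ge0 (1 + q * q0); lra.
Qed.

(* With q = tan t and q0 = tan t0, the substitution p = (q - q0) / (1 + q q0)
   is the rotation t - t0, which preserves dq / (1 + q^2). *)
Lemma integral_moebius_log (q0 : R) : (0 <= q0)%R ->
  \int[mu]_q (moebius_log q q0 / (1 + q ^+ 2))%:E =
  \int[mu]_q (moebius_log q 0 / (1 + q ^+ 2))%:E.
Proof.
rewrite le_eqVlt => /predU1P[<-//|q00].
have pos (q : R) : (0 < 1 + q ^+ 2)%R by rewrite ltr_pwDl// sqr_ge0.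
(* [(q - q0) / (1 + q q0) = al - be / (q + al)]: the rotation is composed of shifts, a reflection
   and the inversion [x -> be / x]. *)
set al := q0^-1%R; set be := (1 + al ^+ 2)%R.
have be0 : (0 < be)%R by exact: pos.
have [F FE] : exists F, F = (fun q : R => (moebius_log q 0 / (1 + q ^+ 2))%:E) by eexists.
have F0 q : 0 <= F q.
  by rewrite FE lee_fin mulr_ge0 ?moebius_log_ge0// invr_ge0 ltW.
have mF : measurable_fun setT F by rewrite FE /moebius_log; mf.
have key (q : R) : (moebius_log q q0 / (1 + q ^+ 2))%:E =
    F (1 * - (be / (1 * q + al)) + al)%R * (be / (1 * q + al) ^+ 2)%:E.
  rewrite FE -EFinM; congr _%:E.
  have q0n : (q0 != 0)%R by rewrite gt_eqF.
  (* At the pole [q = - al] the right side is 0 by the division convention. The left side is 0 too: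
     the two directions are perpendicular there and the logarithm is [ln 1]. *)
  have [qa|qa] := eqVneq (q + al)%R 0%R.
    rewrite !mul1r qa expr0n/= invr0 !mulr0.
    have -> : (q = - al)%R by apply/eqP; rewrite -addr_eq0 qa.
    have e : ((1 + (- al) ^+ 2) * (1 + q0 ^+ 2) / (- al - q0) ^+ 2 = 1)%R.
      have p0 := pos q0; rewrite /al; field.
      by rewrite q0n/=; apply: contraTneq p0 => e; rewrite -leNgt; lra.
    by rewrite /moebius_log e ln1 mul0r.
  have qn : (1 + q * q0 != 0)%R.
    apply: contra_neq qa => e; apply: (mulIf q0n).
    by rewrite mul0r mulrDl /al mulVf// addrC.
  have -> : (1 * (- (be / (1 * q + al))) + al = (q - q0) / (1 + q * q0))%R.
    by rewrite /be /al; field; rewrite qn q0n.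
  have e2 : (1 + ((q - q0) / (1 + q * q0)) ^+ 2 =
      (1 + q ^+ 2) * (1 + q0 ^+ 2) / (1 + q * q0) ^+ 2)%R by field.
  rewrite /moebius_log e2 expr0n/= addr0 mulr1 subr0.
  have -> : (be / (1 * q + al) ^+ 2 = (1 + q0 ^+ 2) / (1 + q * q0) ^+ 2)%R.
    by rewrite /be /al; field; rewrite qn q0n.
  have -> : ((1 + q ^+ 2) * (1 + q0 ^+ 2) / (1 + q * q0) ^+ 2 /
      ((q - q0) / (1 + q * q0)) ^+ 2 = (1 + q ^+ 2) * (1 + q0 ^+ 2) / (q - q0) ^+ 2)%R.
    have [->|qq] := eqVneq q q0; first by rewrite subrr mul0r expr0n/= invr0 !mulr0.
    by field; rewrite qn subr_eq0 qq.
  have p1 := pos q; have p2 := pos q0.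
  by field; rewrite ?qn ?(gt_eqF p1) ?(gt_eqF p2).
rewrite -FE (@ge0_integral_affine _ 1%R al F ltr01)// mul1e.
rewrite (@ge0_integral_oppr _ (fun x => F (1 * x + al)%R))//; last by mf.
rewrite (@ge0_integral_line_inv be (fun x => F (1 * - x + al)%R))//; last by mf.
rewrite (@ge0_integral_affine _ 1%R al
  (fun x => F (1 * - (be / x) + al)%R * (be / x ^+ 2)%:E) ltr01); last 2 first.
- by mf.
- by move=> x; rewrite mule_ge0// lee_fin divr_ge0 ?sqr_ge0// ltW.
by rewrite mul1e; apply: eq_integral => q _; exact: key.
Qed.

Variable r : R.
Hypothesis r0 : (0 < r)%R.
Local Notation k := (fun y : R => (r ^+ 2 - y ^+ 2) `^ (- 2^-1))%R.

(** Dividing the diameter [2 r] by the distance makes the integrand nonnegative. *)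
Definition log_pot (x : R) : \bar R :=
  \int[mu]_(y in `](- r)%R, r[) (k y * ln (2 * r / `|x - y|))%:E.

Lemma ln_ratio_ge0 (x y : R) : (- r <= x <= r)%R -> (- r < y < r)%R ->
  (0 <= ln (2 * r / `|x - y|))%R.
Proof.
move=> /andP[x1 x2] /andP[y1 y2]; have [->|xy] := eqVneq x y.
  by rewrite subrr normr0 invr0 mulr0 ln0.
apply: ln_ge0; rewrite ler_pdivlMr ?normr_gt0 ?subr_eq0// mul1r ler_norml.
by apply/andP; split; lra.
Qed.

Let log_potE (x : R) : (- r < x <= r)%R ->
  log_pot x = \int[mu]_(u in D) (u `^ (- 2^-1) / (1 + u) *
     ln ((1 + u) * (1 + (r - x) / (r + x)) / `|u - (r - x) / (r + x)|))%:E.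
Proof.
move=> /andP[x1 x2]; rewrite /log_pot ge0_integral_ball_subst//; last 2 first.
- by mf.
- move=> y yr; rewrite lee_fin mulr_ge0 ?powR_ge0//; apply: ln_ratio_ge0 => //.
  by rewrite (ltW x1).
apply: eq_integral => u; rewrite in_itv0y => u0; rewrite -EFinM; congr _%:E.
have u1 : (0 < 1 + u)%R by rewrite addr_gt0.
have rx : (0 < r + x)%R by rewrite -(opprK r) addrC subr_gt0.
rewrite mulrAC (ball_weight_subst _ _ r0)// divff// subrr powRr0 mul1r.
rewrite (_ : 1 - 2 = -1)%R; last by ring.
rewrite powR_inv1 ?(ltW u1)//; congr (_ * ln _)%R.
have -> : (x - r * ((1 - u) / (1 + u)) = (r + x) * (u - (r - x) / (r + x)) / (1 + u))%R.
  by field; rewrite !gt_eqF.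
rewrite 2!normrM (gtr0_norm rx) (gtr0_norm (_ : 0 < (1 + u)^-1)%R) ?invr_gt0//.
have [->|ux] := eqVneq (u - (r - x) / (r + x))%R 0%R.
  by rewrite normr0 mulr0 mul0r invr0 !mulr0.
by field; rewrite !gt_eqF//= normr_gt0 ux.
Qed.

(** For [u = q^2] and [p^2 = (r - x) / (r + x)] the values of [moebius_log] with pole [p] at [q] and
    [- q] add up to twice the logarithm in [u], because [(q - p)^2 (q + p)^2 = (q^2 - p^2)^2]. The
    half-line is thus unfolded to the line, where the rotation acts. *)
Lemma log_pot_moebius (x : R) : (- r < x <= r)%R ->
  log_pot x = \int[mu]_q (moebius_log q 0 / (1 + q ^+ 2))%:E.
Proof.
move=> xr; rewrite log_potE//; case/andP: xr => x1 x2.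
have rx : (0 < r + x)%R by rewrite -(opprK r) addrC subr_gt0.
set u0 := ((r - x) / (r + x))%R.
have u00 : (0 <= u0)%R by rewrite divr_ge0 ?subr_ge0// ltW.
have pos (q : R) : (0 < 1 + q ^+ 2)%R by rewrite ltr_pwDl// sqr_ge0.
rewrite -(@integral_moebius_log (Num.sqrt u0)) ?sqrtr_ge0//.
rewrite ge0_integral_pos_sqr; last 2 first.
- by mf.
- move=> u u1; rewrite lee_fin mulr_ge0//.
    by rewrite divr_ge0 ?powR_ge0// addr_ge0// ltW.
  have [->|uu] := eqVneq u u0; first by rewrite subrr normr0 invr0 mulr0 ln0.
  apply: ln_ge0; rewrite ler_pdivlMr ?normr_gt0 ?subr_eq0// mul1r ler_norml.
  have := mulr_ge0 (ltW u1) u00.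
  by move=> h; apply/andP; split; lra.
rewrite ge0_integral_halves; last 2 first.
- by rewrite /moebius_log; mf.
- by move=> q; rewrite lee_fin mulr_ge0 ?moebius_log_ge0// invr_ge0 ltW.
apply: (@integral_eq_except (Num.sqrt u0)) => //.
- by apply: measurable_funTS; mf.
- by apply: measurable_funTS; rewrite /moebius_log; mf.
move=> q; rewrite itv0yE => q0 qq; rewrite -EFinM -EFinD; congr _%:E.
rewrite (sqrrN q) -mulrDl /moebius_log (sqrrN q) sqr_sqrtr// -{2}(sqr_sqrtr u00).
move: qq (sqrtr_ge0 u0); rewrite -[in (1 + u0)%R](sqr_sqrtr u00).
move: (Num.sqrt u0) => p qp p0.
have qp1 : (0 < q + p)%R by rewrite ltr_pwDl.
have qp2 : (0 < (q - p) ^+ 2)%R by rewrite exprn_even_gt0 ?subr_eq0.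
have qp3 : (0 < (- q - p) ^+ 2)%R by rewrite exprn_even_gt0//= -opprD oppr_eq0 gt_eqF.
have pq := pos q; have pp := pos p.
have A0 := mulr_gt0 pq pp.
rewrite -lnM ?posrE; [|exact: divr_gt0 A0 qp2|exact: divr_gt0 A0 qp3].
have -> : ((q ^+ 2) `^ (- 2^-1) = q^-1)%R.
  rewrite -powR_mulrn ?(ltW q0)// -powRrM (_ : 2%:R * - 2^-1 = -1)%R; last by field.
  by rewrite powR_inv1// ltW.
have np : (0 < `|q ^+ 2 - p ^+ 2|)%R.
  by rewrite normr_gt0 subr_sqr mulf_neq0 ?subr_eq0// gt_eqF.
have -> : ((1 + q ^+ 2) * (1 + p ^+ 2) / (q - p) ^+ 2 *
   ((1 + q ^+ 2) * (1 + p ^+ 2) / (- q - p) ^+ 2) =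
   ((1 + q ^+ 2) * (1 + p ^+ 2) / `|q ^+ 2 - p ^+ 2|) ^+ 2)%R.
  rewrite [in RHS]exprMn exprVn real_normK ?num_real//.
  have n1 : (q - p != 0)%R by rewrite subr_eq0.
  have n2 : (- q - p != 0)%R by rewrite -opprD oppr_eq0 gt_eqF.
  field.
  by rewrite n1 n2 subr_sqr mulf_neq0// gt_eqF.
rewrite lnXn ?divr_gt0 ?mulr_gt0// -mulr_natl.
by field; rewrite !gt_eqF.
Qed.

(** By constancy it suffices to take [x = r], where the logarithm is that of [(1 + u) / u]. The
    bound [ln v <= 4 v^(1/4)] leaves a Beta integral with parameters [1/2] and [1/4]. *)
Lemma log_pot_lty (x : R) : (- r < x <= r)%R -> log_pot x < +oo.
Proof.
move=> xr; rewrite log_pot_moebius// -(@log_pot_moebius r); last first.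
  by rewrite lexx andbT -subr_gt0 opprK addr_gt0.
rewrite log_potE; last by rewrite lexx andbT -subr_gt0 opprK addr_gt0.
apply: (@le_lt_trans _ _ (4%:E *
   \int[mu]_(t in D) (t `^ (4^-1 - 1) / (1 + t) `^ (2^-1 + 4^-1))%:E)); last first.
  by rewrite integral_beta// -EFinM ltry.
rewrite -ge0_integralZl//; try msr; try nneg.
apply: ge0_le_integral => //.
- move=> u; rewrite itv0yE => u0; rewrite lee_fin mulr_ge0//.
    by rewrite divr_ge0 ?powR_ge0// addr_ge0// ltW.
  rewrite subrr mul0r addr0 mulr1 subr0 (gtr0_norm u0); apply: ln_ge0.
  by rewrite ler_pdivlMr// mul1r lerDr.
- by apply: measurable_funTS; mf.
- by apply: measurable_funTS; mf.
move=> u; rewrite itv0yE => u0; rewrite -EFinM lee_fin.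
have u1 : (0 < 1 + u)%R by rewrite addr_gt0.
rewrite subrr mul0r addr0 mulr1 subr0 (gtr0_norm u0).
set v := ((1 + u) / u)%R; have v0 : (0 < v)%R by rewrite divr_gt0.
have lv : (ln v <= 4 * v `^ 4^-1)%R.
  have := @ln_sublinear R (v `^ 4^-1) (powR_gt0 _ v0); rewrite ln_powR; lra.
apply: (@le_trans _ _ (u `^ (- 2^-1) / (1 + u) * (4 * v `^ 4^-1))%R).
  by rewrite ler_wpM2l// divr_ge0 ?powR_ge0// ltW.
rewrite le_eqVlt; apply/orP; left; apply/eqP.
rewrite /v powRM ?invr_ge0 ?(ltW u0) ?(ltW u1)//.
rewrite -(powR_inv1 (ltW u1)) -(powR_inv1 (ltW u0)) -powRrM.
have -> : (u `^ (4^-1 - 1) = u `^ (- 2^-1) * u `^ (- 1 * 4^-1))%R.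
  by rewrite -powRD ?(gt_eqF u0) ?implybT//; congr (_ `^ _)%R; field.
have -> : ((1 + u) `^ (-1) = (1 + u) `^ (- (2^-1 + 4^-1)) * (1 + u) `^ (- 4^-1))%R.
  by rewrite -powRD ?(gt_eqF u1) ?implybT//; congr (_ `^ _)%R; field.
rewrite !(powRN (1 + u)).
by field; rewrite !gt_eqF ?powR_gt0.
Qed.

End real_line.

(** * Signed integrands *)

Section integral_subD.
Local Open Scope ereal_scope.
Context d (T : measurableType d) (R : realType) (mu : {measure set T -> \bar R}).
Implicit Types (A : set T) (f g h : T -> R).

Lemma ge0_integrable_EFin A f : measurable A ->
  measurable_fun A f -> (forall x, A x -> (0 <= f x)%R) ->
  \int[mu]_(x in A) (f x)%:E < +oo -> mu.-integrable A (EFin \o f).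
Proof.
move=> mA mf f0 foo; apply/integrableP; split; first exact/measurable_EFinP.
under eq_integral => x xA.
  rewrite gee0_abs ?lee_fin; last by apply: f0; rewrite inE in xA.
  over.
exact: foo.
Qed.

(** Made for the equality of the logarithmic potentials at [x] and at the endpoint: as their common
    value is finite, they cancel inside a signed integral. *)
Lemma integral_subD A f g h (c N : R) : measurable A ->
  measurable_fun A f -> measurable_fun A g ->
  (forall x, A x -> (0 <= f x)%R) -> (forall x, A x -> (0 <= g x)%R) ->
  mu.-integrable A (EFin \o h) ->
  \int[mu]_(x in A) (f x)%:E = \int[mu]_(x in A) (g x)%:E ->
  \int[mu]_(x in A) (g x)%:E < +oo -> \int[mu]_(x in A) (h x)%:E = N%:E ->
  \int[mu]_(x in A) (c * (f x - g x + h x))%:E = (c * N)%:E.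
Proof.
move=> mA mf mg f0 g0 ih fg goo hN.
have if_ : mu.-integrable A (EFin \o f) by apply: ge0_integrable_EFin; rewrite ?fg.
have ig : mu.-integrable A (EFin \o g) by apply: ge0_integrable_EFin.
have ifg : mu.-integrable A (EFin \o (fun x => f x - g x)%R).
  rewrite (_ : _ \o _ = (EFin \o f) \- (EFin \o g)); last by apply/funext => x /=.
  exact: integrableB.
have ifgh : mu.-integrable A (EFin \o (fun x => f x - g x + h x)%R) by exact: (integrableD _ ifg ih).
transitivity (c%:E * \int[mu]_(x in A) (f x - g x + h x)%:E).
  by rewrite -(integralZl mA ifgh).
rewrite (integralD_EFin mA ifg ih) hN /=.
under eq_integral do rewrite EFinB.
rewrite integralB_EFin// fg subee ?add0e ?EFinM// ge0_fin_numE//.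
by apply: integral_ge0 => x Ax; rewrite lee_fin g0.
Qed.

Lemma integral_addZ A f g (c : R) : measurable A ->
  mu.-integrable A (EFin \o f) -> mu.-integrable A (EFin \o g) ->
  \int[mu]_(x in A) (f x + c * g x)%:E =
  \int[mu]_(x in A) (f x)%:E + c%:E * \int[mu]_(x in A) (g x)%:E.
Proof.
move=> mA if_ ig.
have icg : mu.-integrable A (EFin \o (fun x => c * g x)%R) by exact: (integrableZl _ c ig).
rewrite (integralD_EFin mA if_ icg); congr (_ + _).
by rewrite -(integralZl mA ig).
Qed.

End integral_subD.

Section interval_potential_signed.
Local Open Scope ereal_scope.
Context {R : realType}.
Local Notation mu := (@lebesgue_measure R).

Lemma ge0_integral_ball_opp (r : R) (g : R -> \bar R) : measurable_fun setT g ->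
  (forall y, (- r < y < r)%R -> 0 <= g y) ->
  \int[mu]_(y in `](- r)%R, r[) g y = \int[mu]_(y in `](- r)%R, r[) g (- y)%R.
Proof.
move=> mg g0; rewrite integral_mkcond ge0_integral_oppr; last 2 first.
- by apply/(measurable_restrictT _ _).1 => //; exact: measurable_funTS.
- by move=> y; apply: erestrict_ge0 => {}y; rewrite /= in_itv/=; exact: g0.
rewrite [RHS]integral_mkcond; apply: eq_integral => y _.
by rewrite !patchE !mem_setE !in_itv/= ltrN2 ltrNl andbC.
Qed.

Variables (r T : R).
Hypotheses (r0 : (0 < r)%R) (T0 : (0 < T)%R).

Lemma integral_ball_power (s w : R) : (2^-1 < s < 1)%R -> (`|w| = sphere_path r T)%R ->
  \int[mu]_(y in `](- r)%R, r[)
    ((r ^+ 2 - y ^+ 2) `^ (- s) * `|w - y| `^ (2 * s - 1))%:E =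
  (Gamma (1 - s) * Gamma s)%:E +
  ((2 * s - 1) * (2 `^ (- (2 * s)) * (Gamma (1 - s) ^+ 2 / Gamma (2 - 2 * s))))%:E *
    \int[mu]_(t in `[0%R, T]) (t `^ (s - 1) / (t + 1) `^ (2^-1))%:E.
Proof.
move=> ss wE; rewrite -(@integral_ball_power_right R r r0 s T ss T0).
have p y : (- r < y < r)%R -> (0 < sphere_path r T - y)%R.
  by move=> /andP[_ yr]; rewrite subr_gt0 sphere_path_gt// ltW.
have [w0|w0] := leP 0%R w.
  apply: eq_integral => y; rewrite mem_setE in_itv/= => yr.
  by rewrite -(ger0_norm w0) wE (gtr0_norm (p _ yr)).
rewrite ge0_integral_ball_opp; last 2 first.
- by mf.
- by move=> y _; nneg.
apply: eq_integral => y; rewrite mem_setE in_itv/= => yr.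
rewrite sqrrN; congr (_ * _ `^ _)%:E.
by rewrite opprK -(gtr0_norm (p _ yr)) -wE (ltr0_norm w0) -opprD normrN.
Qed.

Local Notation k := (fun y : R => (r ^+ 2 - y ^+ 2) `^ (- 2^-1))%R.

Lemma integral_ball_log (x w c L : R) : (- r < x < r)%R -> (`|w| = sphere_path r T)%R ->
  \int[mu]_(y in `](- r)%R, r[) (c * (k y * (L + (ln `|w - y| - ln `|x - y|))))%:E =
  (c * (pi * (L + ln (Num.sqrt T + Num.sqrt (1 + T)))))%:E.
Proof.
move=> xr wE; have [x1 x2] := andP xr.
have nrr : (- r < r <= r)%R by rewrite lexx andbT -subr_gt0 opprK addr_gt0.
have nxr : (- r < x <= r)%R by rewrite x1 ltW.
have [W WE] : exists W, W = sphere_path r T by eexists.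
have p y : (- r < y < r)%R -> (r - y < W - y)%R.
  move=> /andP[_ yr]; rewrite ltrD2r WE /sphere_path ltr_pMr//.
  by rewrite -[X in (X < _)%R]sqrtr1 ltr_sqrt ?ltrDl// addr_gt0.
have rE : log_pot r x = log_pot r r by rewrite !log_pot_moebius.
have rfin := log_pot_lty _ r0 _ nrr.
pose g2 y := (k y * ln (2 * r / `|r - y|))%R.
pose g3 y := (k y * ln ((W - y) / (r - y)))%R.
have mg2 : measurable_fun setT g2 by rewrite /g2; mf.
have mg3 : measurable_fun setT g3 by rewrite /g3; mf.
have Nr y : (- r < y < r)%R -> (- r < - y < r)%R by rewrite ltrN2 ltrNl andbC.
have g20 y : (- r < y < r)%R -> (0 <= g2 y)%R.
  move=> yr; rewrite mulr_ge0 ?powR_ge0// ln_ratio_ge0//.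
  by case/andP: nrr => h _; rewrite lexx andbT ltW.
have g30 y : (- r < y < r)%R -> (0 <= g3 y)%R.
  move=> yr; have /andP[_ yr2] := yr; rewrite mulr_ge0 ?powR_ge0// ln_ge0//.
  by rewrite ler_pdivlMr ?subr_gt0// mul1r ltW// p.
have i3 : \int[mu]_(y in `](- r)%R, r[) (g3 y)%:E =
    (pi * ln (Num.sqrt T + Num.sqrt (1 + T)))%:E.
  rewrite /g3 WE integral_ball_log_ratio// integral_arcsinh// -EFinM; congr _%:E.
  by field.
(* The sign of [w]: the reflection [y -> e y] reduces to the endpoint [r], on the side of [w]. *)
pose e : R := if (0 <= w)%R then 1%R else (-1)%R.
have eE : e = 1%R \/ e = (-1)%R by rewrite /e; case: ifP => _; [left|right].
have wW : w = (e * W)%R.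
  rewrite WE -wE /e; case: (leP 0%R w) => w0; first by rewrite ger0_norm// mul1r.
  by rewrite ltr0_norm// mulrNN mul1r.
have i2e : \int[mu]_(y in `](- r)%R, r[) (g2 (e * y)%R)%:E = log_pot r r.
  case: eE => ->; first by under eq_integral do rewrite mul1r.
  under eq_integral do rewrite mulN1r.
  by rewrite -(@ge0_integral_ball_opp r (fun y => (g2 y)%:E))//; mf.
have i3e : \int[mu]_(y in `](- r)%R, r[) (g3 (e * y)%R)%:E =
    \int[mu]_(y in `](- r)%R, r[) (g3 y)%:E.
  case: eE => ->; first by under eq_integral do rewrite mul1r.
  under eq_integral do rewrite mulN1r.
  by rewrite -(@ge0_integral_ball_opp r (fun y => (g3 y)%:E))//; mf.
have Er y : (- r < y < r)%R -> (- r < e * y < r)%R.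
  by case: eE => ->; rewrite ?mul1r// mulN1r; exact: Nr.
have ee : (e * e = 1)%R by case: eE => ->; rewrite ?mulrNN mulr1.
have ne : (`|e| = 1)%R by case: eE => ->; rewrite ?normrN normr1.
(* [ln |w - y| - ln |x - y|] is split at the endpoint into the difference of the potentials at [x]
   and at the endpoint, which integrates to 0, and the increment [g3] along the path. The identity
   fails at most at [y = x]. *)
transitivity (\int[mu]_(y in `](- r)%R, r[)
   (c * (k y * ln (2 * r / `|x - y|) - g2 (e * y) + (g3 (e * y) + L * k y)))%:E).
  apply: (@integral_eq_except _ x) => //.
  - by apply: measurable_funTS; mf.
  - by apply: measurable_funTS; mf.
  move=> y; rewrite /= in_itv/= => yr yx; congr _%:E.
  have eyr := Er _ yr; have /andP[_ eyr2] := eyr.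
  have ry : (0 < r - e * y)%R by rewrite subr_gt0.
  have wy : (0 < W - e * y)%R by rewrite (lt_trans ry)// p.
  have xy : (0 < `|x - y|)%R by rewrite normr_gt0 subr_eq0 eq_sym.
  have r2 : (0 < 2 * r)%R by rewrite mulr_gt0.
  rewrite /g2 /g3 (_ : (e * y) ^+ 2 = y ^+ 2)%R; last first.
    by rewrite exprMn expr2 ee mul1r.
  have -> : (`|w - y| = W - e * y)%R.
    have -> : (w - y = e * (W - e * y))%R by rewrite wW mulrBr mulrA ee mul1r.
    by rewrite normrM ne mul1r gtr0_norm.
  rewrite (gtr0_norm ry) !ln_div ?posrE//; ring.
have ik : \int[mu]_(y in `](- r)%R, r[) (k y)%:E = pi%:E.
  have s0 : (0 < 2^-1 :> R)%R by [].
  have s1 : (2^-1 < 1 :> R)%R by lra.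
  have := @integral_ball_pole R 2^-1 r s0 s1 r0.
  have -> : (1 - 2^-1 = 2^-1 :> R)%R by field.
  rewrite Gamma_half -expr2 sqr_sqrtr ?pi_ge0// divff// subrr => <-.
  by apply: eq_integral => y _; rewrite powRr0 mulr1.
have mBo : measurable (`](- r)%R, r[%classic : set R) by [].
have ig3 : mu.-integrable `](- r)%R, r[ (EFin \o (fun y => g3 (e * y)%R)).
  apply: ge0_integrable_EFin => //.
  - by apply: measurable_funTS; mf.
  - by move=> y; rewrite /= in_itv/= => yr; exact/g30/Er.
  - by rewrite i3e i3 ltry.
have ikk : mu.-integrable `](- r)%R, r[ (EFin \o k).
  apply: ge0_integrable_EFin => //.
  - by apply: measurable_funTS; mf.
  - by move=> y _; exact: powR_ge0.
  - by rewrite ik ltry.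
have iLk : mu.-integrable `](- r)%R, r[ (EFin \o (fun y => L * k y)%R).
  exact: (integrableZl _ L ikk).
apply: integral_subD => //; try by apply: measurable_funTS; mf.
- move=> y; rewrite /= in_itv/= => yr; rewrite mulr_ge0 ?powR_ge0// ln_ratio_ge0//.
  by rewrite (ltW x1) ltW.
- by move=> y; rewrite /= in_itv/= => yr; exact/g20/Er.
- exact: (integrableD _ ig3 iLk).
- by rewrite i2e -rE.
- by rewrite i2e.
- rewrite (@integral_addZ _ _ _ mu _ _ _ L mBo ig3 ikk) i3e i3 ik -EFinM -EFinD; congr _%:E.
  by ring.
Qed.

End interval_potential_signed.

(** * Inversion and the Green function *)

Section rV_points.
Local Open Scope ereal_scope.
Context {R : realType}.

Lemma lebesgue_rV_set1 n (a : 'rV[R]_n) : (0 < n)%N ->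
  measurable [set a] /\ @lebesgue_rV R n [set a] = 0.
Proof.
case: n a => // n a _.
have aE : [set a] = [set v : 'rV[R]_n.+1 | forall i, [set a 0%R i] (v 0%R i)].
  apply/seteqP; split => [v ->//|v /= va].
  by apply/rowP => i; exact: va.
split.
  have -> : [set a] = \bigcap_(i in [set: 'I_n.+1]) (@rV_coord R n.+1 i @^-1` [set a 0%R i]).
    by rewrite aE; apply/seteqP; split => v /= h i; [move=> _|]; exact: h.
  apply: fin_bigcap_measurable => // i _.
  by rewrite -[X in measurable X]setTI; exact: measurable_rV_coord.
rewrite aE (@lebesgue_rV_box R n.+1 (fun i => [set a 0%R i])); last by move=> i; exact: measurable_set1.
by rewrite big_ord_recl/= lebesgue_measure_set1 mul0e.
Qed.

Lemma integral_rV_eq_except n (a : 'rV[R]_n) (f g : 'rV[R]_n -> \bar R) : (0 < n)%N ->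
  measurable_fun setT f -> measurable_fun setT g -> (forall x, x != a -> f x = g x) ->
  \int[@lebesgue_rV R n]_x f x = \int[@lebesgue_rV R n]_x g x.
Proof.
move=> n0 mf mg fg; have [ma a0] := lebesgue_rV_set1 _ a n0.
apply: ae_eq_integral => //.
exists [set a]; split => // x /=; apply: contra_notP => /eqP xa _; exact: fg.
Qed.

(** A substitution known for nonnegative functions passes to signed ones through positive and
    negative parts, with no integrability required; this suits the logarithm, whose sign varies. *)
Lemma integral_transfer d1 d2 (T1 : measurableType d1) (T2 : measurableType d2)
    (m1 : {measure set T1 -> \bar R}) (m2 : {measure set T2 -> \bar R})
    (A1 : set T1) (A2 : set T2) (g : T2 -> T1) (J : T2 -> R) (f : T1 -> R) :
  (forall y, (0 <= J y)%R) ->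
  \int[m1]_(x in A1) (Num.max (f x) 0)%:E = \int[m2]_(y in A2) (Num.max (f (g y)) 0 * J y)%:E ->
  \int[m1]_(x in A1) (Num.max (- f x) 0)%:E = \int[m2]_(y in A2) (Num.max (- f (g y)) 0 * J y)%:E ->
  \int[m1]_(x in A1) (f x)%:E = \int[m2]_(y in A2) (f (g y) * J y)%:E.
Proof.
move=> J0 fp fn; rewrite integralE [RHS]integralE; congr (_ - _).
  under eq_integral do rewrite funeposE -EFin_max.
  rewrite fp; apply: eq_integral => y _.
  by rewrite funeposE -EFin_max maxr_pMl// mul0r.
under eq_integral do rewrite funenegE -EFin_max.
rewrite fn; apply: eq_integral => y _.
by rewrite funenegE -EFin_max maxr_pMl// mul0r mulNr.
Qed.

Let max_ge0 (x : R) : (0 <= Num.max x 0)%R.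
Proof. by rewrite le_max lexx orbT. Qed.

Let mf_max d (T : measurableType d) (f : T -> R) : measurable_fun setT f ->
  measurable_fun setT (fun x => Num.max (f x) 0%R).
Proof. by move=> mf; apply: measurable_maxr. Qed.

(** The inversion followed by the reflection in [x]: the image of [y] lies on the opposite side of
    [x]. *)
Lemma ge0_integral_rV_inv_center n (x : 'rV[R]_n) (C : R) (f : 'rV[R]_n -> \bar R) :
  (0 < n)%N -> (0 < C)%R -> f x = 0 -> measurable_fun setT f -> (forall v, 0 <= f v) ->
  \int[@lebesgue_rV R n]_v f v =
  \int[@lebesgue_rV R n]_y (f (x - (C / enorm (y - x) ^+ 2) *: (y - x))%R *
    (C ^+ n / (enorm (y - x) ^+ 2) ^+ n)%:E).
Proof.
move=> n0 C0 fx mf f0.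
rewrite (@ge0_integral_rV_affine _ n 1%R x f ltr01)// expr1n mul1e.
rewrite (@ge0_integral_rV_opp _ n (fun v => f (1 *: v + x)%R))//; last first.
  by mf.
rewrite (@ge0_integral_rV_inv _ n C (fun v => f (1 *: - v + x)%R) n0 C0)//; last 2 first.
- by rewrite oppr0 scaler0 add0r.
- by mf.
rewrite (@ge0_integral_rV_affine _ n 1%R (- x)%R (fun v : 'rV[R]_n =>
  f (1 *: - ((C / enorm v ^+ 2) *: v) + x)%R * (C ^+ n / (enorm v ^+ 2) ^+ n)%:E) ltr01); last 2 first.
- by mf.
- by move=> v; have := ltW C0; have := f0; nneg.
rewrite expr1n mul1e; apply: eq_integral => y _.
by rewrite !scale1r addrC.
Qed.

Lemma integral_rV_inv_center n (x : 'rV[R]_n) (C : R) (f : 'rV[R]_n -> R) :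
  (0 < n)%N -> (0 < C)%R -> f x = 0%R -> measurable_fun setT f ->
  \int[@lebesgue_rV R n]_v (f v)%:E =
  \int[@lebesgue_rV R n]_y (f (x - (C / enorm (y - x) ^+ 2) *: (y - x)) *
    (C ^+ n / (enorm (y - x) ^+ 2) ^+ n))%:E.
Proof.
move=> n0 C0 fx mf.
apply: (@integral_transfer _ _ _ _ (@lebesgue_rV R n) (@lebesgue_rV R n) setT setT
  (fun y => x - (C / enorm (y - x) ^+ 2) *: (y - x))%R
  (fun y => C ^+ n / (enorm (y - x) ^+ 2) ^+ n)%R).
- by move=> y; have := ltW C0; nneg.
- rewrite (@ge0_integral_rV_inv_center n x C (fun v => (Num.max (f v) 0)%:E))//.
  + by rewrite fx maxxx.
  + by apply/measurable_EFinP; exact: mf_max.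
  + by move=> v; rewrite lee_fin.
- rewrite (@ge0_integral_rV_inv_center n x C (fun v => (Num.max (- f v) 0)%:E))//.
  + by rewrite fx oppr0 maxxx.
  + by apply/measurable_EFinP; apply: mf_max; exact: mfN.
  + by move=> v; rewrite lee_fin.
Qed.

Lemma integral_rV1 (f : 'rV[R]_1 -> R) : measurable_fun setT f ->
  \int[@lebesgue_rV R 1]_v (f v)%:E =
  \int[@lebesgue_measure R]_a (f (rV_cons (0%R : 'rV[R]_0, a)))%:E.
Proof.
move=> mf.
have H (g : 'rV[R]_1 -> R) : measurable_fun setT g -> (forall v, (0 <= g v)%R) ->
    \int[@lebesgue_rV R 1]_v (g v)%:E =
    \int[@lebesgue_measure R]_a (g (rV_cons (0%R : 'rV[R]_0, a)))%:E.
  move=> mg g0; rewrite ge0_integral_rVS; last 2 first.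
  - exact/measurable_EFinP.
  - by move=> v; rewrite lee_fin.
  rewrite ge0_integral_rV0//.
  apply: (@measurable_integral_in _ _ _ _ R (@lebesgue_measure R)
    setT setT (fun v a => (g (rV_cons (v, a)))%:E)) => //.
  + rewrite setXTT; apply/measurable_EFinP; apply: (measurableT_comp mg).
    by apply: mf_rV_cons; [exact: measurable_fst|exact: measurable_snd].
  + by move=> v a _ _; rewrite lee_fin.
have := @integral_transfer _ _ _ _ (@lebesgue_rV R 1) (@lebesgue_measure R) setT setT
  (fun a => rV_cons (0%R : 'rV[R]_0, a)) (fun=> 1%R) f (fun=> ler01).
move=> ->.
- by apply: eq_integral => a _; rewrite mulr1.
- rewrite (H (fun v => Num.max (f v) 0%R))//; last exact: mf_max.
  by apply: eq_integral => a _; rewrite mulr1.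
- rewrite (H (fun v => Num.max (- f v)%R 0%R))//; last by apply: mf_max; exact: mfN.
  by apply: eq_integral => a _; rewrite mulr1.
Qed.

End rV_points.

(** * Geometry of the inversion *)

Section geometry.
Context {R : realType} {n : nat}.
Implicit Types (x y z e : 'rV[R]_n) (r : R).

Lemma sqr_enormD x y : enorm (x + y) ^+ 2 = enorm x ^+ 2 + 2 * dotv x y + enorm y ^+ 2.
Proof. by rewrite !sqr_enorm !(dotvDl, dotvDr) (dotvC y x); ring. Qed.

Lemma sqr_enormZ c x : enorm (c *: x) ^+ 2 = c ^+ 2 * enorm x ^+ 2.
Proof. by rewrite enormZ exprMn real_normK ?num_real. Qed.

(** For [x] in the ball, [r^2 - |x|^2] is the product of the two segments into which [x] cuts any
    chord. The inversion with this constant, composed with the reflection in [x], therefore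
    preserves the sphere; the sign of the factor shows that it exchanges the two sides. *)
Lemma sqr_enorm_inversion r x e : e != 0 ->
  enorm (x - ((r ^+ 2 - enorm x ^+ 2) / enorm e ^+ 2) *: e) ^+ 2 - r ^+ 2 =
  (r ^+ 2 - enorm x ^+ 2) / enorm e ^+ 2 * (r ^+ 2 - enorm (x + e) ^+ 2).
Proof.
move=> e0; have e1 : enorm e != 0 by rewrite enorm_eq0.
rewrite -scaleNr !sqr_enormD sqr_enormZ dotvZr.
by field.
Qed.

(* The identity |u/|u|^2 - v/|v|^2| = |u - v| / (|u| |v|). *)
Lemma enorm_inversion (C : R) u e : u != 0 -> e != 0 ->
  enorm (u + (C / enorm e ^+ 2) *: e) =
  enorm u * enorm (- (C / enorm u ^+ 2) *: u - e) / enorm e.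
Proof.
move=> u0 e0; have u1 : 0 < enorm u by rewrite enorm_gt0.
have e1 : 0 < enorm e by rewrite enorm_gt0.
apply: (@pexpIrn _ 2); rewrite ?nnegrE ?enorm_ge0//.
  by rewrite divr_ge0 ?mulr_ge0 ?enorm_ge0.
rewrite exprMn exprVn exprMn !sqr_enormD enormN !sqr_enormZ !(dotvZr, dotvZl, dotvNr).
by field; rewrite !gt_eqF.
Qed.

End geometry.

(* The image of [z] under the inversion centred at [x] that exchanges the ball
   of radius [r] with its exterior. *)
Definition inversion_image {R : realType} {n : nat} (r : R) (x z : 'rV[R]_n) : 'rV[R]_n :=
  x - ((r ^+ 2 - enorm x ^+ 2) / enorm (z - x) ^+ 2) *: (z - x).

Section inversion.
Local Open Scope ereal_scope.
Context {R : realType} {n : nat}.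
Variables (r : R) (x z : 'rV[R]_n).
Hypotheses (r_gt0 : (0 < r)%R).
Hypotheses (xr : (enorm x < r)%R) (zr : (enorm z < r)%R) (xz : x != z).

Lemma sqr_gap_gt0 (v : 'rV[R]_n) : (0 < r ^+ 2 - enorm v ^+ 2)%R = (enorm v < r)%R.
Proof. by rewrite subr_gt0 ltr_pXn2r// nnegrE ?enorm_ge0// ltW. Qed.

Lemma r0_gt0 : (0 < r0 r x z)%R.
Proof.
rewrite /r0 divr_gt0// mulr_gt0 ?sqr_gap_gt0 ?exprn_gt0//.
by rewrite enorm_gt0 subr_eq0.
Qed.

Lemma sqr_enorm_inversion_image :
  (enorm (inversion_image r x z) ^+ 2 = r ^+ 2 * (1 + r0 r x z))%R.
Proof.
have zx : (z - x != 0)%R by rewrite subr_eq0 eq_sym.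
have m0 : (0 < enorm (z - x))%R by rewrite enorm_gt0.
have := sqr_enorm_inversion r x _ zx; rewrite subrKC -/(inversion_image r x z) => e.
rewrite -[LHS](subrK (r ^+ 2)%R) e /r0 -(enormN (x - z)) opprB.
by field; rewrite !gt_eqF.
Qed.

Lemma inversion_image_gt : (r < enorm (inversion_image r x z))%R.
Proof.
rewrite -(@ltr_pXn2r _ 2)// ?nnegrE ?enorm_ge0 ?(ltW r_gt0)//.
by rewrite sqr_enorm_inversion_image ltr_pMr ?exprn_gt0// ltrDl r0_gt0.
Qed.

Lemma enorm_inversion_image :
  enorm (inversion_image r x z) = sphere_path r (r0 r x z).
Proof.
have w0 := lt_trans r_gt0 inversion_image_gt.
rewrite /sphere_path -(gtr0_norm w0) -sqrtr_sqr sqr_enorm_inversion_image.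
by rewrite sqrtrM ?sqr_ge0// sqrtr_sqr gtr0_norm.
Qed.

End inversion.

(** * The Green function after inversion *)

Section green.
Local Open Scope ereal_scope.
Context {R : realType} {n : nat}.
Variables (s r : R) (x z : 'rV[R]_n).
Hypotheses (n0 : (0 < n)%N) (s0 : (0 < s)%R) (s1 : (s < 1)%R) (r_gt0 : (0 < r)%R).
Hypotheses (xr : (enorm x < r)%R) (zr : (enorm z < r)%R) (xz : x != z).

Local Notation m := (enorm (z - x)).
Local Notation d := (r ^+ 2 - enorm x ^+ 2)%R.
Local Notation w := (inversion_image r x z).

Let zx : (z - x != 0)%R. Proof. by rewrite subr_eq0 eq_sym. Qed.
Let m_gt0 : (0 < m)%R. Proof. by rewrite enorm_gt0. Qed.
Let sqr_gap := @sqr_gap_gt0 R n r r_gt0.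
Let d_gt0 : (0 < d)%R. Proof. by rewrite sqr_gap. Qed.

(** With [v] the image of [y], [|x - v| = d / |y - x|] and the Jacobian is [d^n / |y - x|^(2 n)], so
    that all powers of [d] cancel. The function [h] is general to cover both forms of [Phi]. *)
Lemma integral_Poisson (h : R -> R) : measurable_fun setT h ->
  \int[lebesgue_rV]_(y in ~` eball r) (h (enorm (z - y)) * Poisson s r y x)%:E =
  \int[@lebesgue_rV R n]_y
    (if (enorm y < r)%R then h (m * enorm (w - y) / enorm (y - x)) *
       (c_const n s * (enorm (y - x) `^ (2 * s - n%:R) * (r ^+ 2 - enorm y ^+ 2) `^ (- s)))
     else 0)%:E.
Proof.
move=> mh.
pose f (v : 'rV[R]_n) : R := if (enorm v < r)%R then 0%R else
  (h (enorm (z - v)) * Poisson s r v x)%R.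
transitivity (\int[@lebesgue_rV R n]_v (f v)%:E).
  rewrite integral_mkcond; apply: eq_integral => v _.
  rewrite patchE /f /eball; case: ifPn => [|]; rewrite ?notin_setE ?inE/=.
    by move=> /negP/negbTE ->.
  by rewrite /setC/= => /contrapT ->.
have mf' : measurable_fun setT f by rewrite /f /Poisson; mf.
have fx : f x = 0%R by rewrite /f xr.
rewrite (@integral_rV_inv_center _ n x d f n0 d_gt0 fx mf').
(* At the centre [x] the inversion takes a default value; a single point is null. *)
apply: (@integral_rV_eq_except _ n x _ _ n0).
- have mf2 : measurable_fun setT (fun y : 'rV[R]_n => f (x - (d / enorm (y - x) ^+ 2) *: (y - x))%R).
    apply: (measurableT_comp mf').
    by mf.
  by mf.
- by mf.
move=> y yx; congr _%:E.
have yx0 : (y - x != 0)%R by rewrite subr_eq0.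
have e0 : (0 < enorm (y - x))%R by rewrite enorm_gt0.
have Hi := sqr_enorm_inversion r x _ yx0; rewrite subrKC in Hi.
rewrite /f; move: Hi; set v := (x - _ *: _)%R => Hi.
have a0 : (0 < d / enorm (y - x) ^+ 2)%R by rewrite divr_gt0// exprn_gt0.
have [yr|yr] := ltP (enorm y) r.
  have yr2 : (0 < r ^+ 2 - enorm y ^+ 2)%R by rewrite sqr_gap.
  rewrite ifF; last first.
    apply/negbTE; rewrite -sqr_gap -leNgt -oppr_ge0 opprB Hi.
    by rewrite mulr_ge0 ?ltW.
  have -> : enorm (z - v) = (m * enorm (w - y) / enorm (y - x))%R.
    have -> : (z - v = (z - x) + (d / enorm (y - x) ^+ 2) *: (y - x))%R.
      by rewrite /v opprB addrA addrAC.
    rewrite enorm_inversion//; congr (_ * enorm _ / _)%R.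
    by rewrite /inversion_image scaleNr opprB addrA (addrC (- _)%R).
  rewrite -mulrA; congr (_ * _)%R.
  have xv : enorm (x - v) = (d / enorm (y - x))%R.
    rewrite /v opprB addrC subrK enormZ gtr0_norm//.
    by field; rewrite gt_eqF.
  rewrite /Poisson Hi xv.
  have -> : (d / (d / enorm (y - x) ^+ 2 * (r ^+ 2 - enorm y ^+ 2)) =
      enorm (y - x) ^+ 2 * (r ^+ 2 - enorm y ^+ 2)^-1)%R.
    by field; rewrite !gt_eqF.
  have ir (a p : R) : (0 < a)%R -> (a^-1 `^ p = a `^ (- p))%R.
    by move=> a1; rewrite -(powR_inv1 (ltW a1)) -powRrM mulN1r.
  suff core : ((enorm (y - x) ^+ 2 * (r ^+ 2 - enorm y ^+ 2)^-1) `^ s /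
      (d / enorm (y - x)) ^+ n * (d ^+ n / (enorm (y - x) ^+ 2) ^+ n) =
      enorm (y - x) `^ (2 * s - n%:R) * (r ^+ 2 - enorm y ^+ 2) `^ (- s))%R.
    by rewrite -core !mulrA.
  rewrite powRM ?sqr_ge0 ?invr_ge0 ?(ltW yr2)// ir//.
  rewrite -(powR_mulrn 2 (ltW e0)) -powRrM.
  have -> : (enorm (y - x) `^ (2 * s - n%:R) =
      enorm (y - x) `^ (2%:R * s) / enorm (y - x) ^+ n)%R.
    by rewrite -powR_mulrn ?(ltW e0)// -powRB// (gt_eqF e0) implybT.
  rewrite exprMn exprVn powR_mulrn ?(ltW e0)// -exprM mulnC exprM.
  by field; rewrite !expf_neq0 ?gt_eqF.
have [vr|vr] := ltP (enorm v) r; first by rewrite mul0r.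
(* [y] and its image can both lie outside the open ball only on the sphere, where the kernel
   evaluates to 0. *)
suff -> : Poisson s r v x = 0%R by rewrite mulr0 mul0r.
have y2 : (r ^+ 2 - enorm y ^+ 2 <= 0)%R by rewrite leNgt sqr_gap -leNgt.
have v2 : (r ^+ 2 - enorm v ^+ 2 <= 0)%R by rewrite leNgt sqr_gap -leNgt.
suff e : (enorm v ^+ 2 - r ^+ 2 = 0)%R.
  by rewrite /Poisson e invr0 mulr0 powR0 ?gt_eqF// mulr0 mul0r.
apply/eqP; rewrite eq_le -[X in _ && X]oppr_le0 opprB v2 andbT Hi.
by rewrite pmulr_rle0.
Qed.

(** Written with the power itself rather than the subordinated kernel, it also covers
    [n = 1 < 2 s]. *)
Definition ball_riesz (v : 'rV[R]_n) : \bar R :=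
  \int[@lebesgue_rV R n]_y (if (enorm y < r)%R then
     (r ^+ 2 - enorm y ^+ 2) `^ (- s) * enorm (v - y) `^ (2 * s - n%:R) else 0%R)%:E.

(** [Phi (z - y)] acquires the factor [|y - x|^(n - 2 s)], which cancels the power left by the
    Poisson kernel; the integrand is then a constant multiple of that of [ball_riesz w]. *)
Lemma Green_power (j : R) : n%:R != (2 * s)%R -> ball_riesz w = j%:E ->
  Green s r x z =
  (a_const n s * m `^ (2 * s - n%:R) * (1 - c_const n s * j))%:E.
Proof.
move=> ns jE; have mxz : enorm (x - z) = m by rewrite -enormN opprB.
have pE : (- n%:R + 2 * s = 2 * s - n%:R)%R by rewrite addrC.
rewrite /Green /Phi (negbTE ns) pE mxz.
pose h (t : R) := (a_const n s * t `^ (2 * s - n%:R))%R.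
rewrite (@integral_Poisson h); last by rewrite /h; mf.
pose C := (a_const n s * m `^ (2 * s - n%:R) * c_const n s)%R.
pose J (y : 'rV[R]_n) : R := if (enorm y < r)%R then
  ((r ^+ 2 - enorm y ^+ 2) `^ (- s) * enorm (w - y) `^ (2 * s - n%:R))%R else 0%R.
have J0 y : (0 <= J y)%R by rewrite /J; nneg.
have mJ : measurable_fun setT J by rewrite /J; mf.
rewrite (@integral_rV_eq_except _ n x _ (fun y => C%:E * (J y)%:E) n0); last 3 first.
- by rewrite /h; mf.
- by mf.
- move=> y yx; rewrite -EFinM; congr _%:E; rewrite /J.
  have [yr|yr] := ltP (enorm y) r; last by rewrite mulr0.
  have e0 : (0 < enorm (y - x))%R by rewrite enorm_gt0 subr_eq0.
  rewrite /h /C powRM ?mulr_ge0 ?invr_ge0 ?enorm_ge0 ?(ltW m_gt0)//.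
  rewrite powRM ?enorm_ge0 ?(ltW m_gt0)//.
  rewrite -(powR_inv1 (ltW e0)) -powRrM mulN1r (powRN (enorm (y - x))).
  have : (enorm (y - x) `^ (2 * s - n%:R) != 0)%R by rewrite gt_eqF// powR_gt0.
  move: (enorm (y - x) `^ _)%R (enorm (w - y) `^ _)%R (m `^ _)%R (_ `^ (- s))%R => E W M K E0.
  by move: (a_const n s) (c_const n s) => A B; field.
have iJ : (@lebesgue_rV R n).-integrable setT (EFin \o J).
  by apply: ge0_integrable_EFin => //; rewrite [X in X < _]jE ltry.
rewrite integralZl// [X in _ * X]jE -EFinM -EFinB; congr _%:E.
by rewrite /C; ring.
Qed.

(** Expanding the constants leaves [sin (pi s) Gamma s Gamma (1 - s) / pi]. *)
Lemma c_const_riesz : (2 * s < n%:R)%R ->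
  (c_const n s * riesz_const n s * (Gamma (n%:R / 2 - s) * Gamma s / Gamma (n%:R / 2)) = 1)%R.
Proof.
move=> ns; have a0 : (0 < n%:R / 2 - s)%R by rewrite subr_gt0 ltr_pdivlMr// mulrC.
have nn : (0 < n%:R / 2 :> R)%R by rewrite divr_gt0// ltr0n.
have G1 := Gamma_gt0 _ a0; have G2 := Gamma_gt0 _ s0; have G3 := Gamma_gt0 _ nn.
have s1' : (0 < 1 - s)%R by rewrite subr_gt0.
have G4 := Gamma_gt0 _ s1'.
have p0 : (0 < (pi : R) `^ (n%:R / 2))%R by rewrite powR_gt0// pi_gt0.
have ss : (0 < s < 1)%R by rewrite s0 s1.
have e := @Gamma_reflection R s ss.
have pp := @pi_gt0 R.
rewrite /c_const /riesz_const powRD ?(gt_eqF pp) ?implybT// powRr1 ?(ltW pp)//.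
transitivity (sin (pi * s) * (Gamma s * Gamma (1 - s)) / pi)%R; last first.
  by rewrite e divff// gt_eqF.
move: (pi : R) pp (sin _) p0 => P P0 S p0.
by field; rewrite !gt_eqF.
Qed.

Lemma Green_exterior : (2 * s < n%:R)%R ->
  Green s r x z =
  (a_const n s / (Gamma (n%:R / 2 - s) * Gamma s / Gamma (n%:R / 2)) *
    m `^ (2 * s - n%:R))%:E *
  \int[lebesgue_measure]_(t in `[0%R, r0 r x z]) (t `^ (s - 1) / (t + 1) `^ (n%:R / 2))%:E.
Proof.
move=> ns; have a0 : (0 < n%:R / 2 - s)%R by rewrite subr_gt0 ltr_pdivlMr// mulrC.
have T0 := r0_gt0 _ _ _ r_gt0 xr zr xz.
move: (sqr_enorm_inversion_image _ _ _ r_gt0 xz) T0; set T := r0 r x z => wT T0.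
set B := (_ / Gamma (n%:R / 2))%R.
pose g (t : R) : R := (t `^ (s - 1) / (t + 1) `^ (n%:R / 2))%R.
have g0 t : (0 <= g t)%R by rewrite /g; nneg.
have mg : measurable_fun setT g by rewrite /g; mf.
(* The Beta integral cut at [T = r_0]; both parts are finite because their sum is. *)
pose I1 := \int[lebesgue_measure]_(t in `]0%R, +oo[) (if (t <= T)%R then g t else 0%R)%:E.
pose I2 := \int[lebesgue_measure]_(t in `]0%R, +oo[) (if (T < t)%R then g t else 0%R)%:E.
have I10 : 0 <= I1 by apply: integral_ge0 => t _; have := g0; nneg.
have I20 : 0 <= I2 by apply: integral_ge0 => t _; have := g0; nneg.
have IB : I1 + I2 = B%:E.
  have := @integral_beta R _ _ a0 s0; rewrite subrK -/B => <-.
  rewrite /I1 /I2 -ge0_integralD//; try msr; try (by move=> t _; have := g0; nneg).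
  apply: eq_integral => t _; rewrite -EFinD (addrC 1%R).
  by case: (leP t T) => _; rewrite ?addr0 ?add0r.
have -> : \int[lebesgue_measure]_(t in `[0%R, T]) (g t)%:E = I1.
  rewrite -integral_itv_obnd_cbnd; last by msr.
  rewrite /I1 integral_mkcond [RHS]integral_mkcond; apply: eq_integral => t _.
  rewrite !patchE !mem_setE !in_itv/= andbT.
  by case: (0 < t)%R => //=; case: ifP.
have [i1 i1E] : exists i1, I1 = i1%:E.
  exists (fine I1); rewrite fineK// ge0_fin_numE//.
  by rewrite (@le_lt_trans _ _ (I1 + I2)) ?leeDl// IB ltry.
have [i2 i2E] : exists i2, I2 = i2%:E.
  exists (fine I2); rewrite fineK// ge0_fin_numE//.
  by rewrite (@le_lt_trans _ _ (I1 + I2)) ?leeDr// IB ltry.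
have Bi : (B = i1 + i2)%R by move: IB; rewrite i1E i2E -EFinD => -[].
have jE : ball_riesz w = (riesz_const n s * i2)%:E.
  have wr := inversion_image_gt _ _ _ r_gt0 xr zr xz.
  rewrite /ball_riesz -(riesz_potE _ _ ns _ _ r_gt0 wr).
  rewrite (@riesz_pot_beta_tail _ _ _ s0 s1 ns _ _ r_gt0 wr).
  (* [|w|^2 = r^2 (1 + T)] turns the cut-off of [beta_tail] into [T < t]. *)
  suff eI : \int[lebesgue_measure]_(t in `]0%R, +oo[)
      (if (enorm w ^+ 2 < r ^+ 2 * (1 + t))%R then t `^ (s - 1) / (1 + t) `^ (n%:R / 2)
       else 0%R)%:E = I2.
    by rewrite /beta_tail eI i2E EFinM.
  apply: eq_integral => t _.
  by rewrite wT ltr_pM2l ?exprn_gt0// ltrD2l /g (addrC t).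
rewrite (Green_power _ _ jE); last by rewrite gt_eqF.
rewrite i1E -EFinM; congr _%:E.
have cB := c_const_riesz ns; rewrite -/B in cB.
have B0 : B != 0%R by apply: contra_eq_neq cB => ->; rewrite mulr0 eq_sym oner_neq0.
have -> : (1 - c_const n s * (riesz_const n s * i2) = i1 / B)%R.
  apply: (mulIf B0); rewrite divfK// mulrBl mul1r.
  have -> : (c_const n s * (riesz_const n s * i2) * B =
    (c_const n s * riesz_const n s * B) * i2)%R by ring.
  by rewrite cB mul1r Bi addrK.
by ring.
Qed.

End green.

(** * The Green function in dimension one *)

Section green1.
Local Open Scope ereal_scope.
Context {R : realType}.

Lemma enorm_rV1 (v : 'rV[R]_1) : enorm v = `|v 0%R 0%R|%R.
Proof. by rewrite /enorm big_ord1 sqrtr_sqr. Qed.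

Lemma rV_cons1 (v : 'rV[R]_0) (a : R) : (rV_cons (v, a)) 0%R 0%R = a.
Proof. by rewrite mxE unlift_none. Qed.

Lemma sub_rV1 (u v : 'rV[R]_1) : ((u - v) 0 0 = u 0 0 - v 0 0)%R.
Proof. by rewrite !mxE. Qed.

Lemma integral_rV1_ball (r : R) (g : 'rV[R]_1 -> R) : measurable_fun setT g ->
  \int[@lebesgue_rV R 1]_v (if (enorm v < r)%R then g v else 0%R)%:E =
  \int[@lebesgue_measure R]_(a in `](- r)%R, r[) (g (rV_cons (0%R, a)))%:E.
Proof.
move=> mg; rewrite integral_rV1; last by mf.
rewrite [RHS]integral_mkcond; apply: eq_integral => a _.
rewrite patchE mem_setE in_itv/= enorm_rV1 rV_cons1 ltr_norml.
by case: ifP.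
Qed.

Variables (s r : R) (x z : 'rV[R]_1).
Hypotheses (s0 : (0 < s)%R) (s1 : (s < 1)%R) (r_gt0 : (0 < r)%R).
Hypotheses (xr : (enorm x < r)%R) (zr : (enorm z < r)%R) (xz : x != z).
Local Notation w := (inversion_image r x z).

Let wE : (`|w 0 0| = sphere_path r (r0 r x z))%R.
Proof. by rewrite -enorm_rV1; exact: enorm_inversion_image. Qed.

Let T0 : (0 < r0 r x z)%R. Proof. exact: r0_gt0. Qed.

Lemma c_const1 : c_const 1 s = (sin (pi * s) / pi :> R)%R.
Proof.
have pp := @pi_gt0 R.
have q0 : (0 < Num.sqrt (pi : R))%R by rewrite sqrtr_gt0.
rewrite /c_const mul1r Gamma_half powRD ?(gt_eqF pp) ?implybT// powRr1 ?(ltW pp)//.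
rewrite powR12_sqrt ?(ltW pp)//.
move: (sin _) => S; move: (pi : R) pp q0 => P P0 q0.
by field; rewrite (gt_eqF P0) (gt_eqF q0).
Qed.

(** By reflection [c_const 1 s] times the endpoint value [Gamma (1 - s) Gamma s] is 1, so in
    [1 - c j] only the increment along the path survives. It comes with a minus sign, which the
    negative [a_const 1 s] compensates. *)
Lemma Green_power1 : (2^-1 < s)%R ->
  Green s r x z =
  (- (a_const 1 s * c_const 1 s * ((2 * s - 1) * (2 `^ (- (2 * s)) *
     (Gamma (1 - s) ^+ 2 / Gamma (2 - 2 * s))))) * enorm (z - x) `^ (2 * s - 1%:R))%:E *
  \int[lebesgue_measure]_(t in `[0%R, r0 r x z]) (t `^ (s - 1) / (t + 1) `^ (1%:R / 2))%:E.
Proof.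
move=> hs; have ss : (2^-1 < s < 1)%R by rewrite hs s1.
set C := ((2 * s - 1) * _)%R.
have := @integral_ball_power R r (r0 r x z) r_gt0 T0 s (w 0%R 0%R) ss wE.
rewrite -/C (_ : 1%:R / 2 = 2^-1)%R ?mul1r//.
pose I := \int[lebesgue_measure]_(t in `[0%R, r0 r x z]) (t `^ (s - 1) / (t + 1) `^ 2^-1)%:E.
rewrite -/I => e.
have I0 : 0 <= I by apply: integral_ge0 => t _; nneg.
have eI : ball_riesz s r w = (Gamma (1 - s) * Gamma s)%:E + C%:E * I.
  rewrite /ball_riesz integral_rV1_ball; last by mf.
  rewrite -e; apply: eq_integral => a _; congr (_ * _ `^ _)%:E.
    by rewrite enorm_rV1 rV_cons1 real_normK ?num_real.
  by rewrite enorm_rV1 sub_rV1 rV_cons1.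
(* For [t <= r_0], [(1 + t)^(- 1/2) <= (1 + r_0)^(1/2) / (1 + t)], which compares [I] with a Beta
   integral. *)
have [i iE] : exists i, I = i%:E.
  exists (fine I); rewrite fineK// ge0_fin_numE//.
  have q0 : (0 <= (1 + r0 r x z) `^ 2^-1)%R by exact: powR_ge0.
  apply: (@le_lt_trans _ _ (((1 + r0 r x z) `^ 2^-1)%:E *
     \int[lebesgue_measure]_(t in `]0%R, +oo[) (t `^ (s - 1) / (1 + t) `^ (1 - s + s))%:E)); last first.
    by rewrite integral_beta ?subr_gt0// -EFinM ltry.
  rewrite -ge0_integralZl//; try msr; try nneg.
  rewrite /I -integral_itv_obnd_cbnd; last by msr.
  rewrite [leLHS]integral_mkcond [leRHS]integral_mkcond; apply: ge0_le_integral => //.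
  - by move=> t _; apply: erestrict_ge0 => *; nneg.
  - by apply/(measurable_restrictT _ _).1 => //; msr.
  - by apply/(measurable_restrictT _ _).1 => //; msr.
  move=> t _; rewrite !patchE !mem_setE !in_itv/= andbT.
  have [t0|t0] //= := ltP 0%R t.
  have t1 : (0 < 1 + t)%R by rewrite addr_gt0.
  case: ifP => tT; last by nneg.
  rewrite -EFinM lee_fin subrK powRr1 ?(ltW t1)// mulrCA ler_wpM2l ?powR_ge0//.
  rewrite (addrC t) ler_pdivlMr// mulrC ler_pdivrMr ?powR_gt0//.
  rewrite -[leLHS](sqr_sqrtr (ltW t1)) -powR12_sqrt ?(ltW t1)// expr2.
  rewrite ler_wpM2r ?powR_ge0// ge0_ler_powR ?nnegrE ?(ltW t1)//.
    by rewrite addr_ge0// ltW// r0_gt0.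
  by rewrite lerD2l.
rewrite iE -EFinM -EFinD in eI.
rewrite (@Green_power _ 1 s r x z _ s0 r_gt0 xr xz _ _ eI)//; last by rewrite lt_eqF//; lra.
rewrite iE -EFinM; congr _%:E.
have cG : (c_const 1 s * (Gamma (1 - s) * Gamma s) = 1)%R.
  have pp := @pi_gt0 R.
  have ss' : (0 < s < 1)%R by rewrite s0 s1.
  have := @Gamma_reflection R s ss'; rewrite (mulrC (Gamma s)) => er.
  by rewrite c_const1 mulrAC er divff// gt_eqF.
by rewrite (mulrDr (c_const 1 s)) cG; ring.
Qed.

Let log_argument :
  (Num.sqrt (r0 r x z) + Num.sqrt (1 + r0 r x z) =
   (r ^+ 2 - dotv x z +
     Num.sqrt ((r ^+ 2 - enorm x ^+ 2) * (r ^+ 2 - enorm z ^+ 2))) /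
   (r * enorm (z - x)))%R.
Proof.
have m0 : (0 < enorm (z - x))%R by rewrite enorm_gt0 subr_eq0 eq_sym.
have rm : (0 < r * enorm (z - x))%R by rewrite mulr_gt0.
have eq_sq (u v : R) : (0 <= u)%R -> (0 <= v)%R -> (u ^+ 2 = v)%R -> Num.sqrt v = u.
  by move=> u0 v0 <-; rewrite sqrtr_sqr ger0_norm.
have mxz : enorm (x - z) = enorm (z - x) by rewrite -enormN opprB.
have dz : (0 < r ^+ 2 - dotv x z)%R.
  have := dotv_le x z; rewrite subr_gt0 => h; apply: le_lt_trans h _.
  rewrite expr2; apply: ltr_pM => //; exact: enorm_ge0.
have A0 : (0 <= (r ^+ 2 - enorm x ^+ 2) * (r ^+ 2 - enorm z ^+ 2))%R.
  by rewrite mulr_ge0// ltW// sqr_gap_gt0.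
rewrite (eq_sq (Num.sqrt ((r ^+ 2 - enorm x ^+ 2) * (r ^+ 2 - enorm z ^+ 2)) /
  (r * enorm (z - x)))%R (r0 r x z)); last 3 first.
- by rewrite divr_ge0 ?sqrtr_ge0 ?(ltW rm).
- exact: ltW.
- rewrite expr_div_n sqr_sqrtr// /r0 mxz exprMn.
  by [].
rewrite (eq_sq ((r ^+ 2 - dotv x z) / (r * enorm (z - x)))%R (1 + r0 r x z)%R); last 3 first.
- by rewrite divr_ge0 ?(ltW rm) ?(ltW dz).
- by rewrite addr_ge0// ltW.
- have xE (v : 'rV[R]_1) : (enorm v ^+ 2 = v 0 0 ^+ 2)%R.
    by rewrite enorm_rV1 real_normK ?num_real.
  have zx0 : (z 0 0 - x 0 0 != 0)%R.
    by move: m0; rewrite enorm_rV1 !mxE normr_gt0.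
  rewrite expr_div_n /r0 mxz exprMn !xE /dotv big_ord1 !mxE.
  by field; rewrite zx0 gt_eqF.
by rewrite -mulrDl addrC.
Qed.

Lemma Green_log : (s = 2^-1)%R ->
  Green s r x z =
  (pi^-1 * ln ((r ^+ 2 - dotv x z
                       + Num.sqrt ((r ^+ 2 - enorm x ^+ 2)
                                   * (r ^+ 2 - enorm z ^+ 2)))
                      / (r * enorm (z - x))))%:E.
Proof.
move=> sE; have ns : (1%:R == 2 * s :> R)%R by rewrite sE; apply/eqP; field.
have pp := @pi_gt0 R.
have m0 : (0 < enorm (z - x))%R by rewrite enorm_gt0 subr_eq0 eq_sym.
have c1 : c_const 1 s = (pi^-1 : R)%R by rewrite c_const1 sE sin_pihalf mul1r.
rewrite /Green /Phi ns /a_const ns.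
have -> : enorm (x - z) = enorm (z - x) by rewrite -enormN opprB.
pose h (t : R) := (- pi^-1 * ln t)%R.
rewrite (@integral_Poisson _ 1 s r x z _ _ _ _ _ h)//; last by rewrite /h; mf.
set T := r0 r x z.
(* The product of the constant [- 1 / pi] of [Phi] and [c_const 1 (1/2) = 1 / pi]. *)
pose c : R := (- (pi ^+ 2)^-1)%R.
(* The density has mass [pi], so the constant term [ln |z - x|] of the integrand integrates to
   exactly [Phi (x - z)] and cancels it. *)
transitivity ((h (enorm (z - x)))%:E -
  (c * (pi * (ln (enorm (z - x)) + ln (Num.sqrt T + Num.sqrt (1 + T)))))%:E); last first.
  rewrite -EFinB; congr _%:E.
  transitivity (pi^-1 * ln (Num.sqrt T + Num.sqrt (1 + T)))%R.
    rewrite /h /c; move: (ln _) (ln _) (pi : R) pp => l1 l2 P P0.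
    by field; rewrite gt_eqF.
  by rewrite log_argument.
congr (_ - _).
rewrite -(@integral_ball_log R r T r_gt0 T0 (x 0%R 0%R) (w 0%R 0%R)); last 2 first.
- by rewrite -ltr_norml -enorm_rV1.
- exact: wE.
rewrite integral_rV1_ball; last by rewrite /h; mf.
apply: (@integral_eq_except _ (x 0%R 0%R)) => //.
- apply: measurable_funTS; rewrite /h.
  have mc : measurable_fun setT (fun a : R => rV_cons (0%R : 'rV[R]_0, a)) by apply: mf_rV_cons; mf.
  by mf.
- by apply: measurable_funTS; mf.
move=> a; rewrite /= in_itv/= => ar ax; congr _%:E; move: ar.
have xaE : (enorm (rV_cons (0%R : 'rV[R]_0, a) - x) = `|x 0 0 - a|)%R.
  by rewrite enorm_rV1 sub_rV1 rV_cons1 distrC.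
have waE : (enorm (w - rV_cons (0%R : 'rV[R]_0, a)) = `|w 0 0 - a|)%R.
  by rewrite enorm_rV1 sub_rV1 rV_cons1.
move=> ar; have {}ar : (`|a| < r)%R by rewrite ltr_norml.
have e0 : (0 < `|x 0 0 - a|)%R by rewrite normr_gt0 subr_eq0 eq_sym.
have W0 : (0 < `|w 0 0 - a|)%R.
  rewrite normr_gt0 subr_eq0; apply: contraTneq ar => <-; rewrite -leNgt.
  by rewrite -enorm_rV1 ltW// inversion_image_gt.
rewrite xaE waE (enorm_rV1 (rV_cons _)) rV_cons1 real_normK ?num_real// c1.
rewrite (_ : 2 * s - 1%:R = 0)%R; last by rewrite sE; field.
rewrite powRr0 sE /h /c ln_div ?posrE ?mulr_gt0// lnM ?posrE//.
move: (ln _) (ln _) (ln _) (pi : R) pp => l1 l2 l3 P P0.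
by field; rewrite gt_eqF.
Qed.

End green1.

Theorem theorem3p1 (R : realType) (n : nat) (s : R) :
  (1 <= n)%N -> 0 < s < 1 ->
  exists kappa : R,
    forall (r : R) (x z : 'rV[R]_n),
      0 < r -> eball r x -> eball r z -> x != z ->
      (n%:R <> 2 * s ->
         Green s r x z =
         ((kappa * enorm (z - x) `^ (2 * s - n%:R))%:E
          * \int[lebesgue_measure]_(t in `[0%R, r0 r x z])
              (t `^ (s - 1) / (t + 1) `^ (n%:R / 2))%:E)%E)
      /\
      (n%:R = 2 * s ->
         Green s r x z =
         (kappa * ln ((r ^+ 2 - dotv x z
                       + Num.sqrt ((r ^+ 2 - enorm x ^+ 2)
                                   * (r ^+ 2 - enorm z ^+ 2)))
                      / (r * enorm (z - x))))%:E).
Proof.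
move=> n1 /andP[s0 s1].
(* Since [2 s < 2]. *)
have n_eq1 : n%:R <= 2 * s -> n = 1%N.
  move=> ns; apply/eqP; rewrite eqn_leq n1 andbT -ltnS -(ltr_nat R).
  by apply: le_lt_trans ns _; lra.
have [ns|ns|ns] := ltgtP (2 * s) n%:R.
(* [kappa] is read off the formula; it simplifies to [Gamma (n/2) / (2^(2 s) pi^(n/2)
   Gamma(s)^2)]. *)
- eexists => r x z r0 xr zr xz; split=> [_|e]; first exact: Green_exterior.
  by move: ns; rewrite e ltxx.
- have nE := n_eq1 (ltW ns); subst n.
  (* By the duplication formula this [kappa] has the same simplified value [Gamma (1/2) / (2^(2 s)
     pi^(1/2) Gamma(s)^2)]. *)
  eexists => r x z r0 xr zr xz; split=> [_|e].
    by apply: Green_power1 => //; lra.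
  by move: ns; rewrite e ltxx.
- have nE : n = 1%N by apply: n_eq1; rewrite ns.
  subst n; exists pi^-1 => r x z r0 xr zr xz; split=> [/(_ (esym ns))//|_].
  by apply: Green_log => //; lra.
Qed.
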